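(* Let $\alpha>0$, $\rho(\xi)=(1-\xi^2)_+^\alpha$ and $\phi(\xi)=(1-|\xi|)_+$. For $\psi\in\{\rho,\phi\}$ and $n\in\mathbb N$ let $$Q_n^\psi f(x)=\frac1{2n+1}\sum_{k=0}^{2n}f(t_k)\psi_n(x-t_k),\qquad \psi_n(x)=\sum_{k=-n}^n\psi\left(\frac kn\right)e^{ikx},\qquad t_k=\frac{2\pi k}{2n+1}.$$ Let $X=X(\mathbb T)$ be a Banach lattice satisfying Assumption A. Then for all $f\in X$, $r\in\mathbb N$ and $n\in\mathbb N$ $$\|f-Q_n^\rho f\|_X+\|f-Q_n^\rho f\|_{X_n}\asymp\|(I-\dot A_{\gamma/n})^2f\|_X+\|(I-A_{\gamma/n})^rf\|_{X_n}.$$ If, additionally, the Hilbert transform $H$ is bounded on $X$, then for all $f\in X$, $r\in\mathbb N$ and $n\in\mathbb N$ $$\|f-Q_n^\phi f\|_X+\|f-Q_n^\phi f\|_{X_n}\asymp\|(I-\dot A_{\gamma/n})f\|_X+\|(I-A_{\gamma/n})^rf\|_{X_n}.$$ Here $\asymp$ denotes a two-sided inequality with positive constants independent of $f$ and $n$.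
   Context: $\mathbb T$ is the unit circle identified with $[-\pi,\pi)$ (functions on $\mathbb T$ are $2\pi$-periodic), with normalized Lebesgue measure $\mu$. A Banach lattice $X=X(\mathbb T)$ is a Banach space of measurable functions on $\mathbb T$ such that: 1) if $f$ is measurable, $g\in X$ and $|f|\le|g|$, then $f\in X$ and $\|f\|_X\le\|g\|_X$; 2) if $f_n\in X$, $\sup_n\|f_n\|_X<\infty$ and $0\le f_n\uparrow f$, then $f\in X$ and $\|f_n\|_X\to\|f\|_X$; 3) for every measurable $E$ with $\mu(E)<\infty$, $\chi_E\in X$ and there is $c_E>0$ with $\int_E|f|\,d\mu\le c_E\|f\|_X$. Functions in $X$ are regarded as finite-valued and defined at every point, not as equivalence classes. Steklov averages: $A_hf(x)=\frac1h\int_{x-h/2}^{x+h/2}f(t)\,dt$ and $\dot A_hf(x)=A_hf(x+\tfrac h2)$ for $h>0$; $I$ is the identity. Assumption A: $A_hf\in X$ for all $f\in X$, $h>0$, and $\sup_{h>0,\,\|f\|_X\le1}\|A_hf\|_X<\infty$. The periodic Hilbert transform is $Hf(x)=\sum_{k\in\mathbb Z}(-i\,\mathrm{sgn}(k))\widehat f(k)e^{ikx}$, $\mathrm{sgn}(0)=0$, where $\widehat f(k)=\frac1{2\pi}\int_{\mathbb T}f(x)e^{-ikx}dx$. The discrete semi-norm is $\|f\|_{X_n}=\big\|\sum_{k=0}^{2n}|f(t_k)|\chi_{[t_k,t_{k+1})}\big\|_X$ with $t_{2n+1}=2\pi$. The constant $\gamma>0$ is a fixed constant such that $\frac\gamma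 n\le t_{k+1}-t_k=\frac{2\pi}{2n+1}$ for all $n\in\mathbb N$. *)

(* Defs.v *)
From HB Require Import structures.
From mathcomp Require Import all_boot all_order all_algebra.
From mathcomp Require Import all_classical all_reals all_analysis.
From mathcomp Require Import complex.

Set Implicit Arguments.
Unset Strict Implicit.
Unset Printing Implicit Defensive.

Import Order.TTheory GRing.Theory Num.Theory.
Import numFieldNormedType.Exports.

Local Open Scope classical_set_scope.
Local Open Scope ring_scope.
Local Open Scope complex_scope.

(* R equipped with the sigma-algebra of Lebesgue measurable sets (the library's
   canonical sigma-algebra on R is the Borel one). *)
Definition lebesgueType (R : realType) :=
  caratheodory_type (R := R) (T := ocitv_type R) (wlength idfun)^*%mu.

Notation leb := (@completed_lebesgue_measure _).

Definition lebesgue_measurable_fun (R : realType) (f : R -> R) : Prop :=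
  measurable_fun [set: lebesgueType R] (f : lebesgueType R -> R).

Definition lebesgue_measurable_set (R : realType) (E : set R) : Prop :=
  measurable (E : set (lebesgueType R)).

(* Functions on the unit circle are 2pi-periodic functions on the line with
   complex values, defined at every point. *)
Section Functions.
Variable R : realType.
Implicit Types (f g : R -> R[i]) (E : set R) (h x a b : R) (n k : nat).

Definition modulus (z : R[i]) : R := ComplexField.Normc.normc z.

Definition cexpi (t : R) : R[i] := cos t +i* sin t.

Definition torus : set R := `[- pi, pi[.

Definition torus_fun f : Prop :=
  [/\ forall x, f (x + 2 * pi) = f x,
      lebesgue_measurable_fun (fun x => complex.Re (f x)) &
      lebesgue_measurable_fun (fun x => complex.Im (f x))].

(* Integral with respect to dx; meaningful when f is integrable on E. *)
Definition cintegral E f : R[i] :=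
  (\int[leb]_(x in E) complex.Re (f x)) +i* (\int[leb]_(x in E) complex.Im (f x)).

(* int_E |f| d mu for E included in the torus, mu being the normalized
   Lebesgue measure. *)
Definition torus_integral_abs E f : \bar R :=
  (((2 * pi)^-1)%:E * \int[leb]_(x in E) (modulus (f x))%:E)%E.

(* Characteristic function of a subset of the circle, given by any set of
   representatives E. *)
Definition torus_indic E : R -> R[i] :=
  \1_[set x | exists m : int, E (x + m%:~R * (2 * pi))].

Definition steklov h f x : R[i] :=
  (h^-1)%:C * cintegral `[x - h / 2, x + h / 2] f.

Definition steklov_dot h f x : R[i] := steklov h f (x + h / 2).

Definition fourier_coef f (k : int) : R[i] :=
  ((2 * pi)^-1)%:C * cintegral torus (fun x => f x * cexpi (- (k%:~R * x))).

(* The Fourier series sum_k (-i sgn k) f^(k) e^(ikx) of Hf need not converge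
   pointwise: g is (a representative of) Hf when g is an integrable function
   having this Fourier series. *)
Definition is_hilbert_transform f g : Prop :=
  [/\ torus_fun g,
      (torus_integral_abs torus g < +oo)%E &
      forall k : int, fourier_coef g k = - (0 +i* 1) * (sgz k)%:~R * fourier_coef f k].

Definition node n k : R := 2 * pi * k%:R / (2 * n + 1)%:R.

Definition kernel_poly (psi : R -> R) n x : R[i] :=
  \sum_(k < 2 * n + 1)
    (psi ((k%:R - n%:R) / n%:R))%:C * cexpi ((k%:R - n%:R) * x).

Definition quasi_interp (psi : R -> R) n f x : R[i] :=
  ((2 * n + 1)%:R)^-1 *
  \sum_(k < 2 * n + 1) f (node n k) * kernel_poly psi n (x - node n k).

Definition sample_step n f x : R[i] :=
  \sum_(k < 2 * n + 1)
    (modulus (f (node n k)))%:C * torus_indic `[node n k, node n k.+1[ x.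

Definition riesz (alpha xi : R) : R := Num.max (1 - xi ^+ 2) 0 `^ alpha.

Definition fejer (xi : R) : R := Num.max (1 - `|xi|) 0.

End Functions.

(* Elements are functions, not classes; the norm identifies functions that
   agree almost everywhere. Outside the carrier bl_norm is unspecified. *)
Record banachLattice (R : realType) := BanachLattice {
  bl_carrier :> (R -> R[i]) -> Prop;
  bl_norm : (R -> R[i]) -> R;
  bl_torus_fun : forall f, bl_carrier f -> torus_fun f;
  bl_add : forall f g, bl_carrier f -> bl_carrier g -> bl_carrier (f \+ g);
  bl_scale : forall (c : R[i]) f,
    bl_carrier f -> bl_carrier (fun x => c * f x);
  bl_norm_ge0 : forall f, bl_carrier f -> 0 <= bl_norm f;
  bl_norm_eq0 : forall f, bl_carrier f ->
    (bl_norm f = 0 <-> {ae leb, forall x, f x = 0});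
  bl_normD : forall f g, bl_carrier f -> bl_carrier g ->
    bl_norm (f \+ g) <= bl_norm f + bl_norm g;
  bl_normZ : forall (c : R[i]) f, bl_carrier f ->
    bl_norm (fun x => c * f x) = modulus c * bl_norm f;
  bl_complete : forall u : nat -> R -> R[i],
    (forall n, bl_carrier (u n)) ->
    (forall e : R, 0 < e -> exists N : nat, forall m n : nat,
       (N <= m)%N -> (N <= n)%N -> bl_norm (u m \- u n) < e) ->
    exists2 f, bl_carrier f & bl_norm (u n \- f) @[n --> \oo] --> (0 : R);
  bl_ideal : forall f g, torus_fun f -> bl_carrier g ->
    (forall x, modulus (f x) <= modulus (g x)) ->
    bl_carrier f /\ bl_norm f <= bl_norm g;
  bl_fatou : forall (u : nat -> R -> R) (f : R -> R),
    (forall n, bl_carrier (fun x => (u n x)%:C)) ->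
    (exists M : R, forall n, bl_norm (fun x => (u n x)%:C) <= M) ->
    (forall n x, 0 <= u n x <= u n.+1 x) ->
    (forall x, u n x @[n --> \oo] --> f x) ->
    bl_carrier (fun x => (f x)%:C) /\
    bl_norm (fun x => (u n x)%:C) @[n --> \oo] --> bl_norm (fun x => (f x)%:C);
  (* mu(E) is finite for every measurable subset E of the circle *)
  bl_indic : forall E : set R, lebesgue_measurable_set E -> E `<=` @torus R ->
    bl_carrier (torus_indic E) /\
    exists2 c : R, 0 < c & forall f, bl_carrier f ->
      (torus_integral_abs E f <= (c * bl_norm f)%:E)%E
}.

Section Lattice.
Variables (R : realType) (X : banachLattice R).

Definition discrete_norm (n : nat) (f : R -> R[i]) : R :=
  bl_norm X (sample_step n f).

Definition assumptionA : Prop :=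
  (forall f h, X f -> 0 < h -> X (steklov h f)) /\
  exists M : R, forall f h, X f -> 0 < h -> bl_norm X f <= 1 ->
    bl_norm X (steklov h f) <= M.

Definition hilbert_bounded : Prop :=
  exists M : R, forall f, X f ->
    exists g, [/\ X g, is_hilbert_transform f g &
                  bl_norm X g <= M * bl_norm X f].

End Lattice.

(* Main.v *)
(* Put xi = k/n and h = gamma/n. On frequencies the averages act through smooth
   functions of xi: 1 - A_h is of order xi^2, the forward average satisfies
   1 - Adot_h = - i gamma xi b(gamma xi) with b nowhere zero, and on
   trigonometric polynomials of degree at most n, by discrete orthogonality, Q_n
   multiplies by psi(xi). So on such polynomials 1 - Q_n, (I - Adot_h)^2 and
   I - A_h (Riesz case), or their versions composed with the Hilbert transform
   (Fejer case, |xi| = sgn(xi) xi), differ by multipliers which are bounded on X.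

   A multiplier G(k/n) is bounded on X as soon as its kernel is dominated by a
   geometric combination of normalized boxes, since each box is a Steklov average.
   For G of class C^{1,1} and compactly supported this follows from second
   differences of the coefficients, and for the kernels of Q_n from the concavity
   of (1 - xi^2)^a, a <= 1, and of 1 - |xi|; other powers are products of these.

   To reach polynomials from a general f, one uses
   1 = (1 - a)^2 (1 + 2a) + a^2 (3 - 2a) for the multiplier a of Adot_h: the last
   term is smooth at scale h, so that a Jackson inequality makes its high frequency
   part small, and the rest is controlled by (I - Adot_h)^2 f. The discrete
   semi-norm of an average is dominated by the norm in X, which handles A_h and
   polynomials in X_n, and Q_n f factors through the step function with the values
   f(t_k), whose norm is the semi-norm of f. *)

From HB Require Import structures.
From mathcomp Require Import all_boot all_order all_algebra.
From mathcomp Require Import all_classical all_reals all_analysis.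
From mathcomp Require Import measurable_realfun.
From mathcomp Require Import complex.
From mathcomp Require Import ring lra zify.
Require Import Defs.

Set Implicit Arguments.
Unset Strict Implicit.
Unset Printing Implicit Defensive.

Import Order.TTheory GRing.Theory Num.Theory.
Import numFieldNormedType.Exports.

Local Open Scope classical_set_scope.
Local Open Scope ring_scope.

(** * Lebesgue measurability and translations *)

Section LebesgueBorel.
Variable R : realType.
Implicit Types (f g : R -> R) (A N : set R).
Local Notation mu := (@lebesgue_measure R).
Local Notation lb := (@completed_lebesgue_measure R).

(** Neither continuity of translations nor density of polynomials is available in the lattice, and
    the values at the nodes are not controlled by the norm; the only tool is the uniform bound on
    Steklov averages. Hence estimates in [X] are reduced to pointwise majorants by averages of |f|,
    and these also survive sampling.

    Two places need more. The tail of f beyond a multiple of n cannot be reached by a limiting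
    argument: it is bounded by the second difference plus half of a similar tail, and absorbed,
    which is legitimate because norms are finite. In the lower Riesz estimate 1 - rho has to be
    inverted up to |xi| = 1, where xi^2 / (1 - rho) need not be C^{1,1} when alpha is small. One
    writes 1 - rho^p = (1 - rho)(1 + rho + ... + rho^(p-1)) with p alpha >= 3: only the smooth 1 -
    rho^p is inverted, and the sum is bounded by products of bounded multipliers. The upper
    estimates avoid the edge altogether, by comparing f with a polynomial of degree below n / 4. *)

Lemma borel_lebesgue_set A : measurable A -> lebesgue_measurable_set A.
Proof. by move=> mA; apply: sub_caratheodory. Qed.

Lemma lebesgue_negligible_measurable A N :
  measurable N -> mu N = 0%E -> A `<=` N -> lebesgue_measurable_set A.
Proof.
move=> mN N0 AN; apply: negligible_sub_caratheodory.
exists N; split => //; exact: borel_lebesgue_set.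
Qed.

(** The Caratheodory sigma-algebra is the completion of the Borel one, so its members are Borel up
    to a subset of a Borel null set. *)
Lemma lebesgue_set_borel A : lebesgue_measurable_set A ->
  exists B N, [/\ measurable B, measurable N, mu N = 0%E &
    A `\` N = B `\` N].
Proof.
rewrite /lebesgue_measurable_set => mA.
have : (completed_algebra_gen mu).-sigma.-measurable A.
  by rewrite completed_caratheodory_measurable.
rewrite g_sigma_completed_algebra_genE => -[B mB [M [N [mN N0 MN]]]] <-.
exists B, N; split => //.
apply/seteqP; split => x [] /=; last by move=> Bx Nx; split => //; left.
by move=> [Bx|Mx] Nx; split => //; exact: (False_ind _ (Nx (MN _ Mx))).
Qed.

Lemma lebesgue_set_congr A B N : measurable N -> mu N = 0%E ->
  A `\` N = B `\` N -> lebesgue_measurable_set B -> lebesgue_measurable_set A.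
Proof.
move=> mN N0 AB mB.
have -> : A = (B `\` N) `|` (A `&` N).
  by rewrite -AB setUC -[A in LHS](setUIDK A N) setUC setUC.
apply: measurableU.
  by apply: measurableD => //; exact: borel_lebesgue_set.
by apply: (lebesgue_negligible_measurable mN N0).
Qed.

(** Each sublevel set at a rational height is Borel off a null set; discarding the union of these
    countably many null sets, and putting 0 there, leaves a Borel function. This gives Lebesgue
    measurable functions access to translation of integrals and to Fubini, both obtained on the
    Borel side. *)
Lemma lebesgue_fun_borel f : lebesgue_measurable_fun f <->
  exists g N, [/\ measurable_fun setT g, measurable N, mu N = 0%E &
    forall x, ~ N x -> f x = g x].
Proof.
split=> [mf|[g [N [mg mN N0 fg]]]].
  have mfq (q : rat) : lebesgue_measurable_set [set x | f x < ratr q].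
    have := mf measurableT `]-oo, (ratr q)[%classic (measurable_itv _).
    rewrite setTI /lebesgue_measurable_set.
    suff -> : [set x | f x < ratr q] = f @^-1` `]-oo, (ratr q)[ by [].
    by apply/seteqP; split => x /=; rewrite in_itv.
  pose B q := projT1 (cid (lebesgue_set_borel (mfq q))).
  pose N q := projT1 (cid (projT2 (cid (lebesgue_set_borel (mfq q))))).
  have BNP q : [/\ measurable (B q), measurable (N q), mu (N q) = 0%E &
    [set x | f x < ratr q] `\` N q = B q `\` N q].
    exact: (projT2 (cid (projT2 (cid (lebesgue_set_borel (mfq q)))))).
  (* Reindexing by the natural numbers through the encoding of the rationals, so that the union of
     null sets is a countable union over [nat]. *)
  pose N' k := if unpickle k is Some q then N q else set0.
  have N'P k : measurable (N' k) /\ mu (N' k) = 0%E.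
    rewrite /N'; case: unpickle => [q|]; last by split => //; rewrite measure0.
    by have [] := BNP q.
  pose M := \bigcup_k N' k.
  have NM q : N q `<=` M.
    have E : N' (pickle q) = N q by rewrite /N' pickleK.
    by move=> x Nx; exists (pickle q); [exact: I|rewrite E; exact: Nx].
  have mM : measurable M by apply: bigcupT_measurable => k; case: (N'P k).
  have M0 : mu M = 0%E.
    apply/eqP; rewrite -measure_le0.
    have : mu.-negligible M.
      by apply: negligible_bigcup => k; exists (N' k); have [mNk Nk0] := N'P k; split.
    case=> C [mC C0 MC]; rewrite -C0; apply: le_measure => //; by rewrite inE.
  have mB q : measurable (B q) by case: (BNP q).
  exists (fun x => if x \in M then 0 else f x), M; split => //; last first.
    by move=> x Mx; rewrite memNset.
  apply: (measurability _ (RGenInftyO.measurableE R)) => _ /= -[_ [r ->] <-].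
  rewrite setTI.
  pose C := \bigcup_(q in [set q : rat | ratr q <= r]) (B q `\` M).
  have mC : measurable C.
    rewrite /C bigcup_mkcond; apply: bigcupT_measurable_rat => q.
    by case: ifP => // _; apply: measurableD.
  suff -> : (fun x => if x \in M then 0 else f x) @^-1` `]-oo, r[ =
      C `|` (M `&` [set x | 0 < r]).
    apply: measurableU => //; apply: measurableI => //.
    have [r0|r0] := ltP 0 r.
      by rewrite (_ : [set x | _] = setT)//; apply/seteqP.
    by rewrite (_ : [set x | _] = set0)//; apply/seteqP; split.
  apply/seteqP; split => x /=; rewrite in_itv /=.
    case: ifPn => [/set_mem Mx r0|/negP Mx fr]; first by right.
    have nMx : ~ M x by move=> ?; apply: Mx; rewrite inE.
    left; have [q] := rat_in_itvoo fr; rewrite in_itv /= => /andP[fq qr].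
    exists q; first exact: ltW.
    split => //; case: (BNP q) => _ _ _ E.
    suff : (B q `\` N q) x by case.
    by rewrite -E; split => //= Nx; apply: nMx; exact: NM Nx.
  case=> [[q /= qr [Bx Mx]]|[Mx r0]]; last by rewrite mem_set.
  rewrite memNset//; apply: lt_le_trans qr.
  case: (BNP q) => _ _ _ E.
  suff : ([set x | f x < ratr q] `\` N q) x by case.
  by rewrite E; split => // Nx; apply: Mx; exact: NM Nx.
move=> _ Y mY; rewrite setTI.
apply: (lebesgue_set_congr mN N0 (B := g @^-1` Y)).
  rewrite eqEsubset; split => x [] /= fY Nx; split => //=.
    by rewrite /preimage/= -fg.
  by rewrite /preimage/= fg.
apply: borel_lebesgue_set; rewrite -(setTI (g @^-1` Y)); exact: mg.
Qed.
End LebesgueBorel.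

(** * Integrals for the completed and for the Borel measure *)

Section LebesgueIntegral.
Variable R : realType.
Implicit Types (f g : R -> R) (D A N : set R) (h : R -> \bar R).
Local Notation mu := (@lebesgue_measure R).
Local Notation lb := (@completed_lebesgue_measure R).

Lemma borel_lebesgue_fun g : measurable_fun setT g -> lebesgue_measurable_fun g.
Proof.
move=> mg _ Y mY; apply: borel_lebesgue_set.
exact: mg.
Qed.

(** The identity, from the Lebesgue to the Borel sigma-algebra, is measurable and pushes the
    completed measure to the Borel one. *)
Lemma ge0_lebesgue_integralE D h : measurable D -> measurable_fun setT h ->
  (forall x, 0 <= h x)%E ->
  (\int[lb]_(x in D) h x = \int[mu]_(x in D) h x)%E.
Proof.
move=> mD mh h0.
have mid : measurable_fun [set: lebesgueType R] (fun x : lebesgueType R => x : measurableTypeR R).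
  by apply: (@borel_lebesgue_fun (fun x => x)); exact: measurable_id.
rewrite -[LHS](@ge0_integral_pushforward _ _ _ _ R _ mid lb D h) //; last first.
  exact: (measurable_funTS mh).
Qed.

Lemma lebesgue_integralE D h : measurable D -> measurable_fun setT h ->
  (\int[lb]_(x in D) h x = \int[mu]_(x in D) h x)%E.
Proof.
move=> mD mh; rewrite integralE [RHS]integralE.
congr (_ - _)%E; apply: ge0_lebesgue_integralE => //.
  exact: measurable_funepos.
exact: measurable_funeneg.
Qed.

(** Uniqueness of Lebesgue measure: its image under a translation has the same values on half-open
    intervals. *)
Lemma lebesgue_measure_shift A (s : R) : measurable A ->
  mu A = mu ((fun x => x + s) @^-1` A).
Proof.
move=> mA.
have ms : measurable_fun [set: measurableTypeR R] (fun x : measurableTypeR R => x + s : measurableTypeR R) by exact: measurable_funD.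
apply: (@lebesgue_measure_unique R (measure_function_pushforward__canonical__measure_function_Measure mu ms)) => // X [[a b] _ <-].
rewrite /= /pushforward.
have -> : (fun x => x + s) @^-1` `]a, b] = `]a - s, b - s]%classic.
  by apply/seteqP; split => x /=; rewrite !in_itv /= ltrBlDr lerBrDr.
rewrite !lebesgue_measure_itv /= !lte_fin ltrD2r; case: ifP => // _.
by rewrite -!EFinB opprB addrA subrK.
Qed.

Lemma ge0_integral_shift D h s : measurable D -> measurable_fun setT h ->
  (forall x, 0 <= h x)%E ->
  (\int[mu]_(x in (fun x => x + s)%R @^-1` D) h (x + s)%R = \int[mu]_(x in D) h x)%E.
Proof.
move=> mD mh h0.
have ms : measurable_fun [set: measurableTypeR R] (fun x : measurableTypeR R => x + s : measurableTypeR R) by exact: measurable_funD.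
rewrite -(@ge0_integral_pushforward _ _ _ _ R _ ms mu D h) //; last first.
  exact: (measurable_funTS mh).
by apply: eq_measure_integral => A mA _ /=; rewrite [RHS](lebesgue_measure_shift s).
Qed.

Lemma integral_shift D h s : measurable D -> measurable_fun setT h ->
  (\int[mu]_(x in (fun x => x + s)%R @^-1` D) h (x + s)%R = \int[mu]_(x in D) h x)%E.
Proof.
move=> mD mh; rewrite integralE [RHS]integralE.
congr (_ - _)%E.
  rewrite -[X in X^\+%E]/(h \o (fun x => x + s)%R) funepos_comp.
  by apply: (ge0_integral_shift (h := h^\+%E)) => //; exact: measurable_funepos.
rewrite -[X in X^\-%E]/(h \o (fun x => x + s)%R) funeneg_comp.
by apply: (ge0_integral_shift (h := h^\-%E)) => //; exact: measurable_funeneg.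
Qed.

Lemma lebesgue_fun_shift f s :
  lebesgue_measurable_fun f -> lebesgue_measurable_fun (fun x => f (x + s)).
Proof.
move=> /lebesgue_fun_borel[g [N [mg mN N0 fg]]].
have ms : measurable_fun [set: measurableTypeR R] (fun x : measurableTypeR R => x + s : measurableTypeR R) by exact: measurable_funD.
apply/lebesgue_fun_borel; exists (fun x => g (x + s)), ((fun x => x + s) @^-1` N).
split.
- exact: (measurableT_comp mg ms).
- by rewrite -[_ @^-1` _]setTI; exact: ms.
- by rewrite -lebesgue_measure_shift.
- by move=> x Nx; exact: fg.
Qed.

(** The outer function [phi] lets one statement serve for [f], for its absolute value and for its
    product with a constant. *)
Lemma lebesgue_integral_borel D f g N (phi : R -> \bar R) :
  measurable D -> measurable_fun setT phi -> measurable_fun setT g ->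
  measurable N -> mu N = 0%E -> (forall x, ~ N x -> f x = g x) ->
  (\int[lb]_(x in D) phi (f x) = \int[mu]_(x in D) phi (g x))%E.
Proof.
move=> mD mphi mg mN N0 fg.
rewrite -lebesgue_integralE//; last exact: (measurableT_comp mphi mg).
have mf : lebesgue_measurable_fun f.
  by apply/lebesgue_fun_borel; exists g, N.
have mgl := borel_lebesgue_fun mg.
apply: ae_eq_integral.
- exact: borel_lebesgue_set.
- by apply: measurable_funTS; apply: measurableT_comp => //; exact: mf.
- by apply: measurable_funTS; apply: measurableT_comp => //; exact: mgl.
exists N; split => //; first exact: borel_lebesgue_set.
by move=> x /= /not_implyP[Dx] H; apply: contrapT => Nx; apply: H; rewrite fg.
Qed.

Lemma lebesgue_integral_shift D f s (phi : R -> \bar R) :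
  measurable D -> measurable_fun setT phi -> lebesgue_measurable_fun f ->
  (\int[lb]_(x in (fun x => x + s)%R @^-1` D) phi (f (x + s)%R) =
   \int[lb]_(x in D) phi (f x))%E.
Proof.
move=> mD mphi /lebesgue_fun_borel[g [N [mg mN N0 fg]]].
have ms : measurable_fun [set: measurableTypeR R] (fun x : measurableTypeR R => x + s : measurableTypeR R) by exact: measurable_funD.
have msA A : measurable A -> measurable ((fun x => x + s) @^-1` A).
  by move=> mA; rewrite -[_ @^-1` _]setTI; exact: ms.
rewrite (lebesgue_integral_borel mD mphi mg mN N0 fg).
rewrite (@lebesgue_integral_borel _ (fun x => f (x + s)) (fun x => g (x + s))
  ((fun x => x + s) @^-1` N))//.
- by rewrite (integral_shift (h := fun x => phi (g x)))//; exact: (measurableT_comp mphi mg).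
- exact: msA.
- exact: (measurableT_comp mg ms).
- exact: msA.
- by rewrite -lebesgue_measure_shift.
- by move=> x Nx; exact: fg.
Qed.
End LebesgueIntegral.

(** * Integrals over intervals *)

Section RealIntervalIntegral.
Variable R : realType.
Implicit Types (f g : R -> R) (a b c s : R).
Local Notation mu := (@lebesgue_measure R).
Local Notation lb := (@completed_lebesgue_measure R).

(** Bounded intervals rather than one period, because the averages use windows of any length and
    position. *)
Definition loc_integrable f : Prop :=
  lebesgue_measurable_fun f /\ forall a b, lb.-integrable `[a, b] (EFin \o f).

Definition itv_integral a b f : R := \int[lb]_(x in `[a, b]) f x.

Lemma leb_measurable_itv (i : interval R) :
  measurable ([set` i] : set (lebesgueType R)).
Proof. exact: (borel_lebesgue_set (measurable_itv i)). Qed.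
Local Hint Resolve leb_measurable_itv : core.

Lemma loc_integrableD f g : loc_integrable f -> loc_integrable g ->
  loc_integrable (fun x => f x + g x).
Proof.
move=> [mf jf] [mg jg]; split; first exact: measurable_funD.
by move=> a b; apply: (integrableD (leb_measurable_itv _) (jf a b) (jg a b)).
Qed.

Lemma loc_integrableZ k f : loc_integrable f -> loc_integrable (fun x => k * f x).
Proof.
move=> [mf jf]; split; first exact: measurable_funM.
by move=> a b; apply: (integrableZl (leb_measurable_itv _) k (jf a b)).
Qed.

Lemma loc_integrable_dom f g : lebesgue_measurable_fun f -> loc_integrable g ->
  (forall x, `|f x| <= g x) -> loc_integrable f.
Proof.
move=> mf [mg jg] fg; split => // a b.
apply: (le_integrable (leb_measurable_itv _) _ _ (jg a b)).
  by apply/measurable_EFinP; exact: measurable_funTS.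
by move=> x _ /=; rewrite lee_fin (le_trans (fg x))// ler_norm.
Qed.

Lemma loc_integrable_norm f : loc_integrable f -> loc_integrable (fun x => `|f x|).
Proof.
move=> [mf jf]; split; first exact: measurableT_comp.
move=> a b; exact: (integrable_norm (jf a b)).
Qed.

Lemma loc_integrable_cst k : loc_integrable (fun=> k).
Proof.
split; first exact: measurable_cst.
move=> a b; apply: measurable_bounded_integrable => //.
- have := lebesgue_measure_itv `[a, b]; rewrite /= /lebesgue_measure => E.
  by rewrite [X in (X < _)%E]E /=; case: ifP => _; rewrite ?ltry// -EFinB ltry.
- exact: bounded_cst.
Qed.

Lemma continuous_lebesgue_fun f : continuous f -> lebesgue_measurable_fun f.
Proof. by move=> cf; apply: borel_lebesgue_fun; exact: continuous_measurable_fun. Qed.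

Lemma loc_integrableM f g k : loc_integrable f -> lebesgue_measurable_fun g ->
  (forall x, `|g x| <= k) -> loc_integrable (fun x => f x * g x).
Proof.
move=> jf mg gk.
apply: (@loc_integrable_dom _ (fun x => k * `|f x|)).
- by apply: measurable_funM => //; case: jf.
- exact/loc_integrableZ/loc_integrable_norm.
- by move=> x; rewrite normrM mulrC ler_wpM2r.
Qed.

Lemma loc_integrable_shift f s : loc_integrable f -> loc_integrable (fun x => f (x + s)).
Proof.
move=> [mf jf]; split; first exact: lebesgue_fun_shift.
move=> a b; apply/integrableP; split.
  by apply/measurable_EFinP; apply: measurable_funTS; exact: lebesgue_fun_shift.
have /integrableP[_] := jf (a + s) (b + s); apply: le_lt_trans.
have -> : `[a, b]%classic = (fun x => x + s) @^-1` `[a + s, b + s].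
  by apply/seteqP; split => x /=; rewrite !in_itv /= !lerD2r.
rewrite (@lebesgue_integral_shift R `[a + s, b + s] f s (fun y => `|y%:E|%E))//.
by apply: measurableT_comp => //; apply/measurable_EFinP.
Qed.

Lemma itv_integral_shift a b s f : loc_integrable f ->
  itv_integral a b (fun x => f (x + s)) = itv_integral (a + s) (b + s) f.
Proof.
move=> [mf jf]; rewrite /itv_integral /Rintegral; congr fine.
have -> : `[a, b]%classic = (fun x => x + s) @^-1` `[a + s, b + s].
  by apply/seteqP; split => x /=; rewrite !in_itv /= !lerD2r.
by rewrite (@lebesgue_integral_shift R `[a + s, b + s] f s EFin)//; exact/measurable_EFinP.
Qed.

Lemma itv_integralD a b f g : loc_integrable f -> loc_integrable g ->
  itv_integral a b (fun x => f x + g x) = itv_integral a b f + itv_integral a b g.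
Proof. by move=> [_ jf] [_ jg]; apply: RintegralD. Qed.

Lemma itv_integralZ a b k f : loc_integrable f ->
  itv_integral a b (fun x => k * f x) = k * itv_integral a b f.
Proof. by move=> [_ jf]; apply: RintegralZl. Qed.

Lemma itv_integral_le a b f g : loc_integrable f -> loc_integrable g ->
  (forall x, a <= x <= b -> f x <= g x) -> itv_integral a b f <= itv_integral a b g.
Proof.
by move=> [_ jf] [_ jg] fg; apply: le_Rintegral.
Qed.

Lemma itv_integral_ge0 a b f : (forall x, a <= x <= b -> 0 <= f x) ->
  0 <= itv_integral a b f.
Proof. by move=> f0; apply: Rintegral_ge0 => x /=; rewrite in_itv; exact: f0. Qed.

Lemma eq_itv_integral a b f g : (forall x, a <= x <= b -> f x = g x) ->
  itv_integral a b f = itv_integral a b g.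
Proof. by move=> fg; apply: eq_Rintegral => x; rewrite inE /= in_itv; exact: fg. Qed.

Lemma lebesgue_point c : lb [set c] = 0%E.
Proof. exact: (@lebesgue_measure_set1 R c). Qed.

Lemma Rintegral_point c f : \int[lb]_(x in [set c]) f x = 0.
Proof.
rewrite /Rintegral null_set_integral; [by []| | |].
- by apply: (borel_lebesgue_set (measurable_set1 c)).
- by apply: measurable_fun_set1.
- exact: lebesgue_point.
Qed.

Lemma itv_integral_cc_co a b f : loc_integrable f -> a <= b ->
  itv_integral a b f = \int[lb]_(x in `[a, b[) f x.
Proof.
move=> [_ jf] ab; rewrite /itv_integral -(@setUitv1 _ _ _ _ true) ?bnd_simp//.
rewrite Rintegral_setU//.
- by rewrite Rintegral_point addr0.
- by apply: (borel_lebesgue_set (measurable_set1 b)).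
- by rewrite (@setUitv1 _ _ _ _ true) ?bnd_simp//; exact: jf.
- by apply/disj_set2P/seteqP; split => x //= -[] + xb; rewrite in_itv /= xb ltxx andbF.
Qed.

Lemma itv_integral_cat a b c f : loc_integrable f -> a <= b -> b <= c ->
  itv_integral a c f = itv_integral a b f + itv_integral b c f.
Proof.
move=> jf ab bc; rewrite (itv_integral_cc_co jf ab).
rewrite /itv_integral -Rintegral_setU//.
- by rewrite -itv_bndbnd_setU ?bnd_simp.
- by rewrite -itv_bndbnd_setU ?bnd_simp//; case: jf => _; exact.
- apply/disj_set2P/seteqP; split => x //= -[]; rewrite !in_itv /= => /andP[_ xb] /andP[bx _].
  by have := lt_le_trans xb bx; rewrite ltxx.
Qed.

Lemma itv_integral_cst a b k : a <= b -> itv_integral a b (fun=> k) = k * (b - a).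
Proof.
move=> ab; rewrite /itv_integral Rintegral_cst//; congr (_ * _).
have := lebesgue_measure_itv `[a, b]; rewrite /= /lebesgue_measure => E.
rewrite [X in fine X]E /= lte_fin; case: ltP => // ba.
by rewrite (le_anti (_ : a <= b <= a)) ?subrr// ab.
Qed.

Lemma itv_integral_FTC a b f F : a <= b ->
  (forall x, is_derive x (1 : R) F (f x)) -> continuous f ->
  itv_integral a b f = F b - F a.
Proof.
move=> ab dF cf; move: ab; rewrite le_eqVlt => /predU1P[->|ab].
  by rewrite subrr /itv_integral set_itv1 Rintegral_point.
rewrite /itv_integral /Rintegral lebesgue_integralE//; last first.
  by apply/measurable_EFinP; exact: continuous_measurable_fun.
have cF : continuous F.
  by move=> x; have [dFx _] := dF x; apply: differentiable_continuous; exact/derivable1_diffP.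
rewrite (@continuous_FTC2 R f F a b)//.
- exact: continuous_subspaceT.
- split => //.
    exact/cvg_at_right_filter/cF.
  exact/cvg_at_left_filter/cF.
- by move=> x _; rewrite derive1E; have [_] := dF x.
Qed.

Lemma itv_integral_widen a b a' b' f : loc_integrable f -> (forall x, 0 <= f x) ->
  a' <= a -> a <= b -> b <= b' -> itv_integral a b f <= itv_integral a' b' f.
Proof.
move=> jf f0 aa ab bb.
rewrite (itv_integral_cat jf aa (le_trans ab bb)) (itv_integral_cat jf ab bb).
have := @itv_integral_ge0 a' a f (fun x _ => f0 x).
have := @itv_integral_ge0 b b' f (fun x _ => f0 x).
by lra.
Qed.

End RealIntervalIntegral.
#[global] Hint Extern 0 (measurable [set` _]) => (apply: leb_measurable_itv) : core.

(** * Exchange of the integrals of f(x + s) g(x) *)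

Section FubiniShift.
Variable R : realType.
Implicit Types (f g : R -> R) (a b c d k : R).
Local Notation mu := (@lebesgue_measure R).
Local Notation lb := (@completed_lebesgue_measure R).
Local Notation T := (measurableTypeR R).

Lemma itv_integralK a b f : loc_integrable f ->
  (itv_integral a b f)%:E = (\int[lb]_(x in `[a, b]) (f x)%:E)%E.
Proof. by move=> [_ jf]; rewrite fineK//; apply: integrable_fin_num. Qed.

Lemma integral_indic_itv a b (h h' : R -> \bar R) :
  (forall x, a <= x <= b -> h x = h' x) ->
  (forall x, ~~ (a <= x <= b) -> h x = 0%E) ->
  (\int[mu]_x h x = \int[mu]_(x in `[a, b]) h' x)%E.
Proof.
move=> hh h0; rewrite [RHS]integral_mkcond; apply: eq_integral => x _.
by rewrite patchE mem_setE in_itv /=; case: ifPn => [|/h0//]; exact: hh.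
Qed.

(** Fubini needs joint measurability of (x, s) -> f(x + s), which is immediate for a Borel
    representative [f0] of [f]. On every line where x or s is fixed, the exceptional set is a
    translate of the null set [N], so the inner integrals do not change. *)
Lemma itv_integral_swap a b c d f g k : loc_integrable f ->
  measurable_fun setT g -> (forall x, `|g x| <= k) ->
  itv_integral a b (fun x => itv_integral c d (fun s => f (x + s)) * g x) =
  itv_integral c d (fun s => itv_integral a b (fun x => f (x + s) * g x)).
Proof.
move=> jf mg gk.
have gk0 : 0 <= k by apply: le_trans (gk 0).
case: (jf) => mf _; have /lebesgue_fun_borel[f0 [N [mf0 mN N0 ff0]]] := mf.
have mgl : lebesgue_measurable_fun g by exact: borel_lebesgue_fun.
(* The rectangle enters through indicator factors, so that Fubini is applied on the whole plane. *)
pose I1 (x : T) : R := \1_`[a, b] x.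
pose I2 (x : T) : R := \1_`[c, d] x.
pose H (z : T * T) : R := f0 (z.1 + z.2) * g z.1 * (I1 z.1 * I2 z.2).
have I1E x : a <= x <= b -> I1 x = 1.
  by move=> h; rewrite /I1 indicE mem_setE in_itv /= h.
have I2E x : c <= x <= d -> I2 x = 1.
  by move=> h; rewrite /I2 indicE mem_setE in_itv /= h.
have I10 x : ~~ (a <= x <= b) -> I1 x = 0.
  by move=> /negbTE h; rewrite /I1 indicE mem_setE in_itv /= h.
have I20 x : ~~ (c <= x <= d) -> I2 x = 0.
  by move=> /negbTE h; rewrite /I2 indicE mem_setE in_itv /= h.
have mI1 : measurable_fun [set: T] I1 by apply: measurable_indic; exact: measurable_itv.
have mI2 : measurable_fun [set: T] I2 by apply: measurable_indic; exact: measurable_itv.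
have mH : measurable_fun [set: T * T] H.
  have m12 : measurable_fun [set: T * T] (fun z : T * T => z.1 + z.2 : R).
    by apply: measurable_funD.
  apply: measurable_funM; first apply: measurable_funM.
  - exact: (measurableT_comp mf0 m12).
  - exact: (measurableT_comp mg).
  - by apply: measurable_funM; [exact: (measurableT_comp mI1)|exact: (measurableT_comp mI2)].
have mEH : measurable_fun [set: T * T] (EFin \o H) by exact/measurable_EFinP.
have shN x : measurable ((fun s => s + x) @^-1` N : set T) /\ mu ((fun s => s + x) @^-1` N) = 0%E.
  split; last by rewrite -lebesgue_measure_shift.
  rewrite -[_ @^-1` _]setTI; apply: (_ : measurable_fun setT (fun s : T => s + x : T)) => //.
  exact: measurable_funD.
have mf0s x : measurable_fun [set: T] (fun s : T => f0 (s + x) : R).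
  by apply: (measurableT_comp mf0); exact: measurable_funD.
have jfx x : loc_integrable (fun s => f (x + s)).
  have := loc_integrable_shift x jf; rewrite (_ : (fun _ => f (_ + x)) = fun s => f (x + s))//.
  by apply/funext => s; rewrite addrC.
have jfs s : loc_integrable (fun x => f (x + s) * g x).
  apply: (loc_integrableM (k := k)) => //; exact: loc_integrable_shift.
have Fx x : a <= x <= b -> (\int[mu]_s (H (x, s))%:E)%E =
    (itv_integral c d (fun s => f (x + s)) * g x)%:E.
  move=> xab; rewrite mulrC -itv_integralZ// itv_integralK; last exact: loc_integrableZ.
  rewrite (@integral_indic_itv c d _ (fun s => (g x * f0 (x + s))%:E)).
  - rewrite -(@lebesgue_integral_borel R _ (fun s => f (x + s)) (fun s => f0 (x + s))
      ((fun s => s + x) @^-1` N) (fun y => (g x * y)%:E)) => //.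
    + by apply/measurable_EFinP; exact: measurable_funM.
    + have := mf0s x; rewrite (_ : (fun _ => f0 (_ + x)) = fun s => f0 (x + s))//.
      by apply/funext => s; rewrite addrC.
    + by case: (shN x).
    + by case: (shN x).
    + by move=> s Ns; apply: ff0; rewrite addrC.
  - by move=> s scd; rewrite /H /= I1E// I2E// !mulr1 mulrC.
  - by move=> s scd; rewrite /H /= I20// !mulr0.
have Fs s : c <= s <= d -> (\int[mu]_x (H (x, s))%:E)%E =
    (itv_integral a b (fun x => f (x + s) * g x))%:E.
  move=> scd; rewrite itv_integralK//.
  have mfgB : measurable_fun [set: T] (fun x : T => f0 (x + s) * g x).
    by apply: measurable_funM => //; exact: mf0s.
  rewrite (@integral_indic_itv a b _ (fun x => (f0 (x + s) * g x)%:E)).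
  - rewrite -lebesgue_integralE//; last first.
      exact: (measurable_EFinP _ _).2 mfgB.
    have mfg0 : lebesgue_measurable_fun (fun x => f0 (x + s) * g x).
      exact: borel_lebesgue_fun.
    apply: ae_eq_integral.
    + exact: leb_measurable_itv.
    + by apply/measurable_EFinP; apply: measurable_funTS.
    + by apply/measurable_EFinP; apply: measurable_funTS; case: (jfs s).
    exists ((fun x => x + s) @^-1` N); case: (shN s) => mNs Ns0; split => //.
      exact: borel_lebesgue_set.
    move=> x /= /not_implyP[_] h; apply: contrapT => Nx; apply: h.
    by rewrite /= ff0.
  - by move=> x xab; rewrite /H /= I1E// I2E// !mulr1.
  - by move=> x xab; rewrite /H /= I10// mul0r mulr0.
have F0x x : ~~ (a <= x <= b) -> (\int[mu]_s (H (x, s))%:E)%E = 0%E.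
  by move=> h; rewrite integral0_eq// => s _; rewrite /H /= I10// mul0r mulr0.
have F0s s : ~~ (c <= s <= d) -> (\int[mu]_x (H (x, s))%:E)%E = 0%E.
  by move=> h; rewrite integral0_eq// => x _; rewrite /H /= I20// !mulr0.
(* By Tonelli: for fixed s, the integral over x of |H| is at most [k] times the integral of |f0|
   over the bounded interval [a + c, b + d]. *)
have iH : (mu \x mu)%E.-integrable setT (EFin \o H).
  apply/integrable21ltyP => //.
  pose A0 y : \bar R := `|f0 y|%R%:E.
  have mA0 : measurable_fun [set: T] A0.
    by apply/measurable_EFinP; exact: measurableT_comp.
  pose K : \bar R := (\int[mu]_(y in `[(a + c)%R, (b + d)%R]) A0 y)%E.
  have K0 : (0 <= K)%E by apply: integral_ge0 => y _; rewrite lee_fin.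
  have Kfin : (K < +oo)%E.
    rewrite /K -(@lebesgue_integral_borel R _ f f0 N (fun y => `|y%:E|%E))//.
      by case: jf => _ /(_ (a + c) (b + d)) /integrableP[].
    by apply: measurableT_comp => //; exact/measurable_EFinP.
  have Hs s : (\int[mu]_x `|(EFin \o H) (x, s)| <= k%:E * K * (I2 s)%:E)%E.
    have [scd|scd] := boolP (c <= s <= d); last first.
      rewrite integral0_eq ?I20 ?mule0// => x _.
      by rewrite /H /= I20// !mulr0 normr0.
    rewrite I2E// mule1 /K.
    rewrite (@integral_indic_itv a b _ (fun x => `|f0 (x + s) * g x|%:E)); first last.
    - by move=> x h; rewrite /H /= I10// mul0r mulr0 normr0.
    - by move=> x h; rewrite /H /= I1E// I2E// !mulr1.
    apply: (@le_trans _ _ (\int[mu]_(x in `[a, b]) (k%:E * A0 (x + s)%R))%E).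
      apply: ge0_le_integral => //.
      - apply: measurable_funTS; apply/measurable_EFinP.
        by apply: measurableT_comp => //; apply: measurable_funM => //; exact: mf0s.
      - apply: measurable_funTS; apply: measurable_funeM.
        by apply/measurable_EFinP; apply: measurableT_comp => //; exact: mf0s.
      - by move=> x _; rewrite -EFinM lee_fin normrM mulrC ler_wpM2r.
    rewrite ge0_integralZl_EFin//; last 2 first.
      by move=> y _; rewrite lee_fin.
      apply: measurable_funTS.
      by apply/measurable_EFinP; apply: measurableT_comp => //; exact: mf0s.
    apply: lee_wpmul2l; first by rewrite lee_fin.
    have -> : `[a, b]%classic = (fun x => x + s) @^-1` `[a + s, b + s].
      by apply/seteqP; split => x /=; rewrite !in_itv /= !lerD2r.
    rewrite (integral_shift (h := A0))//.
    apply: ge0_subset_integral => //; first exact: measurable_funTS.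
      by move=> y _; rewrite lee_fin.
    move=> y /=; rewrite !in_itv /=; case/andP: scd => cs sd /andP[ay yb].
    by apply/andP; split; lra.
  apply: (@le_lt_trans _ _ (\int[mu]_s (k%:E * K * (I2 s)%:E))%E).
    apply: ge0_le_integral => //.
    - by move=> x _; apply: integral_ge0.
    - apply: (measurable_fun_fubini_tonelli_G (fun z => `|(EFin \o H) z|%E)) => //.
      exact: measurableT_comp.
    - by apply: measurable_funeM; exact/measurable_EFinP.
  rewrite ge0_integralZl//; first last.
  - by rewrite mule_ge0.
  - by move=> s _; rewrite lee_fin.
  - exact/measurable_EFinP.
  apply: lte_mul_pinfty; first by rewrite mule_ge0.
    by rewrite ge0_fin_numE ?mule_ge0// lte_mul_pinfty.
  rewrite (@integral_indic_itv c d _ (cst 1%E)); first last.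
  - by move=> x h; rewrite I20.
  - by move=> x h; rewrite I2E.
  rewrite integral_cst// mul1e.
  apply: (@le_lt_trans _ _ (@lebesgue_measure R `[c, d]%classic)) => //.
  rewrite lebesgue_measure_itv /=.
  by case: ifP => _; rewrite ?ltry// -EFinB ltry.
rewrite /itv_integral /Rintegral; congr fine.
have mF : measurable_fun [set: T] (fun x : T => \int[mu]_s (H (x, s))%:E)%E.
  exact: (measurable_fubini_F iH).
have mG : measurable_fun [set: T] (fun s : T => \int[mu]_x (H (x, s))%:E)%E.
  exact: (measurable_fubini_G iH).
transitivity (\int[mu]_x \int[mu]_s (H (x, s))%:E)%E.
  rewrite (@integral_indic_itv a b _ (fun x => \int[mu]_s (H (x, s))%:E)%E)//.
  rewrite -lebesgue_integralE//; apply: eq_integral => x.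
  by rewrite inE /= in_itv /= => xab; rewrite Fx.
rewrite (Fubini iH).
rewrite (@integral_indic_itv c d _ (fun s => \int[mu]_x (H (x, s))%:E)%E)//.
rewrite -lebesgue_integralE//; apply: eq_integral => x.
by rewrite inE /= in_itv /= => xab; rewrite Fs.
Qed.
End FubiniShift.

Local Open Scope complex_scope.

(** * Complex-valued periodic functions *)

Section ComplexBasics.
Variable R : realType.
Implicit Types (z w : R[i]) (r s t : R).

Lemma complex_eq z w : complex.Re z = complex.Re w -> complex.Im z = complex.Im w -> z = w.
Proof. by case: z => a b; case: w => c d /= -> ->. Qed.

Lemma ReM z w : complex.Re (z * w) =
  complex.Re z * complex.Re w - complex.Im z * complex.Im w.
Proof. by case: z => a b; case: w => c d. Qed.

Lemma ImM z w : complex.Im (z * w) =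
  complex.Re z * complex.Im w + complex.Im z * complex.Re w.
Proof. by case: z => a b; case: w => c d. Qed.

Lemma ReD z w : complex.Re (z + w) = complex.Re z + complex.Re w.
Proof. by case: z => a b; case: w => c d. Qed.

Lemma ImD z w : complex.Im (z + w) = complex.Im z + complex.Im w.
Proof. by case: z => a b; case: w => c d. Qed.

Lemma ReN z : complex.Re (- z) = - complex.Re z.
Proof. by case: z. Qed.

Lemma ImN z : complex.Im (- z) = - complex.Im z.
Proof. by case: z. Qed.

Lemma CD r s : (r + s)%:C = r%:C + s%:C. Proof. exact: rmorphD. Qed.
Lemma CM r s : (r * s)%:C = r%:C * s%:C. Proof. exact: rmorphM. Qed.
Lemma CB r s : (r - s)%:C = r%:C - s%:C. Proof. exact: rmorphB. Qed.
Lemma CV r : (r^-1)%:C = (r%:C)^-1. Proof. exact: fmorphV. Qed.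
Lemma Cnat n : (n%:R : R)%:C = n%:R. Proof. exact: rmorph_nat. Qed.

Lemma modulus_sqr z : modulus z ^+ 2 = complex.Re z ^+ 2 + complex.Im z ^+ 2.
Proof. by case: z => a b /=; rewrite sqr_sqrtr// addr_ge0 ?sqr_ge0. Qed.

Lemma modulus_ge0 z : 0 <= modulus z.
Proof. by case: z => a b; apply: sqrtr_ge0. Qed.

Lemma modulusM z w : modulus (z * w) = modulus z * modulus w.
Proof. exact: ComplexField.Normc.normcM. Qed.

Lemma modulusV z : modulus (z^-1) = (modulus z)^-1.
Proof. exact: ComplexField.Normc.normcV. Qed.

Lemma modulusD z w : modulus (z + w) <= modulus z + modulus w.
Proof. by rewrite -lecR CD; exact: (ler_normD z w). Qed.

Lemma modulus_real r : modulus (r%:C) = `|r|.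
Proof. by rewrite /modulus /= expr0n addr0 sqrtr_sqr. Qed.

Lemma modulus0 : modulus (0 : R[i]) = 0.
Proof. exact: ComplexField.Normc.normc0. Qed.

Lemma modulus1 : modulus (1 : R[i]) = 1.
Proof. exact: ComplexField.Normc.normc1. Qed.

Lemma modulus_eq0 z : modulus z = 0 -> z = 0.
Proof. exact: ComplexField.Normc.eq0_normc. Qed.

Lemma modulusN z : modulus (- z) = modulus z.
Proof. by case: z => a b /=; rewrite !sqrrN. Qed.

Lemma modulusB z w : modulus (z - w) <= modulus z + modulus w.
Proof. by rewrite -(modulusN w); exact: modulusD. Qed.

Lemma ler_Re_modulus z : `|complex.Re z| <= modulus z.
Proof.
rewrite -(@ler_pXn2r _ 2)// ?nnegrE ?modulus_ge0// modulus_sqr real_normK ?num_real//.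
by rewrite lerDl sqr_ge0.
Qed.

Lemma ler_Im_modulus z : `|complex.Im z| <= modulus z.
Proof.
rewrite -(@ler_pXn2r _ 2)// ?nnegrE ?modulus_ge0// modulus_sqr real_normK ?num_real//.
by rewrite lerDr sqr_ge0.
Qed.

Lemma modulus_le_ReIm z : modulus z <= `|complex.Re z| + `|complex.Im z|.
Proof.
rewrite -(@ler_pXn2r _ 2)// ?nnegrE ?modulus_ge0 ?addr_ge0//.
rewrite modulus_sqr sqrrD !real_normK ?num_real//.
have : 0 <= `|complex.Re z| * `|complex.Im z| by rewrite mulr_ge0.
by rewrite mulr2n; lra.
Qed.

Lemma modulus_sum (I : Type) (s : seq I) (P : pred I) (F : I -> R[i]) :
  modulus (\sum_(i <- s | P i) F i) <= \sum_(i <- s | P i) modulus (F i).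
Proof.
elim/big_rec2: _ => [|i a b _ ih]; first by rewrite modulus0.
by apply: le_trans (modulusD _ _) _; rewrite lerD2l.
Qed.

Lemma cexpiD s t : cexpi (s + t) = cexpi s * cexpi t.
Proof. by apply: complex_eq; rewrite ?ReM ?ImM /= ?cosD ?sinD//; ring. Qed.

Lemma cexpi0 : cexpi (0 : R) = 1.
Proof. by rewrite /cexpi cos0 sin0. Qed.

Lemma modulus_cexpi t : modulus (cexpi t) = 1.
Proof. by rewrite /= cos2Dsin2 sqrtr1. Qed.

Lemma cexpi_neq0 t : cexpi t != 0.
Proof.
by apply/eqP => /(congr1 (@modulus R)); rewrite modulus_cexpi modulus0 => /eqP; rewrite oner_eq0.
Qed.

Lemma cexpiN t : cexpi (- t) = (cexpi t)^-1.
Proof.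
apply: (mulIf (cexpi_neq0 t)); rewrite mulVf ?cexpi_neq0//.
by rewrite -cexpiD addNr cexpi0.
Qed.

Lemma cexpi2pi : cexpi (2 * pi : R) = 1.
Proof. by rewrite /cexpi mulr_natl cos2pi sin2pi. Qed.

Lemma cexpi_int2pi (k : int) : cexpi (k%:~R * (2 * pi) : R) = 1.
Proof.
have H (n : nat) : cexpi (n%:R * (2 * pi) : R) = 1.
  elim: n => [|n ih]; first by rewrite mul0r cexpi0.
  by rewrite -natr1 mulrDl mul1r cexpiD ih cexpi2pi mulr1.
case: k => n; first exact: H.
by rewrite NegzE mulrNz mulNr cexpiN H invr1.
Qed.

End ComplexBasics.

(** * Complex integrals over intervals *)

Section ComplexIntegral.
Variable R : realType.
Implicit Types (f g : R -> R[i]) (a b c s : R) (z : R[i]).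

Definition cloc f := loc_integrable (fun x => complex.Re (f x)) /\
  loc_integrable (fun x => complex.Im (f x)).

Definition citv a b f : R[i] := cintegral `[a, b] f.

Lemma Re_citv a b f : complex.Re (citv a b f) = itv_integral a b (fun x => complex.Re (f x)).
Proof. by []. Qed.

Lemma Im_citv a b f : complex.Im (citv a b f) = itv_integral a b (fun x => complex.Im (f x)).
Proof. by []. Qed.

Lemma clocD f g : cloc f -> cloc g -> cloc (fun x => f x + g x).
Proof.
move=> [fr fi] [gr gi]; split.
  by under eq_fun do rewrite ReD; exact: loc_integrableD.
by under eq_fun do rewrite ImD; exact: loc_integrableD.
Qed.

Lemma cloc_bounded_mul f g k : cloc f ->
  lebesgue_measurable_fun (fun x => complex.Re (g x)) ->
  lebesgue_measurable_fun (fun x => complex.Im (g x)) ->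
  (forall x, modulus (g x) <= k) -> cloc (fun x => f x * g x).
Proof.
move=> [fr fi] mr mi gk.
have kr x : `|complex.Re (g x)| <= k by exact: le_trans (ler_Re_modulus _) (gk x).
have ki x : `|complex.Im (g x)| <= k by exact: le_trans (ler_Im_modulus _) (gk x).
split.
  have := loc_integrableD (loc_integrableM fr mr kr)
    (loc_integrableZ (-1) (loc_integrableM fi mi ki)).
  by under eq_fun do rewrite mulN1r -ReM.
under eq_fun do rewrite ImM.
by apply: loc_integrableD; [exact: loc_integrableM ki|exact: loc_integrableM kr].
Qed.

Lemma clocZ z f : cloc f -> cloc (fun x => z * f x).
Proof.
move=> jf; under eq_fun do rewrite mulrC.
by apply: (cloc_bounded_mul (g := fun=> z) (k := modulus z)) => //; exact: measurable_cst.
Qed.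

Lemma cloc_cst z : cloc (fun=> z).
Proof. by split; exact: loc_integrable_cst. Qed.

Lemma clocB f g : cloc f -> cloc g -> cloc (fun x => f x - g x).
Proof.
move=> jf jg; have := clocD jf (clocZ (-1) jg).
by under eq_fun do rewrite mulN1r.
Qed.

Lemma cloc_shift f s : cloc f -> cloc (fun x => f (x + s)).
Proof.
move=> [fr fi]; split; [exact: (loc_integrable_shift s fr)|exact: (loc_integrable_shift s fi)].
Qed.

Lemma cloc_sum (I : Type) (r : seq I) (P : pred I) (F : I -> R -> R[i]) :
  (forall i, P i -> cloc (F i)) -> cloc (fun x => \sum_(i <- r | P i) F i x).
Proof.
move=> jF; elim: r => [|i r ih].
  rewrite (_ : (fun x => _) = fun=> 0); first exact: cloc_cst.
  by apply/funext => x; rewrite big_nil.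
case: (boolP (P i)) => Pi; last first.
  rewrite (_ : (fun x => _) = fun x => \sum_(j <- r | P j) F j x)//.
  by apply/funext => x; rewrite big_cons (negbTE Pi).
rewrite (_ : (fun x => _) = fun x => F i x + \sum_(j <- r | P j) F j x).
  by apply: clocD => //; exact: jF.
by apply/funext => x; rewrite big_cons Pi.
Qed.

Lemma continuous_cos_lin c : continuous (fun x : R => cos (c * x)).
Proof.
move=> x; apply: (@continuous_comp _ _ _ (fun x => c * x) cos).
  exact: mulrl_continuous.
exact: continuous_cos.
Qed.

Lemma continuous_sin_lin c : continuous (fun x : R => sin (c * x)).
Proof.
move=> x; apply: (@continuous_comp _ _ _ (fun x => c * x) sin).
  exact: mulrl_continuous.
exact: continuous_sin.
Qed.

Lemma cloc_cexpi_mul f c : cloc f -> cloc (fun x => f x * cexpi (c * x)).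
Proof.
move=> jf; apply: (cloc_bounded_mul (k := 1)) => //.
- by apply: continuous_lebesgue_fun; exact: continuous_cos_lin.
- by apply: continuous_lebesgue_fun; exact: continuous_sin_lin.
- by move=> x; rewrite modulus_cexpi.
Qed.

Lemma cloc_cexpi c : cloc (fun x => cexpi (c * x)).
Proof.
have := cloc_cexpi_mul c (cloc_cst 1).
by under eq_fun do rewrite mul1r.
Qed.

Lemma modulus_measurable f : lebesgue_measurable_fun (fun x => complex.Re (f x)) ->
  lebesgue_measurable_fun (fun x => complex.Im (f x)) ->
  lebesgue_measurable_fun (fun x => modulus (f x)).
Proof.
move=> mr mi.
have -> : (fun x => modulus (f x)) =
    (fun x => Num.sqrt (complex.Re (f x) ^+ 2 + complex.Im (f x) ^+ 2)).
  by apply/funext => x; rewrite -modulus_sqr sqrtr_sqr ger0_norm ?modulus_ge0.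
apply: (measurableT_comp (f := @Num.sqrt R)).
  by apply: continuous_measurable_fun; exact: sqrt_continuous.
by apply: measurable_funD; apply: measurable_funX.
Qed.

Lemma cloc_modulus f : cloc f -> loc_integrable (fun x => modulus (f x)).
Proof.
move=> [fr fi]; apply: (@loc_integrable_dom _ _
    (fun x => `|complex.Re (f x)| + `|complex.Im (f x)|)).
- by apply: modulus_measurable; [case: fr|case: fi].
- by apply: loc_integrableD; exact: loc_integrable_norm.
- by move=> x; rewrite ger0_norm ?modulus_ge0// modulus_le_ReIm.
Qed.

Lemma citvD a b f g : cloc f -> cloc g ->
  citv a b (fun x => f x + g x) = citv a b f + citv a b g.
Proof.
move=> [fr fi] [gr gi]; apply: complex_eq; rewrite ?ReD ?ImD ?Re_citv ?Im_citv.
  by under eq_fun do rewrite ReD; exact: itv_integralD.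
by under eq_fun do rewrite ImD; exact: itv_integralD.
Qed.

Lemma citvZ a b z f : cloc f -> citv a b (fun x => z * f x) = z * citv a b f.
Proof.
move=> [fr fi]; apply: complex_eq; rewrite ?ReM ?ImM ?Re_citv ?Im_citv.
  have := itv_integralD a b (loc_integrableZ (complex.Re z) fr)
    (loc_integrableZ (- complex.Im z) fi).
  rewrite !itv_integralZ// mulNr => <-; congr itv_integral; apply/funext => x.
  by rewrite ReM mulNr.
under eq_fun do rewrite ImM.
rewrite itv_integralD ?itv_integralZ//; exact: loc_integrableZ.
Qed.

Lemma citvB a b f g : cloc f -> cloc g ->
  citv a b (fun x => f x - g x) = citv a b f - citv a b g.
Proof.
move=> jf jg; have := citvD a b jf (clocZ (-1) jg).
by rewrite citvZ// mulN1r; under eq_fun do rewrite mulN1r.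
Qed.

Lemma citv_sum a b (I : Type) (r : seq I) (P : pred I) (F : I -> R -> R[i]) :
  (forall i, P i -> cloc (F i)) ->
  citv a b (fun x => \sum_(i <- r | P i) F i x) = \sum_(i <- r | P i) citv a b (F i).
Proof.
move=> jF; elim: r => [|i r ih].
  rewrite big_nil (_ : (fun x => _) = fun=> 0); last by apply/funext => x; rewrite big_nil.
  by rewrite -[X in citv a b (fun=> X)](mul0r 0) (citvZ a b 0 (cloc_cst 0)) mul0r.
rewrite big_cons; case: (boolP (P i)) => Pi; last first.
  rewrite -ih; congr citv.
  by apply/funext => x; rewrite big_cons (negbTE Pi).
rewrite -ih -citvD; last 2 first.
- exact: jF.
- exact: cloc_sum.
by congr citv; apply/funext => x; rewrite big_cons Pi.
Qed.

Lemma citv_shift a b s f : cloc f ->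
  citv a b (fun x => f (x + s)) = citv (a + s) (b + s) f.
Proof.
move=> [fr fi]; apply: complex_eq; rewrite ?Re_citv ?Im_citv.
  exact: (itv_integral_shift a b s fr).
exact: (itv_integral_shift a b s fi).
Qed.

Lemma citv_cat a b c f : cloc f -> a <= b -> b <= c ->
  citv a c f = citv a b f + citv b c f.
Proof.
move=> [fr fi] ab bc; apply: complex_eq; rewrite ?ReD ?ImD ?Re_citv ?Im_citv;
  exact: itv_integral_cat.
Qed.

Lemma citv_cst a b z : a <= b -> citv a b (fun=> z) = z * (b - a)%:C.
Proof.
move=> ab; apply: complex_eq; rewrite ?ReM ?ImM ?Re_citv ?Im_citv itv_integral_cst//= mulr0 ?subr0 ?add0r//.
Qed.

Lemma eq_citv a b f g : (forall x, a <= x <= b -> f x = g x) ->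
  citv a b f = citv a b g.
Proof.
by move=> fg; apply: complex_eq; rewrite ?Re_citv ?Im_citv; apply: eq_itv_integral => x xab;
  rewrite fg.
Qed.

Lemma modulus_citv a b f : cloc f ->
  modulus (citv a b f) <= itv_integral a b (fun x => modulus (f x)).
Proof.
move=> jf; have [->|nz] := eqVneq (citv a b f) 0.
  by rewrite modulus0; apply: itv_integral_ge0 => x _; exact: modulus_ge0.
set I := citv a b f in nz *.
have mI : modulus I != 0 by apply: contra nz => /eqP/modulus_eq0 ->.
(* rotate the integral onto the positive half-line *)
pose u : R[i] := (modulus I)%:C / I.
have uI : u * I = (modulus I)%:C by rewrite divfK.
have mu : modulus u = 1.
  by rewrite modulusM modulusV modulus_real ger0_norm ?modulus_ge0// divff.
have -> : modulus I = complex.Re (citv a b (fun x => u * f x)) by rewrite citvZ// uI.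
rewrite Re_citv; apply: itv_integral_le.
- by case: (clocZ u jf).
- exact: cloc_modulus.
- move=> x _; apply: le_trans (ler_norm _) _.
  by apply: le_trans (ler_Re_modulus _) _; rewrite modulusM mu mul1r.
Qed.

Lemma is_derive_cmul (F : R -> R) c (x d : R) : is_derive x (1 : R) F d ->
  is_derive x (1 : R) (fun y => c * F y) (c * d).
Proof. exact: is_deriveZ. Qed.

Lemma is_derive_lin c (x : R) : is_derive x (1 : R) (fun y : R => c * y) c.
Proof. exact: (is_derive_eq (is_derive_cmul c (is_derive_id x 1)) (mulr1 c)). Qed.

Lemma is_derive_sin_lin c (x : R) :
  is_derive x (1 : R) (fun x => sin (c * x)) (c * cos (c * x)).
Proof.
apply: (is_derive_eq (is_derive1_comp (is_derive_sin _) (is_derive_lin c x))).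
exact: mulrC.
Qed.

Lemma is_derive_cos_lin c (x : R) :
  is_derive x (1 : R) (fun x => cos (c * x)) (- (c * sin (c * x))).
Proof.
apply: (is_derive_eq (is_derive1_comp (is_derive_cos _) (is_derive_lin c x))).
by rewrite mulNr mulrC.
Qed.

Lemma itv_integral_cos a b c : a <= b -> c != 0 ->
  itv_integral a b (fun x => cos (c * x)) = (sin (c * b) - sin (c * a)) / c.
Proof.
move=> ab c0.
have dF x : is_derive x (1 : R) (fun x => c^-1 * sin (c * x)) (cos (c * x)).
  by apply: (is_derive_eq (is_derive_cmul _ (is_derive_sin_lin c x))); rewrite mulKf.
by rewrite (itv_integral_FTC ab dF (@continuous_cos_lin c)) -mulrBr mulrC.
Qed.

Lemma itv_integral_sin a b c : a <= b -> c != 0 ->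
  itv_integral a b (fun x => sin (c * x)) = (cos (c * a) - cos (c * b)) / c.
Proof.
move=> ab c0.
have dF x : is_derive x (1 : R) (fun x => - c^-1 * cos (c * x)) (sin (c * x)).
  apply: (is_derive_eq (is_derive_cmul _ (is_derive_cos_lin c x))).
  by rewrite mulrNN mulKf.
rewrite (itv_integral_FTC ab dF (@continuous_sin_lin c)) -mulrBr mulrC.
by rewrite mulrN -mulNr opprB.
Qed.

End ComplexIntegral.

(** * Periodic functions and integrals over a period *)

Section Periodic.
Variable R : realType.
Implicit Types (F : R -> R) (f g : R -> R[i]) (a b c d h s t x : R) (k : int).

Lemma periodic_int (T : Type) (G : R -> T) : (forall x, G (x + 2 * pi) = G x) ->
  forall (m : int) x, G (x + m%:~R * (2 * pi)) = G x.
Proof.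
move=> GP.
have H (n : nat) x : G (x + n%:R * (2 * pi)) = G x.
  elim: n x => [|n ih] x; first by rewrite mul0r addr0.
  by rewrite -natr1 mulrDl mul1r addrA GP ih.
case=> n x; first exact: H.
by rewrite NegzE mulrNz mulNr -[RHS](H n.+1 x) -[in RHS](subrK (n.+1%:R * (2 * pi)) x) H.
Qed.

Lemma period_reduce x : exists m : int, - pi <= x + m%:~R * (2 * pi) < pi.
Proof.
have p0 := pi_gt0 R.
exists (- Num.floor ((x + pi) / (2 * pi))).
set y := (x + pi) / (2 * pi).
have xE : x = y * (2 * pi) - pi by rewrite /y divfK ?addrK// lt0r_neq0// mulr_gt0.
have /andP[f1 f2] := floor_itv y.
rewrite mulrNz; apply/andP; split.
  rewrite [in X in _ <= X]xE; have : 0 <= (y - (Num.floor y)%:~R) * (2 * pi).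
    by rewrite mulr_ge0 ?subr_ge0// mulr_ge0// ltW.
  by rewrite mulrBl; lra.
rewrite [in X in X < _]xE; have : 0 < ((Num.floor y + 1)%:~R - y) * (2 * pi).
  by rewrite mulr_gt0 ?subr_gt0// mulr_gt0.
by rewrite intrD mulrBl mulrDl; lra.
Qed.

(** After [a] has been moved into [-pi, pi) by whole periods, cut at pi; the piece beyond pi is the
    translate of the piece missing on the left. *)
Lemma itv_integral_periodic F a : loc_integrable F ->
  (forall x, F (x + 2 * pi) = F x) ->
  itv_integral a (a + 2 * pi) F = itv_integral (- pi) pi F.
Proof.
move=> jF FP; have p0 := pi_gt0 R.
have [m /andP[am1 am2]] := period_reduce a.
have -> : itv_integral a (a + 2 * pi) F =
    itv_integral (a + m%:~R * (2 * pi)) (a + m%:~R * (2 * pi) + 2 * pi) F.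
  rewrite addrAC -itv_integral_shift//; apply: eq_itv_integral => x _.
  by rewrite periodic_int.
set b := a + _ in am1 am2 *.
rewrite (@itv_integral_cat _ b pi)//; [|exact: ltW|by lra].
rewrite [RHS](@itv_integral_cat _ _ b)//; last exact: ltW.
rewrite addrC; congr (_ + _).
have := itv_integral_shift (- pi) b (2 * pi) jF.
have -> : - pi + 2 * pi = pi :> R by lra.
move=> <-; apply: eq_itv_integral => x _; exact: FP.
Qed.

Lemma citv_periodic f a : cloc f -> (forall x, f (x + 2 * pi) = f x) ->
  citv a (a + 2 * pi) f = citv (- pi) pi f.
Proof.
move=> [fr fi] fP; apply: complex_eq; rewrite ?Re_citv ?Im_citv.
  by apply: (itv_integral_periodic a fr) => x; rewrite fP.
by apply: (itv_integral_periodic a fi) => x; rewrite fP.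
Qed.

Lemma citv_periodic_shift f x : cloc f -> (forall x, f (x + 2 * pi) = f x) ->
  citv (- pi) pi (fun t => f (t + x)) = citv (- pi) pi f.
Proof.
move=> jf fP; rewrite citv_shift// -(citv_periodic (- pi + x) jf fP).
by congr (citv _ _ _); lra.
Qed.

(** Integrability over one period propagates: [J], the integral of the modulus, is invariant under
    whole periods and subadditive under concatenation. *)
Lemma torus_fun_cloc f : torus_fun f -> (torus_integral_abs (@torus R) f < +oo)%E -> cloc f.
Proof.
move=> [fP mr mi] fin; have p0 := pi_gt0 R.
have mf := modulus_measurable mr mi.
pose J a b : \bar R := (\int[@completed_lebesgue_measure R]_(x in `[a, b]) (modulus (f x))%:E)%E.
have mEf D : measurable_fun D (fun x : lebesgueType R => (modulus (f x))%:E).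
  by apply: measurable_funTS; exact/measurable_EFinP.
have Jsh a b (m : int) : J (a + m%:~R * (2 * pi)) (b + m%:~R * (2 * pi)) = J a b.
  rewrite /J -(@lebesgue_integral_shift R `[_, _] (fun x => modulus (f x)) (m%:~R * (2 * pi)) EFin)//.
  have -> : (fun x => x + m%:~R * (2 * pi)) @^-1`
      `[a + m%:~R * (2 * pi), b + m%:~R * (2 * pi)] = `[a, b]%classic.
    by apply/seteqP; split => x /=; rewrite !in_itv /= !lerD2r.
  by apply: eq_integral => x _; rewrite periodic_int.
have Jcat a b c : a <= b -> b <= c -> (J a c <= J a b + J b c)%E.
  move=> ab bc; rewrite /J.
  have E : `[a, c]%classic = `[a, b[ `|` `[b, c] by rewrite -itv_bndbnd_setU ?bnd_simp.
  rewrite E ge0_integral_setU//.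
  - rewrite leeD2r//; apply: ge0_subset_integral => //.
    + by move=> x _; rewrite lee_fin modulus_ge0.
    + by move=> x /=; rewrite !in_itv /= => /andP[-> /ltW ->].
  - by move=> x _; rewrite lee_fin modulus_ge0.
  - apply/disj_set2P/seteqP; split => x //= -[]; rewrite !in_itv /= => /andP[_ xb] /andP[bx _].
    by have := lt_le_trans xb bx; rewrite ltxx.
pose Jfin a b := (J a b < +oo)%E.
have J0 : Jfin (- pi) pi.
  have E : `[- pi, pi]%classic = `[- pi, pi[ `|` [set (pi : R)].
    by rewrite (@setUitv1 _ _ _ _ true) ?bnd_simp//; lra.
  rewrite /Jfin /J E ge0_integral_setU//.
  - rewrite [X in (_ + X < _)%E]null_set_integral//; last 2 first.
    + by apply: (borel_lebesgue_set (measurable_set1 (pi : R))).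
    + exact: lebesgue_point.
    rewrite adde0; move: fin; rewrite /torus_integral_abs /torus.
    set I := (\int[_]_(x in _) _)%E.
    have I0 : (0 <= I)%E by apply: integral_ge0 => x _; rewrite lee_fin modulus_ge0.
    case: I I0 => [r _ _|_|//]; first exact: ltry.
    by rewrite mulry gtr0_sg ?mul1e// invr_gt0 mulr_gt0.
  - by apply: (borel_lebesgue_set (measurable_set1 (pi : R))).
  - by move=> x _; rewrite lee_fin modulus_ge0.
  - by apply/disj_set2P/seteqP; split => x //= -[] + xb; rewrite in_itv /= xb ltxx andbF.
have JN (N : nat) : Jfin (- pi) (- pi + N%:R * (2 * pi)).
  elim: N => [|N ih].
    apply: le_lt_trans J0; apply: ge0_subset_integral => //.
    + by move=> x _; rewrite lee_fin modulus_ge0.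
    + by move=> x /=; rewrite !in_itv /= mul0r addr0 => /andP[-> /le_trans ->//]; lra.
  have h1 : - pi <= - pi + N%:R * (2 * pi) :> R.
    by rewrite lerDl mulr_ge0// mulr_ge0// ltW.
  have h2 : - pi + N%:R * (2 * pi) <= - pi + N.+1%:R * (2 * pi) :> R.
    by rewrite lerD2l ler_wpM2r ?mulr_ge0 ?ltW// ltr_nat.
  apply: (le_lt_trans (Jcat _ _ _ h1 h2)).
  apply: lte_add_pinfty => //.
  have := Jsh (- pi) pi (N : int).
  have -> : pi + (N : int)%:~R * (2 * pi) = - pi + N.+1%:R * (2 * pi) :> R.
    by rewrite -natr1 mulrDl mul1r; lra.
  by move=> ->.
have Jab a b : Jfin a b.
  (* [N] periods on either side of [-pi, pi] cover [a, b]: 2 N + 1 periods starting at -pi are moved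
     back by [N] of them. *)
  pose N := (Num.truncn ((`|a| + `|b|) / pi)).+1.
  have NE : `|a| + `|b| < N%:R * pi.
    by rewrite -ltr_pdivrMr//; exact: truncnS_gt.
  have := JN (N + N + 1)%N; rewrite /Jfin -(Jsh _ _ (- (N : int))).
  apply: le_lt_trans; apply: ge0_subset_integral => //.
  - by move=> x _; rewrite lee_fin modulus_ge0.
  - have na := ler_norm (- a); have nb := ler_norm b; rewrite normrN in na.
    have a0 := normr_ge0 a; have b0 := normr_ge0 b.
    move=> x /=; rewrite !in_itv /= => /andP[ax xb]; rewrite mulrNz !natrD !mulrDl !mul1r mulNr.
    have -> : ((N : int)%:~R : R) = N%:R by [].
    by apply/andP; split; lra.
have I : loc_integrable (fun x => modulus (f x)).
  split => // a b; apply/integrableP; split; first exact: mEf.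
  apply: le_lt_trans (Jab a b); rewrite le_eqVlt; apply/orP; left; apply/eqP.
  by apply: eq_integral => x _ /=; rewrite ger0_norm ?modulus_ge0.
split; apply: (loc_integrable_dom _ I) => // x.
  exact: ler_Re_modulus.
exact: ler_Im_modulus.
Qed.
End Periodic.

(** * Fourier multipliers *)

Section SymmetricSums.
Variable V : zmodType.
Implicit Types (F G : int -> V) (L m : nat).

(** The sum over |k| <= L, indexed by ordinals shifted by L as in [kernel_poly], so that the lemmas
    on finite sums apply. *)
Definition isum L F : V := \sum_(k < 2 * L + 1) F ((k : nat)%:Z - L%:Z).

Lemma isum0 F : isum 0 F = F 0.
Proof. by rewrite /isum big_ord1. Qed.

Lemma isumS L F : isum L.+1 F = isum L F + F L.+1%:Z + F (- L.+1%:Z).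
Proof.
rewrite /isum (_ : (2 * L.+1 + 1 = (2 * L + 1).+2)%N); last by rewrite mulnS; lia.
rewrite big_ord_recl big_ord_recr [LHS]addrC; congr (_ + _ + _).
  by apply: eq_bigr => k _; congr F; rewrite lift0 /=; lia.
- by congr F; rewrite lift0 /=; lia.
- by congr F; rewrite /= sub0r.
Qed.

Lemma eq_isum L F G : (forall k, `|k|%N <= L -> F k = G k)%N -> isum L F = isum L G.
Proof. by move=> FG; apply: eq_bigr => k _; apply: FG; have := ltn_ord k; lia. Qed.

Lemma isumD L F G : isum L (fun k => F k + G k) = isum L F + isum L G.
Proof. exact: big_split. Qed.

Lemma isumN L F : isum L (fun k => - F k) = - isum L F.
Proof. by rewrite /isum sumrN. Qed.

Lemma isum_widen L L' F : (L <= L')%N -> (forall k, (L < `|k|)%N -> F k = 0) ->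
  isum L' F = isum L F.
Proof.
move=> LL F0; rewrite -(subnKC LL); elim: (L' - L)%N => [|d ih]; first by rewrite addn0.
by rewrite addnS isumS ih !F0 ?addr0//; lia.
Qed.

Lemma isum_delta L F (k0 : int) :
  isum L (fun k => if k == k0 then F k else 0) = if (`|k0| <= L)%N then F k0 else 0.
Proof.
elim: L => [|L ih].
  rewrite isum0; have [<-|k0N] := eqVneq 0 k0; first by [].
  by rewrite ifN//; move: k0N; lia.
rewrite isumS ih.
have [|] := leqP `|k0|%N L => kL.
  have -> : (L.+1%:Z == k0) = false by apply/eqP; lia.
  have -> : (- L.+1%:Z == k0) = false by apply/eqP; lia.
  by rewrite !addr0 leqW.
rewrite add0r; have [<-|k1] := eqVneq L.+1%:Z k0.
  have -> : (- L.+1%:Z == L.+1%:Z) = false by apply/eqP; lia.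
  by rewrite addr0 absz_nat leqnn.
rewrite add0r; have [<-|k2] := eqVneq (- L.+1%:Z) k0; first by rewrite abszN absz_nat leqnn.
have -> : (`|k0| <= L.+1)%N = false by move: k1 k2 => /eqP ? /eqP ?; lia.
by [].
Qed.

Lemma isum_opp L F : isum L (fun k => F (- k)) = isum L F.
Proof.
elim: L => [|L ih]; first by rewrite !isum0 oppr0.
by rewrite !isumS ih opprK addrAC.
Qed.

Lemma isum_pred L F : (forall k, (L < `|k|)%N -> F k = 0) ->
  isum L.+1 (fun k => F (k - 1)) = isum L F.
Proof.
move=> F0; rewrite /isum (_ : (2 * L.+1 + 1 = (2 * L + 1).+2)%N); last by rewrite mulnS; lia.
rewrite !big_ord_recl !F0 ?add0r; [|by rewrite lift0 /=; lia|by rewrite /=; lia].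
by apply: eq_bigr => k _; congr F; rewrite !lift0; lia.
Qed.

Lemma isum_subn L m F : (forall k, (L < `|k|)%N -> F k = 0) ->
  isum (L + m) (fun k => F (k - m%:Z)) = isum L F.
Proof.
move=> F0; elim: m => [|m ih].
  by rewrite addn0; apply: eq_isum => k _; rewrite subr0.
rewrite -[RHS]ih addnS -(@isum_pred _ (fun k => F (k - m%:Z))); last by move=> k kL; apply: F0; lia.
by apply: eq_isum => k _; congr F; lia.
Qed.

Lemma isum_addn L m F : (forall k, (L < `|k|)%N -> F k = 0) ->
  isum (L + m) (fun k => F (k + m%:Z)) = isum L F.
Proof.
move=> F0; rewrite -[RHS]isum_opp -(@isum_subn L m (fun k => F (- k))); last first.
  by move=> k kL; apply: F0; rewrite abszN.
by rewrite -isum_opp; apply: eq_isum => k _; congr F; lia.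
Qed.
End SymmetricSums.

Lemma isumZ (A : pzRingType) L (F : int -> A) (c : A) : isum L (fun k => c * F k) = c * isum L F.
Proof. by rewrite /isum mulr_sumr. Qed.

Lemma ler_isum (A : numDomainType) L (F G : int -> A) :
  (forall k, (`|k| <= L)%N -> F k <= G k) -> isum L F <= isum L G.
Proof. by move=> FG; apply: ler_sum => k _; apply: FG; have := ltn_ord k; lia. Qed.

Lemma isum_cst (A : pzRingType) L (c : A) : isum L (fun=> c) = c * (2 * L + 1)%:R.
Proof. by rewrite /isum sumr_const card_ord mulr_natr. Qed.

(** * Fourier coefficients and truncated multipliers *)

Section Fourier.
Variable R : realType.
Implicit Types (f g : R -> R[i]) (a b c d h s t x : R) (k : int) (L n : nat).

Lemma modulus_isum L (F : int -> R[i]) :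
  modulus (isum L F) <= isum L (fun k => modulus (F k)).
Proof. exact: modulus_sum. Qed.

Definition ploc f := cloc f /\ forall x, f (x + 2 * pi) = f x.

Lemma plocZ (z : R[i]) f : ploc f -> ploc (fun x => z * f x).
Proof. by move=> [jf pf]; split=> [|x]; [exact: clocZ|rewrite pf]. Qed.

Lemma plocB f g : ploc f -> ploc g -> ploc (fun x => f x - g x).
Proof. by move=> [jf pf] [jg pg]; split=> [|x]; [exact: clocB|rewrite pf pg]. Qed.

Lemma ploc_shift f s : ploc f -> ploc (fun x => f (x + s)).
Proof. by move=> [jf pf]; split=> [|x]; [exact: (cloc_shift s jf)|rewrite addrAC pf]. Qed.

Lemma cexpi_periodic k x : cexpi (k%:~R * (x + 2 * pi)) = cexpi (k%:~R * x) :> R[i].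
Proof. by rewrite mulrDr cexpiD cexpi_int2pi mulr1. Qed.

Lemma ploc_cexpi k : ploc (fun x => cexpi (k%:~R * x)).
Proof. by split=> [|x]; [exact: cloc_cexpi|exact: cexpi_periodic]. Qed.

Lemma ploc_sum (I : Type) (r : seq I) (F : I -> R -> R[i]) :
  (forall i, ploc (F i)) -> ploc (fun x => \sum_(i <- r) F i x).
Proof.
move=> jF; split; first by apply: cloc_sum => i _; case: (jF i).
by move=> x; apply: eq_bigr => i _; case: (jF i).
Qed.

Lemma fourier_coefE f k : cloc f -> fourier_coef f k =
  ((2 * pi)^-1)%:C * citv (- pi) pi (fun x => f x * cexpi ((- k%:~R) * x)).
Proof.
move=> jf; rewrite /fourier_coef; congr (_ * _).
have -> : (fun x => f x * cexpi (- (k%:~R * x))) = (fun x => f x * cexpi ((- k%:~R) * x)).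
  by apply/funext => x; rewrite mulNr.
have [jr ji] := cloc_cexpi_mul (- k%:~R) jf.
have pp : - pi <= pi :> R by have := pi_gt0 R; lra.
by rewrite /citv /cintegral -(itv_integral_cc_co jr pp) -(itv_integral_cc_co ji pp).
Qed.

Lemma fourier_coefD f g k : cloc f -> cloc g ->
  fourier_coef (fun x => f x + g x) k = fourier_coef f k + fourier_coef g k.
Proof.
move=> jf jg; rewrite !fourier_coefE//; last exact: clocD.
rewrite -mulrDr -citvD; [|exact: cloc_cexpi_mul|exact: cloc_cexpi_mul].
by congr (_ * citv _ _ _); apply/funext => x; rewrite mulrDl.
Qed.

Lemma fourier_coefZ (z : R[i]) f k : cloc f ->
  fourier_coef (fun x => z * f x) k = z * fourier_coef f k.
Proof.
move=> jf; rewrite !fourier_coefE//; last exact: clocZ.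
rewrite mulrCA -(citvZ _ _ z); last exact: cloc_cexpi_mul.
by congr (_ * citv _ _ _); apply/funext => x; rewrite mulrA.
Qed.

Lemma fourier_coefB f g k : cloc f -> cloc g ->
  fourier_coef (fun x => f x - g x) k = fourier_coef f k - fourier_coef g k.
Proof.
move=> jf jg; have := fourier_coefD k jf (clocZ (-1) jg).
by rewrite fourier_coefZ// mulN1r; under eq_fun do rewrite mulN1r.
Qed.

Lemma fourier_coef_sum (I : Type) (r : seq I) (F : I -> R -> R[i]) k :
  (forall i, cloc (F i)) ->
  fourier_coef (fun x => \sum_(i <- r) F i x) k = \sum_(i <- r) fourier_coef (F i) k.
Proof.
move=> jF; elim: r => [|i r ih].
  rewrite big_nil (_ : (fun x => _) = fun x => 0 * 0); last first.
    by apply/funext => x; rewrite big_nil mul0r.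
  by rewrite (@fourier_coefZ 0 (fun=> 0))// ?mul0r//; exact: cloc_cst.
rewrite big_cons -ih -fourier_coefD//; last exact: cloc_sum.
by congr (fourier_coef _ k); apply/funext => x; rewrite big_cons.
Qed.

Lemma citv_cexpi_period k : citv (- pi) pi (fun x => cexpi (k%:~R * x)) =
  if k == 0 then (2 * pi : R)%:C else 0.
Proof.
have pp : - pi <= pi :> R by have := pi_gt0 R; lra.
case: ifPn => [/eqP ->|k0].
  rewrite (eq_citv (g := fun=> 1)); last by move=> x _; rewrite mul0r cexpi0.
  by rewrite citv_cst// mul1r; congr (_%:C); lra.
have kR : k%:~R != 0 :> R by rewrite intr_eq0.
have E : cexpi (k%:~R * pi) = cexpi (k%:~R * - pi) :> R[i].
  by rewrite -(cexpi_periodic k (- pi)); congr (cexpi (_ * _)); lra.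
case: E => Ec Es.
apply: complex_eq; rewrite ?Re_citv ?Im_citv.
  by rewrite itv_integral_cos// Es subrr mul0r.
by rewrite itv_integral_sin// Ec subrr mul0r.
Qed.

Lemma two_pi_neq0 : (2 * pi : R) != 0.
Proof. by rewrite mulf_neq0 ?lt0r_neq0 ?pi_gt0. Qed.

Lemma fourier_coef_cexpi j k : fourier_coef (fun x : R => cexpi (j%:~R * x)) k =
  if j == k then 1 else 0.
Proof.
rewrite fourier_coefE; last exact: cloc_cexpi.
have -> : (fun x : R => cexpi (j%:~R * x) * cexpi (- k%:~R * x)) =
    (fun x => cexpi ((j - k)%:~R * x)).
  by apply/funext => x; rewrite -cexpiD -mulrDl intrB.
rewrite citv_cexpi_period subr_eq0; case: ifP => _; last by rewrite mulr0.
by rewrite -CM mulVf ?two_pi_neq0.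
Qed.

(** By periodicity the variable may be translated by x, which moves x from the exponential to f.
    Summation over k then gives the convolution formula [tmul_conv]. *)
Lemma fourier_term_conv f k x : ploc f ->
  fourier_coef f k * cexpi (k%:~R * x) =
  ((2 * pi)^-1)%:C * citv (- pi) pi (fun t => f (t + x) * cexpi ((- k%:~R) * t)).
Proof.
move=> [jf pf]; rewrite fourier_coefE// -mulrA; congr (_ * _).
rewrite mulrC -(citvZ _ _ (cexpi (k%:~R * x))); last exact: cloc_cexpi_mul.
pose g y := cexpi (k%:~R * x) * (f y * cexpi ((- k%:~R) * y)).
rewrite -[LHS]/(citv (- pi) pi g) -(citv_periodic_shift x (f := g)).
- apply: eq_citv => t _; rewrite /g mulrCA -cexpiD; congr (_ * cexpi _); ring.
- by apply: clocZ; exact: cloc_cexpi_mul.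
- by move=> y; rewrite /g pf -!rmorphN /= cexpi_periodic.
Qed.

(** Truncation at degree L makes every multiplier a finite sum, so no convergence question arises;
    by [tmul_widen] the value of L is immaterial once it exceeds the support of the symbol. *)
Definition tmul L (m : int -> R[i]) f x : R[i] :=
  isum L (fun k => m k * fourier_coef f k * cexpi (k%:~R * x)).

Definition tkernel L (m : int -> R[i]) t : R[i] := isum L (fun k => m k * cexpi (k%:~R * t)).

Lemma ploc_tmul L m f : ploc (tmul L m f).
Proof. by apply: ploc_sum => k; apply: plocZ; exact: ploc_cexpi. Qed.

Lemma fourier_coef_isum L (c : int -> R[i]) k :
  fourier_coef (fun x => isum L (fun j => c j * cexpi (j%:~R * x))) k =
  if (`|k| <= L)%N then c k else 0.
Proof.
rewrite fourier_coef_sum; last by move=> i; apply: clocZ; exact: cloc_cexpi.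
rewrite -(isum_delta L c k); apply: eq_bigr => j _.
rewrite fourier_coefZ; last exact: cloc_cexpi.
by rewrite fourier_coef_cexpi; case: ifP => _; rewrite ?mulr1 ?mulr0.
Qed.

Lemma fourier_coef_tmul L m f k :
  fourier_coef (tmul L m f) k = if (`|k| <= L)%N then m k * fourier_coef f k else 0.
Proof. by rewrite -[RHS](fourier_coef_isum L (fun k => m k * fourier_coef f k)). Qed.

Lemma eq_tmul L m m' f g :
  (forall k, (`|k| <= L)%N -> m k * fourier_coef f k = m' k * fourier_coef g k) ->
  tmul L m f = tmul L m' g.
Proof. by move=> E; apply/funext => x; apply: eq_isum => k kL; rewrite E. Qed.

Lemma tmul_widen L L' m f : (L <= L')%N -> (forall k, (L < `|k|)%N -> m k = 0) ->
  tmul L' m f = tmul L m f.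
Proof.
move=> LL m0; apply/funext => x; apply: isum_widen => // k kL.
by rewrite m0// !mul0r.
Qed.

Lemma tmulM L L' m m' f : (forall k, (L' < `|k|)%N -> m' k = 0) ->
  tmul L m (tmul L' m' f) = tmul L (fun k => m k * m' k) f.
Proof.
move=> m0; apply: eq_tmul => k _; rewrite fourier_coef_tmul.
case: leqP => kL; first by rewrite mulrA.
by rewrite m0 ?mulr0 ?mul0r.
Qed.

Lemma tmulD L m m' f x : tmul L (fun k => m k + m' k) f x = tmul L m f x + tmul L m' f x.
Proof. by rewrite /tmul -isumD; apply: eq_isum => k _; rewrite !mulrDl. Qed.

Lemma tmulZ L m (z : R[i]) f x : tmul L (fun k => z * m k) f x = z * tmul L m f x.
Proof. by rewrite /tmul -isumZ; apply: eq_isum => k _; rewrite !mulrA. Qed.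

Lemma tmul_funD L m f g x : cloc f -> cloc g ->
  tmul L m (fun x => f x + g x) x = tmul L m f x + tmul L m g x.
Proof.
move=> jf jg; rewrite /tmul -isumD; apply: eq_isum => k _.
by rewrite fourier_coefD// mulrDr mulrDl.
Qed.

Lemma tmul_funZ L m (z : R[i]) f x : cloc f ->
  tmul L m (fun x => z * f x) x = z * tmul L m f x.
Proof.
move=> jf; rewrite /tmul -isumZ; apply: eq_isum => k _.
by rewrite fourier_coefZ// mulrCA !mulrA.
Qed.

Lemma tmul_funB L m f g x : cloc f -> cloc g ->
  tmul L m (fun x => f x - g x) x = tmul L m f x - tmul L m g x.
Proof.
move=> jf jg; have := tmul_funD L m x jf (clocZ (-1) jg).
by rewrite tmul_funZ// mulN1r; under eq_fun do rewrite mulN1r.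
Qed.

Lemma tmul_conv L m f x : ploc f ->
  tmul L m f x = ((2 * pi)^-1)%:C * citv (- pi) pi (fun t => f (t + x) * tkernel L m (- t)).
Proof.
move=> pf; have jf := (ploc_shift x pf).1.
rewrite /tmul /isum.
under eq_bigr => k _ do rewrite -mulrA fourier_term_conv// mulrCA.
rewrite -mulr_sumr; congr (_ * _).
transitivity (\sum_(k < 2 * L + 1) citv (- pi) pi (fun t => m ((k : nat)%:Z - L%:Z) *
    (f (t + x) * cexpi ((- ((k : nat)%:Z - L%:Z)%:~R) * t)))).
  by apply: eq_bigr => k _; rewrite -citvZ//; exact: cloc_cexpi_mul.
rewrite -citv_sum; last by move=> k _; apply: clocZ; exact: cloc_cexpi_mul.
apply: eq_citv => t _; rewrite /tkernel /isum mulr_sumr; apply: eq_bigr => k _.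
by rewrite mulrCA mulrN mulNr.
Qed.

End Fourier.

(** * Steklov averages as Fourier multipliers *)

Section SteklovFourier.
Variable R : realType.
Implicit Types (F : R -> R) (f g : R -> R[i]) (a b c d h s t x : R) (k : int) (L n : nat).

Lemma steklovE h f x : cloc f ->
  steklov h f x = (h^-1)%:C * citv (- (h / 2)) (h / 2) (fun s => f (s + x)).
Proof.
move=> jf; rewrite citv_shift// /steklov /citv; congr (_ * cintegral _ f).
by rewrite (addrC (- (h / 2))) (addrC (h / 2) x).
Qed.

(** The symbol of [steklov h], kept as an average of exponentials because this is the form that the
    exchange of integrals produces; [smultE] and [smult_sinc] evaluate it. *)
Definition smult h k : R[i] := (h^-1)%:C *
  citv (- (h / 2)) (h / 2) (fun s => cexpi (k%:~R * s)).

Lemma lebesgue_cos_lin c : lebesgue_measurable_fun (fun x : R => cos (c * x)).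
Proof. by apply: continuous_lebesgue_fun; exact: continuous_cos_lin. Qed.

Lemma lebesgue_sin_lin c : lebesgue_measurable_fun (fun x : R => sin (c * x)).
Proof. by apply: continuous_lebesgue_fun; exact: continuous_sin_lin. Qed.

Lemma loc_integrable_cos_mul F c : loc_integrable F ->
  loc_integrable (fun x => F x * cos (c * x)).
Proof.
move=> jF; apply: (loc_integrableM (k := 1) jF (lebesgue_cos_lin c)) => x.
exact: cos_max.
Qed.

Lemma loc_integrable_sin_mul F c : loc_integrable F ->
  loc_integrable (fun x => F x * sin (c * x)).
Proof.
move=> jF; apply: (loc_integrableM (k := 1) jF (lebesgue_sin_lin c)) => x.
exact: sin_max.
Qed.

(** Write cos(kx) = cos(k(x + s) - ks), expand, and translate the period. The real form is used
    because the exchange of integrals is stated for real functions. *)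
Lemma itv_integral_period_cos F k s : loc_integrable F ->
  (forall x, F (x + 2 * pi) = F x) ->
  itv_integral (- pi) pi (fun x => F (x + s) * cos (k%:~R * x)) =
  itv_integral (- pi) pi (fun y => F y * cos (k%:~R * y)) * cos (k%:~R * s) +
  itv_integral (- pi) pi (fun y => F y * sin (k%:~R * y)) * sin (k%:~R * s).
Proof.
move=> jF FP.
have jc := loc_integrable_cos_mul k%:~R jF.
have js := loc_integrable_sin_mul k%:~R jF.
pose G y := cos (k%:~R * s) * (F y * cos (k%:~R * y)) + sin (k%:~R * s) * (F y * sin (k%:~R * y)).
have jG : loc_integrable G by apply: loc_integrableD; exact: loc_integrableZ.
have GP x : G (x + 2 * pi) = G x.
  have [Ec Es] : cos (k%:~R * (x + 2 * pi)) = cos (k%:~R * x) /\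
      sin (k%:~R * (x + 2 * pi)) = sin (k%:~R * x).
    by have [] := cexpi_periodic k x.
  by rewrite /G FP Ec Es.
transitivity (itv_integral (- pi) pi (fun x => G (x + s))).
  apply: eq_itv_integral => x _; rewrite /G.
  have -> : k%:~R * x = k%:~R * (x + s) - k%:~R * s by ring.
  by rewrite cosB; ring.
rewrite itv_integral_shift//.
have -> : pi + s = - pi + s + 2 * pi :> R by ring.
rewrite itv_integral_periodic// itv_integralD ?itv_integralZ//; try exact: loc_integrableZ.
by ring.
Qed.

Lemma itv_integral_period_sin F k s : loc_integrable F ->
  (forall x, F (x + 2 * pi) = F x) ->
  itv_integral (- pi) pi (fun x => F (x + s) * sin (k%:~R * x)) =
  itv_integral (- pi) pi (fun y => F y * sin (k%:~R * y)) * cos (k%:~R * s) -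
  itv_integral (- pi) pi (fun y => F y * cos (k%:~R * y)) * sin (k%:~R * s).
Proof.
move=> jF FP.
have jc := loc_integrable_cos_mul k%:~R jF.
have js := loc_integrable_sin_mul k%:~R jF.
pose G y := cos (k%:~R * s) * (F y * sin (k%:~R * y)) + - sin (k%:~R * s) * (F y * cos (k%:~R * y)).
have jG : loc_integrable G by apply: loc_integrableD; exact: loc_integrableZ.
have GP x : G (x + 2 * pi) = G x.
  have [Ec Es] : cos (k%:~R * (x + 2 * pi)) = cos (k%:~R * x) /\
      sin (k%:~R * (x + 2 * pi)) = sin (k%:~R * x).
    by have [] := cexpi_periodic k x.
  by rewrite /G FP Ec Es.
transitivity (itv_integral (- pi) pi (fun x => G (x + s))).
  apply: eq_itv_integral => x _; rewrite /G.
  have -> : k%:~R * x = k%:~R * (x + s) - k%:~R * s by ring.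
  by rewrite sinB; ring.
rewrite itv_integral_shift//.
have -> : pi + s = - pi + s + 2 * pi :> R by ring.
rewrite itv_integral_periodic// itv_integralD ?itv_integralZ//; try exact: loc_integrableZ.
by ring.
Qed.

Lemma swap_cos F k c d : loc_integrable F -> (forall x, F (x + 2 * pi) = F x) ->
  itv_integral (- pi) pi (fun x => itv_integral c d (fun s => F (x + s)) * cos (k%:~R * x)) =
  itv_integral (- pi) pi (fun y => F y * cos (k%:~R * y)) * itv_integral c d (fun s => cos (k%:~R * s)) +
  itv_integral (- pi) pi (fun y => F y * sin (k%:~R * y)) * itv_integral c d (fun s => sin (k%:~R * s)).
Proof.
move=> jF FP.
have lc : loc_integrable (fun s : R => cos (k%:~R * s)) by case: (@cloc_cexpi R k%:~R).
have ls : loc_integrable (fun s : R => sin (k%:~R * s)) by case: (@cloc_cexpi R k%:~R).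
rewrite (@itv_integral_swap R _ _ _ _ _ _ 1)//; last 2 first.
- by apply: continuous_measurable_fun; exact: continuous_cos_lin.
- by move=> x; exact: cos_max.
under [in LHS]eq_fun do rewrite itv_integral_period_cos//.
by rewrite itv_integralD ?itv_integralZ//; exact: loc_integrableZ.
Qed.

Lemma swap_sin F k c d : loc_integrable F -> (forall x, F (x + 2 * pi) = F x) ->
  itv_integral (- pi) pi (fun x => itv_integral c d (fun s => F (x + s)) * sin (k%:~R * x)) =
  itv_integral (- pi) pi (fun y => F y * sin (k%:~R * y)) * itv_integral c d (fun s => cos (k%:~R * s)) -
  itv_integral (- pi) pi (fun y => F y * cos (k%:~R * y)) * itv_integral c d (fun s => sin (k%:~R * s)).
Proof.
move=> jF FP.
have lc : loc_integrable (fun s : R => cos (k%:~R * s)) by case: (@cloc_cexpi R k%:~R).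
have ls : loc_integrable (fun s : R => sin (k%:~R * s)) by case: (@cloc_cexpi R k%:~R).
rewrite (@itv_integral_swap R _ _ _ _ _ _ 1)//; last 2 first.
- by apply: continuous_measurable_fun; exact: continuous_sin_lin.
- by move=> x; exact: sin_max.
under [in LHS]eq_fun do rewrite itv_integral_period_sin// -mulNr.
by rewrite itv_integralD ?itv_integralZ// ?mulNr//; exact: loc_integrableZ.
Qed.

(** The average is exchanged with the Fourier integral, on real and imaginary parts against cos and
    sin. Local integrability of the average is a hypothesis here; in [X] it comes from Assumption
    A. *)
Lemma fourier_coef_steklov h f k : ploc f -> cloc (steklov h f) ->
  fourier_coef (steklov h f) k = smult h k * fourier_coef f k.
Proof.
move=> [jf pf] jS; rewrite !fourier_coefE// /smult.
rewrite [RHS]mulrCA; congr (_ * _).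
pose P x := citv (- (h / 2)) (h / 2) (fun s => f (x + s)).
have SE x : steklov h f x = (h^-1)%:C * P x.
  by rewrite steklovE//; congr (_ * _); apply: eq_citv => s _; rewrite addrC.
(* For h = 0 both sides vanish, the inverse of 0 being 0. *)
have [h0|h0] := eqVneq h 0.
  rewrite h0 invr0 mul0r (eq_citv (g := fun=> 0)); last first.
    by move=> x _; rewrite /steklov invr0 !mul0r.
  rewrite citv_cst ?mul0r//; have := pi_gt0 R; lra.
have jP : cloc P.
  have -> : P = (fun x => h%:C * steklov h f x); last exact: clocZ.
  by apply/funext => x; rewrite SE mulrA -CM divff// mul1r.
transitivity ((h^-1)%:C * citv (- pi) pi (fun x => P x * cexpi (- k%:~R * x))).
  rewrite -citvZ; last exact: cloc_cexpi_mul.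
  by apply: eq_citv => x _; rewrite SE mulrA.
rewrite -mulrA; congr (_ * _).
set c := - (h / 2); set d := h / 2.
have lM := @loc_integrable_cos_mul; have lMs := @loc_integrable_sin_mul.
have key (Fc : R -> R[i]) : cloc Fc ->
  citv (- pi) pi (fun x => Fc x * cexpi (- k%:~R * x)) =
  (itv_integral (- pi) pi (fun x => complex.Re (Fc x) * cos (k%:~R * x)) +
   itv_integral (- pi) pi (fun x => complex.Im (Fc x) * sin (k%:~R * x))) +i*
  (itv_integral (- pi) pi (fun x => complex.Im (Fc x) * cos (k%:~R * x)) -
   itv_integral (- pi) pi (fun x => complex.Re (Fc x) * sin (k%:~R * x))).
  move=> [jr ji]; apply: complex_eq; rewrite ?Re_citv ?Im_citv /=.
    rewrite -itv_integralD; [|exact: lM|exact: lMs].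
    apply: eq_itv_integral => x _; rewrite ReM /= mulNr cosN sinN; ring.
  rewrite -[- itv_integral _ _ _]mulN1r -itv_integralZ; last exact: lMs.
  rewrite -itv_integralD; [|exact: lM|by apply: loc_integrableZ; exact: lMs].
  by apply: eq_itv_integral => x _; rewrite ImM /= mulNr cosN sinN; ring.
rewrite !key//.
case: (jf) => fr fi.
have pr x : complex.Re (f (x + 2 * pi)) = complex.Re (f x) by rewrite pf.
have pi' x : complex.Im (f (x + 2 * pi)) = complex.Im (f x) by rewrite pf.
have sr := swap_cos k c d fr pr; have sr' := swap_sin k c d fr pr.
have si := swap_cos k c d fi pi'; have si' := swap_sin k c d fi pi'.
apply: complex_eq; rewrite ?ReM ?ImM ?Re_citv ?Im_citv /=.
  by rewrite [X in X + _]sr [X in _ + X]si'; ring.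
by rewrite [X in X - _]si [X in _ - X]sr'; ring.
Qed.

Lemma fourier_coef_shift f s k : ploc f ->
  fourier_coef (fun x => f (x + s)) k = cexpi (k%:~R * s) * fourier_coef f k.
Proof.
move=> [jf pf]; rewrite !fourier_coefE//; last exact: cloc_shift.
rewrite mulrCA; congr (_ * _).
pose g y := f y * cexpi (- k%:~R * y).
have jg : cloc g by exact: cloc_cexpi_mul.
rewrite -[in RHS](citv_periodic_shift s (f := g))//; last first.
  by move=> x; rewrite /g pf -!rmorphN /= cexpi_periodic.
rewrite -citvZ; last exact: cloc_shift.
apply: eq_citv => x _; rewrite /g mulrCA -cexpiD; congr (_ * cexpi _); ring.
Qed.

Lemma steklov_cexpi h k x :
  steklov h (fun y => cexpi (k%:~R * y)) x = smult h k * cexpi (k%:~R * x).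
Proof.
rewrite steklovE; last exact: cloc_cexpi.
rewrite /smult -mulrA; congr (_ * _); rewrite [RHS]mulrC -citvZ; last exact: cloc_cexpi.
by apply: eq_citv => s _; rewrite -cexpiD; congr cexpi; ring.
Qed.

Lemma steklovD h f g x : cloc f -> cloc g ->
  steklov h (fun x => f x + g x) x = steklov h f x + steklov h g x.
Proof. by move=> jf jg; rewrite -mulrDr -citvD. Qed.

Lemma steklovZ h (z : R[i]) f x : cloc f ->
  steklov h (fun x => z * f x) x = z * steklov h f x.
Proof.
by move=> jf; rewrite /steklov -[cintegral _ (fun _ => _)]/(citv _ _ _) citvZ// mulrCA.
Qed.

Lemma steklovB h f g x : cloc f -> cloc g ->
  steklov h (fun x => f x - g x) x = steklov h f x - steklov h g x.
Proof. by move=> jf jg; rewrite -mulrBr -citvB. Qed.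

Lemma steklov_tmul h L m f x :
  steklov h (tmul L m f) x = tmul L (fun k => smult h k * m k) f x.
Proof.
rewrite /steklov -[cintegral _ _]/(citv _ _ (tmul L m f)) /tmul /isum.
rewrite citv_sum; last by move=> k _; apply: clocZ; exact: cloc_cexpi.
rewrite mulr_sumr; apply: eq_bigr => k _.
have := steklovZ h (m ((k : nat)%:Z - L%:Z) * fourier_coef f ((k : nat)%:Z - L%:Z)) x
  (cloc_cexpi ((k : nat)%:Z - L%:Z)%:~R).
rewrite /steklov -[cintegral _ (fun _ => _ * _)]/(citv _ _ _) => ->.
rewrite -[X in _ * X]/(steklov h (fun y => cexpi (((k : nat)%:Z - L%:Z)%:~R * y)) x).
by rewrite steklov_cexpi; ring.
Qed.

Lemma smultE h k : 0 < h -> smult h k =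
  (if k == 0 then 1 else sin (k%:~R * h / 2) / (k%:~R * h / 2))%:C.
Proof.
move=> h0; rewrite /smult; have hh : - (h / 2) <= h / 2 by lra.
case: ifPn => [/eqP ->|k0].
  rewrite (eq_citv (g := fun=> 1)); last by move=> x _; rewrite mul0r cexpi0.
  rewrite citv_cst// mul1r -CM; congr (_%:C); field; lra.
have kR : k%:~R != 0 :> R by rewrite intr_eq0.
have -> : citv (- (h / 2)) (h / 2) (fun s => cexpi (k%:~R * s)) =
    (2 * sin (k%:~R * h / 2) / k%:~R)%:C.
  apply: complex_eq; rewrite ?Re_citv ?Im_citv /=.
    rewrite itv_integral_cos// mulrN sinN opprK mulrA; congr (_ / _); ring.
  by rewrite itv_integral_sin// mulrN cosN subrr mul0r.
by rewrite -CM; congr (_%:C); field; rewrite kR lt0r_neq0.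
Qed.

End SteklovFourier.

(** * Smooth functions described by differences *)

Section SmoothClass.
Variable R : realType.
Implicit Types (I J : set R) (f g phi dphi : R -> R) (x y t s c : R).

Lemma ler_normM (a b A B : R) : `|a| <= A -> `|b| <= B -> `|a * b| <= A * B.
Proof. by move=> aA bB; rewrite normrM ler_pM. Qed.

(* Functions of class C^{1,1}, phrased with differences only, so that
   it also makes sense for functions defined by removable singularities. *)
Definition cls I f := exists C : R, [/\ 0 <= C,
  forall x, I x -> `|f x| <= C,
  forall x y, I x -> I y -> `|f x - f y| <= C * `|x - y| &
  forall x t, I x -> I (x + t) -> I (x - t) ->
    `|f (x + t) + f (x - t) - 2 * f x| <= C * t ^+ 2].

Lemma cls_sub I J f : J `<=` I -> cls I f -> cls J f.
Proof.
move=> JI [C [C0 b l s]]; exists C; split => // *; first by apply: b; exact: JI.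
  by apply: l; exact: JI.
by apply: s; exact: JI.
Qed.

Lemma eq_cls I f g : (forall x, I x -> f x = g x) -> cls I f -> cls I g.
Proof.
move=> fg [C [C0 b l s]]; exists C; split => // [x Ix|x y Ix Iy|x t Ix Ip Im].
- by rewrite -fg//; exact: b.
- by rewrite -!fg//; exact: l.
- by rewrite -!fg//; exact: s.
Qed.

Lemma cls_cst I c : cls I (fun=> c).
Proof.
exists `|c|; split => // [x y _ _|x t _ _ _].
  by rewrite subrr normr0 mulr_ge0.
have -> : c + c - 2 * c = 0 by ring.
by rewrite normr0 mulr_ge0// sqr_ge0.
Qed.

Lemma clsD I f g : cls I f -> cls I g -> cls I (fun x => f x + g x).
Proof.
move=> [C [C0 b l s]] [C' [C0' b' l' s']]; exists (C + C'); split => [|x Ix|x y Ix Iy|x t Ix Ip Im].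
- exact: addr_ge0.
- by apply: le_trans (ler_normD _ _) _; apply: lerD; [exact: b|exact: b'].
- have -> : f x + g x - (f y + g y) = (f x - f y) + (g x - g y) by ring.
  rewrite [leRHS]mulrDl; apply: le_trans (ler_normD _ _) _; apply: lerD; [exact: l|exact: l'].
have -> : f (x + t) + g (x + t) + (f (x - t) + g (x - t)) - 2 * (f x + g x) =
   (f (x + t) + f (x - t) - 2 * f x) + (g (x + t) + g (x - t) - 2 * g x) by ring.
rewrite [leRHS]mulrDl; apply: le_trans (ler_normD _ _) _; apply: lerD; [exact: s|exact: s'].
Qed.

Lemma clsM I f g : cls I f -> cls I g -> cls I (fun x => f x * g x).
Proof.
move=> [C [C0 b l s]] [C' [C0' b' l' s']]; exists (4 * (C * C')).
have CC : 0 <= C * C' by exact: mulr_ge0.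
split => [|x Ix|x y Ix Iy|x t Ix Ip Im].
- by rewrite mulr_ge0.
- by apply: le_trans (ler_normM (b _ Ix) (b' _ Ix)) _; lra.
- have -> : f x * g x - f y * g y = f x * (g x - g y) + (f x - f y) * g y by ring.
  apply: le_trans (ler_normD _ _) _.
  have h1 := ler_normM (b _ Ix) (l' _ _ Ix Iy).
  have h2 := ler_normM (l _ _ Ix Iy) (b' _ Iy).
  have h3 : 0 <= C * C' * `|x - y| by rewrite mulr_ge0.
  by nra.
have lp := l _ _ Ip Ix; have lm := l _ _ Im Ix.
have lp' := l' _ _ Ip Ix; have lm' := l' _ _ Im Ix.
have ep : `|x + t - x| = `|t| by congr `|_|; ring.
have em : `|x - t - x| = `|t| by rewrite -normrN; congr `|_|; ring.
rewrite ep in lp lp'; rewrite em in lm lm'.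
have t2 : t ^+ 2 = `|t| * `|t| by rewrite -expr2 real_normK ?num_real.
have -> : f (x + t) * g (x + t) + f (x - t) * g (x - t) - 2 * (f x * g x) =
  (f x * (g (x + t) + g (x - t) - 2 * g x) + (f (x + t) + f (x - t) - 2 * f x) * g x)
  + ((f (x + t) - f x) * (g (x + t) - g x) + (f (x - t) - f x) * (g (x - t) - g x)) by ring.
apply: le_trans (ler_normD _ _) _.
have h1 := ler_normM (b _ Ix) (s' _ _ Ix Ip Im).
have h2 := ler_normM (s _ _ Ix Ip Im) (b' _ Ix).
have h3 := ler_normM lp lp'; have h4 := ler_normM lm lm'.
have := ler_normD (f x * (g (x + t) + g (x - t) - 2 * g x))
  ((f (x + t) + f (x - t) - 2 * f x) * g x).
have := ler_normD ((f (x + t) - f x) * (g (x + t) - g x))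
  ((f (x - t) - f x) * (g (x - t) - g x)).
move=> k1 k2; apply: (le_trans (lerD k2 k1)).
apply: (le_trans (lerD (lerD h1 h2) (lerD h3 h4))).
by rewrite t2 le_eqVlt; apply/orP; left; apply/eqP; ring.
Qed.

Lemma clsZ I f c : cls I f -> cls I (fun x => c * f x).
Proof. by move=> cf; apply: clsM => //; exact: cls_cst. Qed.

Lemma clsB I f g : cls I f -> cls I g -> cls I (fun x => f x - g x).
Proof.
move=> cf cg; apply: (@eq_cls _ (fun x => f x + -1 * g x)); first by move=> x _; ring.
by apply: clsD => //; exact: clsZ.
Qed.

Lemma cls_lin I f c : cls I f -> cls [set x | I (c * x)] (fun x => f (c * x)).
Proof.
move=> [C [C0 b l s]]; exists (C * (1 + `|c| + c ^+ 2)).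
have c1 : 0 <= `|c| by []. have c2 : 0 <= c ^+ 2 by exact: sqr_ge0.
have C1 : 0 <= C * `|c| by exact: mulr_ge0.
have C2 : 0 <= C * c ^+ 2 by exact: mulr_ge0.
split => [|x Ix|x y Ix Iy|x t Ix Ip Im].
- by rewrite mulr_ge0// !addr_ge0.
- by apply: le_trans (b _ Ix) _; rewrite !mulrDr mulr1; lra.
- apply: le_trans (l _ _ Ix Iy) _; rewrite -mulrBr normrM mulrA ler_wpM2r//.
  by rewrite !mulrDr mulr1; lra.
move: Ip Im => /=; rewrite mulrDr mulrBr => Ip Im.
apply: le_trans (s _ _ Ix Ip Im) _; rewrite exprMn mulrA ler_wpM2r ?sqr_ge0//.
by rewrite !mulrDr mulr1; lra.
Qed.

Lemma cls_setT_lin f c : cls setT f -> cls setT (fun x => f (c * x)).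
Proof. by move=> cf; apply: cls_sub (cls_lin c cf). Qed.

(** In the second difference of phi(f), the two Taylor remainders are quadratic in f(x + t) - f(x)
    and f(x - t) - f(x), hence O(t^2), and the linear terms recombine into [dphi] times the second
    difference of f. *)
Lemma cls_comp I J phi dphi f K : 0 <= K ->
  (forall y, J y -> `|phi y| <= K) -> (forall y, J y -> `|dphi y| <= K) ->
  (forall x y, J x -> J y -> `|phi y - phi x - dphi x * (y - x)| <= K * (y - x) ^+ 2) ->
  (forall x, I x -> J (f x)) -> cls I f -> cls I (fun x => phi (f x)).
Proof.
move=> K0 pb db tb fJ [C [C0 b l s]].
have nt (x y : R) : (y - x) ^+ 2 = `|y - x| * `|y - x| by rewrite -expr2 real_normK ?num_real.
exists (K * (1 + 3 * C + 2 * C ^+ 2)).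
have CC : 0 <= C ^+ 2 by exact: sqr_ge0.
have KC := mulr_ge0 K0 C0; have KCC := mulr_ge0 K0 CC.
split => [|x Ix|x y Ix Iy|x t Ix Ip Im].
- by rewrite mulr_ge0// !addr_ge0// mulr_ge0.
- by apply: le_trans (pb _ (fJ _ Ix)) _; rewrite !mulrDr mulr1; lra.
- have h := tb _ _ (fJ _ Iy) (fJ _ Ix); have d := db _ (fJ _ Iy); have ll := l _ _ Ix Iy.
  have h2 : `|f x - f y| <= 2 * C.
    by apply: le_trans (ler_normB _ _) _; have := b _ Ix; have := b _ Iy; lra.
  have -> : phi (f x) - phi (f y) =
    (phi (f x) - phi (f y) - dphi (f y) * (f x - f y)) + dphi (f y) * (f x - f y) by ring.
  apply: le_trans (ler_normD _ _) _; apply: (le_trans (lerD h (ler_normM d ll))).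
  rewrite nt.
  have : K * (`|f x - f y| * `|f x - f y|) <= K * (2 * C * (C * `|x - y|)).
    by rewrite ler_wpM2l// ler_pM.
  have := mulr_ge0 KC (normr_ge0 (x - y)); have := mulr_ge0 KCC (normr_ge0 (x - y)).
  have := mulr_ge0 K0 (normr_ge0 (x - y)).
  by rewrite !mulrDr !mulrDl expr2; lra.
have lp := l _ _ Ip Ix; have lm := l _ _ Im Ix.
have ep : `|x + t - x| = `|t| by congr `|_|; ring.
have em : `|x - t - x| = `|t| by rewrite -normrN; congr `|_|; ring.
rewrite ep in lp; rewrite em in lm.
have h1 := tb _ _ (fJ _ Ix) (fJ _ Ip); have h2 := tb _ _ (fJ _ Ix) (fJ _ Im).
have h3 := ler_normM (db _ (fJ _ Ix)) (s _ _ Ix Ip Im).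
have t2 : t ^+ 2 = `|t| * `|t| by rewrite -expr2 real_normK ?num_real.
rewrite !nt in h1 h2; rewrite t2 in h3 *.
have e1 : K * (`|f (x + t) - f x| * `|f (x + t) - f x|) <= K * ((C * `|t|) * (C * `|t|)).
  by rewrite ler_wpM2l// ler_pM.
have e2 : K * (`|f (x - t) - f x| * `|f (x - t) - f x|) <= K * ((C * `|t|) * (C * `|t|)).
  by rewrite ler_wpM2l// ler_pM.
have -> : phi (f (x + t)) + phi (f (x - t)) - 2 * phi (f x) =
  (phi (f (x + t)) - phi (f x) - dphi (f x) * (f (x + t) - f x)) +
  (phi (f (x - t)) - phi (f x) - dphi (f x) * (f (x - t) - f x)) +
  dphi (f x) * (f (x + t) + f (x - t) - 2 * f x) by ring.
apply: le_trans (ler_normD _ _) _; apply: le_trans (lerD (ler_normD _ _) (lexx _)) _.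
apply: (le_trans (lerD (lerD (le_trans h1 e1) (le_trans h2 e2)) h3)).
have tt : 0 <= `|t| * `|t| by exact: mulr_ge0.
have := mulr_ge0 KC tt; have := mulr_ge0 K0 tt.
rewrite !mulrDr !mulrDl expr2.
have -> : K * (C * `|t| * (C * `|t|)) = K * (C * C) * (`|t| * `|t|) by ring.
have -> : K * (C * (`|t| * `|t|)) = K * C * (`|t| * `|t|) by ring.
by lra.
Qed.

Lemma cls_inv I f c : 0 < c -> (forall x, I x -> c <= f x) -> cls I f ->
  cls I (fun x => (f x)^-1).
Proof.
move=> c0 fc cf.
have ci := invr_gt0 c; rewrite c0 in ci.
pose i := c^-1; have i0 : 0 <= i by rewrite ltW.
have inv_le y : c <= y -> y^-1 <= i.
  by move=> cy; rewrite lef_pV2// posrE// (lt_le_trans c0).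
apply: (@cls_comp I [set y | c <= y] GRing.inv (fun y => - (y^-1 * y^-1)) f
  (i + i ^+ 2 + i ^+ 3)) => //.
- by rewrite !addr_ge0// exprn_ge0.
- move=> y /= cy; have y0 := lt_le_trans c0 cy.
  have yi0 : 0 <= y^-1 by rewrite invr_ge0 ltW.
  rewrite ger0_norm//; apply: le_trans (inv_le _ cy) _.
  by rewrite -addrA lerDl addr_ge0// exprn_ge0.
- move=> y /= cy; have y0 := lt_le_trans c0 cy.
  have yi := inv_le _ cy; have yi0 : 0 <= y^-1 by rewrite invr_ge0 ltW.
  rewrite normrN ger0_norm ?mulr_ge0//; apply: (@le_trans _ _ (i ^+ 2)).
    by rewrite expr2 ler_pM.
  by rewrite addrAC lerDr addr_ge0// exprn_ge0.
- move=> x y /= cx cy; have y0 := lt_le_trans c0 cy; have x0 := lt_le_trans c0 cx.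
  have -> : y^-1 - x^-1 - - (x^-1 * x^-1) * (y - x) = (x^-1 * (x^-1 * y^-1)) * (y - x) ^+ 2.
    by field; rewrite !lt0r_neq0.
  have yi := inv_le _ cy; have yi0 : 0 <= y^-1 by rewrite invr_ge0 ltW.
  have xi := inv_le _ cx; have xi0 : 0 <= x^-1 by rewrite invr_ge0 ltW.
  rewrite ger0_norm; last by rewrite mulr_ge0 ?sqr_ge0// mulr_ge0// mulr_ge0.
  rewrite ler_wpM2r ?sqr_ge0//; apply: (@le_trans _ _ (i ^+ 3)).
    by rewrite exprS expr2 ler_pM// ?mulr_ge0// ler_pM.
  by rewrite lerDr addr_ge0// exprn_ge0.
Qed.

(** The collar Z <= |x| <= Z' separates scales. If |t| is below half its width, [d], then either x -
    t, x and x + t all lie in [-Z', Z'] or f vanishes at all three; if |t| >= d, boundedness of f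
    suffices at the cost of d^-2. *)
Lemma cls_extend f Z Z' : 0 <= Z -> Z < Z' -> (forall x, Z <= `|x| -> f x = 0) ->
  cls [set x | `|x| <= Z'] f -> cls setT f.
Proof.
move=> Z0 ZZ f0 [C [C0 b l s]].
pose d := (Z' - Z) / 2; have d0 : 0 < d by rewrite divr_gt0// subr_gt0.
have Ed : Z' = Z + 2 * d by rewrite /d; lra.
have di : 0 < d^-1 by rewrite invr_gt0.
have C1 : 0 <= C * d^-1 by rewrite mulr_ge0// ltW.
have C2 : 0 <= C * d^-1 ^+ 2 by rewrite mulr_ge0// sqr_ge0.
have b' x : `|f x| <= C.
  have [xZ|xZ] := leP `|x| Z'; first exact: b.
  by rewrite f0 ?normr0//; lra.
have far x y : `|x| <= Z -> Z' < `|y| -> d <= `|x - y|.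
  move=> xZ yZ; by have := ler_distD x y 0; rewrite !subr0 distrC; lra.
exists (C + C * d^-1 + 4 * (C * d^-1 ^+ 2)); split => [|x _|x y _ _|x t _ _ _].
- by rewrite !addr_ge0// mulr_ge0.
- by apply: le_trans (b' _) _; lra.
- have [xZ|xZ] := leP `|x| Z'; have [yZ|yZ] := leP `|y| Z'.
  + by apply: le_trans (l _ _ xZ yZ) _; rewrite ler_wpM2r//; lra.
  + rewrite (f0 y) ?subr0; last lra.
    have [xz|xz] := leP `|x| Z; last first.
      by rewrite f0 ?normr0 ?mulr_ge0// ?addr_ge0// ?mulr_ge0//; lra.
    have h := far _ _ xz yZ; apply: le_trans (b' x) _.
    have : C * d^-1 * d <= C * d^-1 * `|x - y| by rewrite ler_wpM2l.
    rewrite mulfVK ?lt0r_neq0//; have := mulr_ge0 C0 (normr_ge0 (x - y)).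
    have := mulr_ge0 C2 (normr_ge0 (x - y)); rewrite !mulrDl; lra.
  + rewrite (f0 x) ?sub0r ?normrN; last lra.
    have [yz|yz] := leP `|y| Z; last first.
      by rewrite f0 ?normr0 ?mulr_ge0// ?addr_ge0// ?mulr_ge0//; lra.
    have h := far _ _ yz xZ; rewrite distrC in h; apply: le_trans (b' y) _.
    have : C * d^-1 * d <= C * d^-1 * `|x - y| by rewrite ler_wpM2l.
    rewrite mulfVK ?lt0r_neq0//; have := mulr_ge0 C0 (normr_ge0 (x - y)).
    have := mulr_ge0 C2 (normr_ge0 (x - y)); rewrite !mulrDl; lra.
  + by rewrite !f0 ?subrr ?normr0 ?mulr_ge0// ?addr_ge0// ?mulr_ge0//; lra.
have T2 : 0 <= t ^+ 2 by exact: sqr_ge0.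
have [td|td] := leP d `|t|.
  have h : 4 * C <= 4 * (C * d^-1 ^+ 2) * t ^+ 2.
    have : d ^+ 2 <= t ^+ 2 by rewrite -(real_normK (num_real t)) ler_pXn2r ?nnegrE// ltW.
    move=> /(ler_wpM2l C2).
    have -> : C * d^-1 ^+ 2 * d ^+ 2 = C by field; rewrite lt0r_neq0.
    by lra.
  have := ler_normB (f (x + t) + f (x - t)) (2 * f x).
  have := ler_normD (f (x + t)) (f (x - t)).
  have := b' (x + t); have := b' (x - t); have := b' x.
  have -> : `|2 * f x| = 2 * `|f x| by rewrite normrM gtr0_norm.
  have := mulr_ge0 C0 T2; have := mulr_ge0 C1 T2; rewrite !mulrDl; lra.
have tri (y r : R) : `|r| <= `|t| -> `|y| <= `|y + r| + `|t|.
  by move=> rt; have := ler_normB (y + r) r; rewrite addrK; lra.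
have [n1|n1] := leP (Z + d) `|x|.
  have z1 : Z <= `|x + t| by have := tri x t (lexx _); lra.
  have z2 : Z <= `|x - t|.
    by have := tri x (- t); rewrite normrN => /(_ (lexx _)); lra.
  rewrite !f0//; last lra.
  by rewrite mulr0 subr0 addr0 normr0 mulr_ge0// !addr_ge0// mulr_ge0.
have z1 : `|x + t| <= Z' by have := ler_normD x t; lra.
have z2 : `|x - t| <= Z' by have := ler_normB x t; lra.
apply: le_trans (s _ _ _ z1 z2) _; first by rewrite /=; lra.
by rewrite ler_wpM2r//; lra.
Qed.

Lemma MVT_bound (g dg : R -> R) (a b K : R) : a <= b ->
  (forall s, a <= s <= b -> is_derive s (1 : R) g (dg s)) ->
  (forall s, a <= s <= b -> `|dg s| <= K) -> `|g b - g a| <= K * (b - a).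
Proof.
move=> ab dgP dgK.
have dgP' s : s \in `]a, b[%R -> is_derive s (1 : R) g (dg s).
  by rewrite in_itv /= => /andP[/ltW h1 /ltW h2]; apply: dgP; rewrite h1.
have cg : {within `[a, b], continuous g}.
  apply: derivable_within_continuous => s; rewrite in_itv /= => sab.
  by have [] := dgP _ sab.
have [c cab ->] := MVT_segment ab dgP' cg.
move: cab; rewrite in_itv /= => cab.
by rewrite normrM (ger0_norm (_ : 0 <= b - a)) ?subr_ge0// ler_wpM2r ?subr_ge0// dgK.
Qed.

(* Removable singularities: [psi x 1] is the average over the unit segment of
   the dilates [s ^ p * f (s * x)]. *)
Lemma cls_average I f (psi : R -> R -> R) p :
  (forall x s, I x -> 0 <= s <= 1 -> I (s * x)) ->
  (forall x, I x -> psi x 0 = 0) ->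
  (forall x s, I x -> 0 <= s <= 1 -> is_derive s (1 : R) (psi x) (s ^+ p * f (s * x))) ->
  cls I f -> cls I (fun x => psi x 1).
Proof.
move=> stI psi0 dpsi [C [C0 b l s]].
have sp (r : R) : 0 <= r <= 1 -> `|r ^+ p| <= 1.
  by move=> /andP[r0 r1]; rewrite ger0_norm ?exprn_ge0// exprn_ile1.
have key (g dg : R -> R) (K : R) : g 0 = 0 -> (forall r : R, 0 <= r <= 1 -> is_derive r (1 : R) g (dg r)) ->
    (forall r : R, 0 <= r <= 1 -> `|dg r| <= K) -> `|g 1| <= K.
  by move=> g0 h1 h2; have := MVT_bound ler01 h1 h2; rewrite g0 !subr0 mulr1.
exists C; split => // [x Ix|x y Ix Iy|x t Ix Ip Im].
- apply: (key (psi x) _ _ (psi0 _ Ix) (fun r => dpsi x r Ix)) => r r01.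
  by rewrite -[C]mul1r; apply: ler_normM; [exact: sp|apply: b; exact: stI].
- apply: (key (fun r => psi x r - psi y r) (fun r => r ^+ p * (f (r * x) - f (r * y)))).
  + by rewrite !psi0 ?subrr.
  + move=> r r01; rewrite mulrBr.
    exact: (is_deriveB (dpsi x r Ix r01) (dpsi y r Iy r01)).
  + move=> r r01; rewrite -[X in _ <= X]mul1r; apply: ler_normM; first exact: sp.
    apply: le_trans (l _ _ (stI _ _ Ix r01) (stI _ _ Iy r01)) _.
    rewrite -mulrBr normrM ler_wpM2l// -[leRHS]mul1r ler_wpM2r//.
    by case/andP: r01 => r0 r1; rewrite ger0_norm.
- apply: (key (fun r => psi (x + t) r + psi (x - t) r - 2 * psi x r)
    (fun r => r ^+ p * f (r * (x + t)) + r ^+ p * f (r * (x - t)) - 2 * (r ^+ p * f (r * x)))).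
  + by rewrite !psi0// mulr0 subr0 addr0.
  + move=> r r01.
    exact: (is_deriveB (is_deriveD (dpsi _ r Ip r01) (dpsi _ r Im r01))
      (is_deriveZ 2 (dpsi x r Ix r01))).
  + move=> r r01.
    have -> : r ^+ p * f (r * (x + t)) + r ^+ p * f (r * (x - t)) - 2 * (r ^+ p * f (r * x)) =
      r ^+ p * (f (r * x + r * t) + f (r * x - r * t) - 2 * f (r * x)).
      by rewrite mulrDr mulrBr; ring.
    rewrite -[X in _ <= X]mul1r; apply: ler_normM; first exact: sp.
    have Ip' := stI _ _ Ip r01; have Im' := stI _ _ Im r01; have Ix' := stI _ _ Ix r01.
    rewrite mulrDr in Ip'; rewrite mulrBr in Im'.
    apply: le_trans (s _ _ Ix' Ip' Im') _.
    rewrite ler_wpM2l// exprMn -[leRHS]mul1r ler_wpM2r ?sqr_ge0//.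
    by case/andP: r01 => r0 r1; rewrite exprn_ile1.
Qed.

Lemma cls_continuous f : cls setT f -> continuous f.
Proof.
move=> [C [C0 _ l _]] x; apply/cvgrPdist_le => e e0.
have C1 : 0 < C + 1 by rewrite ltr_pwDr.
near=> y; apply: le_trans (l _ _ I I) _.
apply: (@le_trans _ _ ((C + 1) * `|x - y|)); first by rewrite ler_wpM2r// lerDl.
rewrite -ler_pdivlMl// mulrC; near: y.
by apply: (@cvgr_dist_le _ _ _ (nbhs x) _ id x cvg_id); rewrite divr_gt0.
Unshelve. all: by end_near. Qed.

Lemma cls_lower_bound f Z : 0 <= Z -> cls setT f -> (forall x, `|x| <= Z -> 0 < f x) ->
  exists2 c, 0 < c & forall x, `|x| <= Z -> c <= f x.
Proof.
move=> Z0 cf f0.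
have [c cZ cm] := @EVT_min R f (- Z) Z ltac:(lra)
  (continuous_subspaceT (cls_continuous cf)).
exists (f c); first by apply: f0; move: cZ; rewrite in_itv /= ler_norml.
by move=> x xZ; apply: cm; rewrite in_itv /= -ler_norml.
Qed.
End SmoothClass.

(** * Special functions: removable singularities and cutoffs *)

Section SpecialFunctions.
Variable R : realType.
Implicit Types (I J : set R) (f g : R -> R) (x y t s c z b m : R).

(** A quadratic Taylor estimate already contains the derivative. This covers the truncated powers
    across 0, where two branches meet. *)
Lemma is_derive_of_quadratic f x (l K d : R) : 0 < d ->
  (forall h, `|h| < d -> `|f (x + h) - f x - l * h| <= K * h ^+ 2) ->
  is_derive x (1 : R) f l.
Proof.
move=> d0 fK.
have K0 : 0 <= K.
  have := fK (d / 2); rewrite ger0_norm; last by lra.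
  move=> /(_ ltac:(lra)) h.
  have := le_trans (normr_ge0 _) h; rewrite pmulr_lge0// exprn_gt0//; lra.
have c : (fun h => h^-1 *: ((f \o shift x) (h *: 1) - f x)) @ 0^' --> l.
  apply/cvgrPdist_le => e e0; near=> h.
  have h0 : h != 0 by near: h; exact: nbhs_dnbhs_neq.
  have hd : `|h| < d.
    by near: h; apply: dnbhs0_lt.
  have he : `|h| < e / (K + 1).
    by near: h; apply: dnbhs0_lt; rewrite divr_gt0// ltr_pwDr.
  rewrite /= /GRing.scale /= mulr1 (addrC h).
  have -> : l - h^-1 * (f (x + h) - f x) = - (h^-1 * (f (x + h) - f x - l * h)) by field.
  rewrite normrN normrM normfV ler_pdivrMl ?normr_gt0//.
  apply: le_trans (fK _ hd) _.
  rewrite -(real_normK (num_real h)) expr2 mulrCA ler_wpM2l//.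
  apply: (@le_trans _ _ ((K + 1) * `|h|)); first by rewrite ler_wpM2r// lerDl.
  by rewrite -ler_pdivlMl ?ltr_pwDr// mulrC ltW.
by apply: DeriveDef; [apply: cvgP c|exact: cvg_lim c].
Unshelve. all: by end_near. Qed.

(** Mean value inequality for [dg], then for g minus its tangent at x; the factor 1/2 of Taylor's
    formula is given up. *)
Lemma taylor2 (g dg ddg : R -> R) (lo hi B x y : R) :
  (forall s, lo <= s <= hi -> is_derive s (1 : R) g (dg s)) ->
  (forall s, lo <= s <= hi -> is_derive s (1 : R) dg (ddg s)) ->
  (forall s, lo <= s <= hi -> `|ddg s| <= B) -> lo <= x <= hi -> lo <= y <= hi ->
  `|g y - g x - dg x * (y - x)| <= B * (y - x) ^+ 2.
Proof.
move=> d1 d2 bB xI yI.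
have lip u v : lo <= u <= hi -> lo <= v <= hi -> u <= v -> `|dg v - dg u| <= B * (v - u).
  move=> /andP[u1 u2] /andP[v1 v2] uv.
  apply: (MVT_bound uv) => s /andP[s1 s2]; [apply: d2|apply: bB].
    by rewrite (le_trans u1 s1) (le_trans s2 v2).
  by rewrite (le_trans u1 s1) (le_trans s2 v2).
pose G s := g s - dg x * s.
have dG s : lo <= s <= hi -> is_derive s (1 : R) G (dg s - dg x).
  move=> sI; have h := d1 _ sI.
  have := is_deriveB h (is_derive_lin (dg x) s); exact.
have GE u v : G v - G u = g v - g u - dg x * (v - u) by rewrite /G; ring.
have [xy|/ltW yx] := leP x y.
  have sI s : x <= s <= y -> lo <= s <= hi.
    by move=> /andP[s1 s2]; case/andP: xI => a1 _; case/andP: yI => _ a2;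
       rewrite (le_trans a1 s1) (le_trans s2 a2).
  rewrite -GE expr2 mulrA; apply: (MVT_bound xy) => s sxy; first exact: dG (sI _ sxy).
  case/andP: (sxy) => s1 s2.
  apply: le_trans (lip _ _ xI (sI _ sxy) s1) _; rewrite ler_wpM2l//; last lra.
  by apply: le_trans (normr_ge0 _) (bB x xI).
have sI s : y <= s <= x -> lo <= s <= hi.
  by move=> /andP[s1 s2]; case/andP: yI => a1 _; case/andP: xI => _ a2;
     rewrite (le_trans a1 s1) (le_trans s2 a2).
rewrite -GE -normrN opprB; have -> : B * (y - x) ^+ 2 = B * (x - y) * (x - y) by ring.
apply: (MVT_bound yx) => s sxy; first exact: dG (sI _ sxy).
case/andP: (sxy) => s1 s2; rewrite distrC.
apply: le_trans (lip _ _ (sI _ sxy) xI s2) _; rewrite ler_wpM2l//; last lra.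
by apply: le_trans (normr_ge0 _) (bB x xI).
Qed.

Lemma sin_ler_norm x : `|sin x| <= `|x|.
Proof.
have H y : 0 <= y -> `|sin y| <= y.
  move=> y0; have := @MVT_bound R sin cos 0 y 1 y0 (fun s _ => is_derive_sin s) (fun s _ => cos_max s).
  by rewrite sin0 !subr0 mul1r.
have [x0|x0] := leP 0 x; first by rewrite (ger0_norm x0); exact: H.
have := H (- x); rewrite sinN normrN (ltr0_norm x0); apply; lra.
Qed.

Lemma cos_quadratic t : 0 <= 1 - cos t <= t ^+ 2 / 2.
Proof.
have -> : cos t = 1 - 2 * sin (t / 2) ^+ 2.
  have {1}-> : t = (t / 2) *+ 2 by rewrite mulr2n; lra.
  rewrite cos_mulr2n; have := cos2Dsin2 (t / 2); rewrite mulr2n; lra.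
have h := sqr_ge0 (sin (t / 2)).
have k : sin (t / 2) ^+ 2 <= (t / 2) ^+ 2.
  rewrite -(real_normK (num_real (sin _))) -(real_normK (num_real (t / 2))).
  by rewrite ler_pXn2r ?nnegrE//; exact: sin_ler_norm.
have -> : t ^+ 2 / 2 = 2 * (t / 2) ^+ 2 by field.
by apply/andP; split; lra.
Qed.

Lemma cls_cos : cls setT (@cos R).
Proof.
exists 1; split => // [x _|x y _ _|x t _ _ _]; first exact: cos_max.
  rewrite mul1r; wlog xy : x y / x <= y.
    move=> h; have [|/ltW] := leP x y; first exact: h.
    by move=> /h; rewrite distrC (distrC y).
  rewrite distrC (distrC x) (ger0_norm (_ : 0 <= y - x)) ?subr_ge0// -[y - x]mul1r.
  apply: (@MVT_bound R cos (fun s => - sin s)) => // s _; rewrite normrN; exact: sin_max.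
have -> : cos (x + t) + cos (x - t) - 2 * cos x = 2 * (cos x * (cos t - 1)).
  by rewrite cosD cosB; ring.
have /andP[h1 h2] := cos_quadratic t.
rewrite mul1r normrM gtr0_norm// -normrN -mulrN opprB.
have := ler_normM (cos_max x) (_ : `|1 - cos t| <= t ^+ 2 / 2).
rewrite ger0_norm// => /(_ h2); lra.
Qed.

Lemma cls_sin : cls setT (@sin R).
Proof.
exists 1; split => // [x _|x y _ _|x t _ _ _]; first exact: sin_max.
  rewrite mul1r; wlog xy : x y / x <= y.
    move=> h; have [|/ltW] := leP x y; first exact: h.
    by move=> /h; rewrite distrC (distrC y).
  rewrite distrC (distrC x) (ger0_norm (_ : 0 <= y - x)) ?subr_ge0// -[y - x]mul1r.
  by apply: (@MVT_bound R sin cos) => // s _; exact: cos_max.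
have -> : sin (x + t) + sin (x - t) - 2 * sin x = 2 * (sin x * (cos t - 1)).
  by rewrite sinD sinB; ring.
have /andP[h1 h2] := cos_quadratic t.
rewrite mul1r normrM gtr0_norm// -normrN -mulrN opprB.
have := ler_normM (sin_max x) (_ : `|1 - cos t| <= t ^+ 2 / 2).
rewrite ger0_norm// => /(_ h2); lra.
Qed.

Definition sinc x := if x == 0 then 1 else sin x / x.

Lemma is_derive_sinr x s : is_derive s (1 : R) (fun r => sin (r * x)) (x * cos (s * x)).
Proof.
have := is_derive_sin_lin x s; rewrite (mulrC x s).
by rewrite (_ : (fun y => sin (x * y)) = fun r => sin (r * x))//; apply/funext => r; rewrite mulrC.
Qed.

(** sinc x is the integral of cos(s x) over 0 <= s <= 1. *)
Lemma cls_sinc : cls setT sinc.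
Proof.
pose psi x s := if x == 0 then s else sin (s * x) / x.
apply: (@eq_cls _ _ (fun x => psi x 1)).
  by move=> x _; rewrite /psi /sinc mul1r.
apply: (@cls_average _ _ cos psi 0) => //; last exact: cls_cos.
  by move=> x _; rewrite /psi; case: ifP => // _; rewrite mul0r sin0 mul0r.
move=> x s _ _; rewrite expr0 mul1r /psi; have [->|x0] := eqVneq x 0.
  by rewrite mulr0 cos0; exact: is_derive_id.
have := is_derive_cmul x^-1 (is_derive_sinr x s); rewrite mulKf//.
by rewrite (_ : (fun y => x^-1 * _) = fun r => sin (r * x) / x)//; apply/funext => r; rewrite mulrC.
Qed.

(** The function (1 - cos x) / x^2 with its singularity removed, through 1 - cos x = 2
    sin^2(x/2). *)
Definition cosc x := sinc (x / 2) ^+ 2 / 2.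

Lemma coscE x : 1 - cos x = x ^+ 2 * cosc x.
Proof.
have -> : cos x = 1 - 2 * sin (x / 2) ^+ 2.
  have {1}-> : x = (x / 2) *+ 2 by rewrite mulr2n; lra.
  rewrite cos_mulr2n; have := cos2Dsin2 (x / 2); rewrite mulr2n; lra.
rewrite /cosc /sinc; have [x0|x0] := eqVneq (x / 2) 0.
  have -> : x = 0 by lra.
  by rewrite mul0r sin0; ring.
have x0' : x != 0 by apply: contra x0 => /eqP ->; rewrite mul0r.
by field.
Qed.

Lemma cls_cosc : cls setT cosc.
Proof.
have h : cls setT (fun x => sinc (x / 2)).
  apply: (@eq_cls _ _ (fun x => sinc (2^-1 * x))); first by move=> x _; rewrite mulrC.
  exact: cls_setT_lin cls_sinc.
apply: (@eq_cls _ _ (fun x => 2^-1 * (sinc (x / 2) * sinc (x / 2)))).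
  by move=> x _; rewrite /cosc expr2 mulrC.
by apply: clsZ; exact: clsM.
Qed.

Definition sinr x := if x == 0 then 6^-1 else (x - sin x) / x ^+ 3.

Lemma sinrE x : 1 - sinc x = x ^+ 2 * sinr x.
Proof.
rewrite /sinc /sinr; have [->|x0] := eqVneq x 0; first by ring.
by field.
Qed.

(** sinr x is the integral of s^2 cosc(s x) over 0 <= s <= 1, since the s-derivative of (x s - sin(s
    x)) / x^3 is (1 - cos(s x)) / x^2; at x = 0 the primitive is s^3 / 6. *)
Lemma cls_sinr : cls setT sinr.
Proof.
pose psi x s := if x == 0 then 6^-1 * s ^+ 3 else (x ^+ 3)^-1 * (x * s - sin (s * x)).
apply: (@eq_cls _ _ (fun x => psi x 1)).
  move=> x _; rewrite /psi /sinr; case: ifP => _; first by rewrite expr1n mulr1.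
  by rewrite mul1r mulr1 mulrC.
apply: (@cls_average _ _ cosc psi 2) => //; last exact: cls_cosc.
  move=> x _; rewrite /psi; case: ifP => _; first by rewrite expr0n mulr0.
  by rewrite mul0r sin0 mulr0 subr0 mulr0.
move=> x s _ _; rewrite /psi; have [->|x0] := eqVneq x 0.
  rewrite mulr0 /cosc /sinc mul0r eqxx expr1n.
  have d3 : is_derive s (1 : R) (fun r : R => r ^+ 3) (3 * s ^+ 2).
    apply: (@is_derive_of_quadratic _ _ _ (3 * `|s| + 1) 1) => // h h1.
    have -> : (s + h) ^+ 3 - s ^+ 3 - 3 * s ^+ 2 * h = (3 * s + h) * h ^+ 2 by ring.
    rewrite normrM (ger0_norm (sqr_ge0 h)) ler_wpM2r ?sqr_ge0//.
    apply: le_trans (ler_normD _ _) _; rewrite normrM (@gtr0_norm _ 3)//.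
    by rewrite lerD2l ltW.
  by apply: (is_derive_eq (is_derive_cmul _ d3)); field.
apply: (is_derive_eq (is_derive_cmul _ (is_deriveB (is_derive_lin x s) (is_derive_sinr x s)))).
have -> : x - x * cos (s * x) = x * (1 - cos (s * x)) by ring.
by rewrite coscE; field.
Qed.

Lemma cls_id Z : cls [set x | `|x| <= Z] (fun x : R => x).
Proof.
exists (`|Z| + 1); split => [|x /= xZ|x y _ _|x t _ _ _].
- by rewrite addr_ge0.
- by apply: le_trans xZ _; have := ler_norm Z; lra.
- by rewrite mulrDl mul1r lerDr mulr_ge0.
- have -> : x + t + (x - t) - 2 * x = 0 by ring.
  by rewrite normr0 mulr_ge0 ?sqr_ge0// addr_ge0.
Qed.

(** [g] is controlled on a bounded interval only; a factor supported strictly inside makes the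
    product global. *)
Lemma cls_cutoff_mul D g Z Z' : 0 <= Z -> Z < Z' -> cls setT D ->
  (forall x, Z <= `|x| -> D x = 0) -> cls [set x | `|x| <= Z'] g ->
  cls setT (fun x => D x * g x).
Proof.
move=> Z0 ZZ cD D0 cg; apply: (cls_extend Z0 ZZ).
  by move=> x xZ; rewrite D0// mul0r.
by apply: clsM => //; exact: cls_sub cD.
Qed.

(** The squared positive part is C^{1,1} and not C^2, exactly the regularity that [cls] records;
    cutoffs are built from it. *)
Definition pos2 x : R := Num.max x 0 ^+ 2.

Lemma cls_pos2 I f : cls I f -> cls I (fun x => pos2 (f x)).
Proof.
move=> cf; case: (cf) => C [C0 b _ _].
apply: (@cls_comp R I [set y | `|y| <= C] pos2 (fun y => 2 * Num.max y 0) f (1 + 2 * C + C ^+ 2)) => //.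
- by rewrite !addr_ge0// ?sqr_ge0// mulr_ge0.
- move=> y /= yC; rewrite /pos2 ger0_norm ?sqr_ge0//; apply: (@le_trans _ _ (C ^+ 2)).
    rewrite ler_pXn2r ?nnegrE// ?le_max ?lexx ?orbT//.
    by rewrite ge_max C0 andbT (le_trans (ler_norm _)).
  by rewrite lerDr addr_ge0// mulr_ge0.
- move=> y /= yC; rewrite normrM gtr0_norm// ger0_norm ?le_max ?lexx ?orbT//.
  have : Num.max y 0 <= C by rewrite ge_max C0 andbT (le_trans (ler_norm _)).
  by have := sqr_ge0 C; lra.
- move=> x y _ _; apply: (@le_trans _ _ (1 * (y - x) ^+ 2)); last first.
    by rewrite ler_wpM2r ?sqr_ge0//; have := sqr_ge0 C; lra.
  rewrite mul1r /pos2; have [x0|x0] := leP x 0; have [y0|y0] := leP y 0.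
  + by rewrite expr0n !mulr0 mul0r !subr0 normr0 sqr_ge0.
  + by rewrite expr0n !mulr0 mul0r !subr0 ger0_norm ?sqr_ge0// ler_pXn2r ?nnegrE//; lra.
  + by rewrite expr0n /= sub0r ler_norml; apply/andP; split; nra.
  + have -> : y ^+ 2 - x ^+ 2 - 2 * x * (y - x) = (y - x) ^+ 2 by ring.
    by rewrite ger0_norm ?sqr_ge0.
Qed.

(* smooth cutoff, equal to 1 on [-1, 1] and vanishing outside [-2, 2] *)
Definition chi x : R := 1 - pos2 (1 - pos2 (4 - x ^+ 2) / 9).

(** Here 4 - x^2 >= 3, so its square divided by 9 is at least 1 and the outer positive part
    vanishes: this is the origin of the constant 9. *)
Lemma chi1 x : `|x| <= 1 -> chi x = 1.
Proof.
move=> x1; have x2 : x ^+ 2 <= 1.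
  by rewrite -(real_normK (num_real x)) exprn_ile1.
rewrite /chi {2}/pos2 max_l; last by lra.
rewrite /pos2 max_r ?expr0n ?subr0//; nra.
Qed.

Lemma chi0 x : 2 <= `|x| -> chi x = 0.
Proof.
move=> x1; have x2 : 4 <= x ^+ 2.
  by rewrite -(real_normK (num_real x)); nra.
rewrite /chi {2}/pos2 max_r; last by lra.
by rewrite expr0n mul0r subr0 /pos2 max_l ?expr1n ?subrr.
Qed.

Lemma cls_chi : cls setT chi.
Proof.
apply: clsB; first exact: cls_cst.
apply: cls_pos2; apply: clsB; first exact: cls_cst.
apply: (@eq_cls _ _ (fun x => 9^-1 * pos2 (4 - x ^+ 2))); first by move=> x _; rewrite mulrC.
apply: clsZ; apply: (@cls_extend _ _ 2 3) => //; first by rewrite ltr_nat.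
  move=> x x2; have x4 : 4 <= x ^+ 2 by rewrite -(real_normK (num_real x)); nra.
  by rewrite /pos2 max_r ?expr0n//; lra.
apply: cls_pos2; apply: clsB; first exact: cls_cst.
by apply: (@eq_cls _ _ (fun x => x * x)); [by move=> x _; rewrite expr2|apply: clsM; exact: cls_id].
Qed.

Lemma cls_chi_lin c : cls setT (fun x => chi (c * x)).
Proof. exact: cls_setT_lin cls_chi. Qed.

(* |1 - a(z)|^2 = z^2 * den z for a(z) = (exp(iz) - 1) / (iz) *)
Definition den z := cosc z ^+ 2 + (z * sinr z) ^+ 2.

(** By oddness let z > 0. Beyond 1 the bound |sin| <= 1 decides; on (0, 1], equality would give cos
    c = 1 at some 0 < c < z by the mean value theorem, against sin c > 0. *)
Lemma sin_lt_norm z : z != 0 -> sin z != z.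
Proof.
move=> z0; apply/eqP => E.
have H y : 0 < y -> sin y != y.
  move=> y0; apply/eqP => Ey.
  have [y1|y1] := ltP 1 y; first by have := sin_max y; rewrite Ey gtr0_norm//; lra.
  have h := cos_quadratic y; have [|c cy] := @MVT R sin cos 0 y y0 (fun s _ => is_derive_sin s).
    exact: continuous_subspaceT (@continuous_sin R).
  rewrite sin0 !subr0 Ey => E1; have c1 : cos c = 1.
    by apply: (mulIf (lt0r_neq0 y0)); rewrite mul1r.
  move: cy; rewrite in_itv /= => /andP[c0 cy].
  have : 0 < sin c by apply: sin_gt0_pi; rewrite c0 /=; have := pi_ge2 R; lra.
  have := cos2Dsin2 c; rewrite c1 expr1n => cs sc.
  have : 0 < sin c ^+ 2 by rewrite exprn_gt0.
  by lra.
have [zp|zn|zE] := ltgtP z 0; last by move: z0; rewrite zE eqxx.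
  have := H (- z); rewrite sinN E eqxx => /(_ _); rewrite oppr_gt0 => /(_ zp); by [].
by have := H z zn; rewrite E eqxx.
Qed.

(** Away from 0 the second square is positive because sin z <> z; at 0 it vanishes and cosc 0 = 1/2
    takes over. Hence the symbol of the forward average equals 1 at the origin only. *)
Lemma den_gt0 z : 0 < den z.
Proof.
rewrite /den; have [->|z0] := eqVneq z 0.
  by rewrite /cosc mul0r /sinc eqxx mul0r expr1n expr0n addr0 exprn_gt0.
apply: ltr_wpDl; first exact: sqr_ge0.
rewrite lt0r sqr_ge0 andbT sqrf_eq0 mulf_neq0// /sinr (negbTE z0).
rewrite mulf_neq0 ?invr_eq0 ?expf_neq0//.
by rewrite subr_eq0 eq_sym sin_lt_norm.
Qed.

Lemma cls_den_inv Z : 0 < Z -> cls [set z | `|z| <= Z] (fun z => (den z)^-1).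
Proof.
move=> Z0.
(* [den] with its factor z cut off: unlike z itself, the cut factor is in the global class, and the
   two functions agree on [-Z, Z]. *)
pose d z := cosc z * cosc z + (chi (Z^-1 * z) * z * sinr z) * (chi (Z^-1 * z) * z * sinr z).
have cd : cls setT d.
  apply: clsD; first by apply: clsM; exact: cls_cosc.
  have h : cls setT (fun z => chi (Z^-1 * z) * z * sinr z).
    apply: clsM; last exact: cls_sinr.
    apply: (@cls_cutoff_mul _ _ (2 * Z) (3 * Z)).
    - by rewrite mulr_ge0// ltW.
    - by rewrite ltr_pM2r// ltr_nat.
    - exact: cls_chi_lin.
    - move=> x xZ; apply: chi0; rewrite normrM gtr0_norm ?invr_gt0// mulrC ler_pdivlMr//.
    - exact: cls_id.
  exact: clsM.
have dE z : `|z| <= Z -> d z = den z.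
  move=> zZ; rewrite /d /den chi1 ?mul1r -?expr2//.
  by rewrite normrM gtr0_norm ?invr_gt0// mulrC ler_pdivrMr// mul1r.
have [c c0 cd'] := cls_lower_bound (ltW Z0) cd (fun x xZ => eq_ind_r (fun v => 0 < v) (den_gt0 x) (dE x xZ)).
apply: (@eq_cls _ _ (fun z => (d z)^-1)); first by move=> z zZ; rewrite dE.
by apply: (cls_inv c0) => //; exact: cls_sub cd.
Qed.

End SpecialFunctions.

(** * Truncated powers and the Riesz and Fejer windows *)

Section TruncatedPowers.
Variable R : realType.
Implicit Types (I J : set R) (f g : R -> R) (x y t s c z a b m e : R).

Definition pospow b y : R := Num.max y 0 `^ b.

Lemma pospow_gt0E b y : 0 < y -> pospow b y = y `^ b.
Proof. by move=> y0; rewrite /pospow max_l// ltW. Qed.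

Lemma pospow_le0E b y : b != 0 -> y <= 0 -> pospow b y = 0.
Proof. by move=> b0 y0; rewrite /pospow max_r// powR0. Qed.

Lemma pospow_ge0 b y : 0 <= pospow b y.
Proof. exact: powR_ge0. Qed.

(** Exactly the data that [cls_comp] requires of the outer function, with b y_+^(b-1) as
    derivative. *)
Definition taylor_pow J b := exists K : R, [/\ 0 <= K,
  forall y, J y -> `|pospow b y| <= K,
  forall y, J y -> `|b * pospow (b - 1) y| <= K &
  forall x y, J x -> J y ->
    `|pospow b y - pospow b x - b * pospow (b - 1) x * (y - x)| <= K * (y - x) ^+ 2].

(** A power is monotone, so it is bounded by the sum of its endpoint values whatever the sign of the
    exponent. *)
Lemma powR_sup e m s : 0 < m -> m <= s <= 2 -> s `^ e <= 2 `^ e + m `^ e.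
Proof.
move=> m0 /andP[ms s2]; have s0 : 0 < s by lra.
have [e0|e0] := leP 0 e.
  apply: (@le_trans _ _ (2 `^ e)); last by rewrite lerDl powR_ge0.
  by apply: ge0_ler_powR; rewrite // nnegrE ltW.
apply: (@le_trans _ _ (m `^ e)); last by rewrite lerDr powR_ge0.
rewrite -(opprK e) !(powRN _ (- e)) lef_pV2 ?posrE ?powR_gt0//.
by apply: ge0_ler_powR; rewrite // ?nnegrE ltW// oppr_gt0.
Qed.

Lemma taylor_pow_seg b m (B x y : R) : 0 < m -> m <= x <= 2 -> m <= y <= 2 ->
  (forall s, m <= s <= 2 -> `|b * ((b - 1) * s `^ (b - 1 - 1))| <= B) ->
  `|pospow b y - pospow b x - b * pospow (b - 1) x * (y - x)| <= B * (y - x) ^+ 2.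
Proof.
move=> m0 xI yI hB.
have p s : m <= s <= 2 -> 0 < s by move=> /andP[? _]; lra.
rewrite !pospow_gt0E ?(p x)// ?(p y)//.
apply: (@taylor2 R (fun s => s `^ b) (fun s => b * s `^ (b - 1)) _ m 2 B x y _ _ hB) => //.
  by move=> s sI; exact: is_derive1_powR (p _ sI).
by move=> s sI; apply: is_derive_cmul; exact: is_derive1_powR (p _ sI).
Qed.

(** Away from 0 the power is smooth for every exponent, including negative ones. *)
Lemma taylor_pow_far b m : 0 < m -> taylor_pow [set y | m <= y <= 2] b.
Proof.
move=> m0.
pose S e := 2 `^ e + m `^ e.
have S0 e : 0 <= S e by rewrite addr_ge0 ?powR_ge0.
have p s : m <= s <= 2 -> 0 < s by move=> /andP[? _]; lra.
exists (S b + `|b| * S (b - 1) + `|b| * (`|b - 1| * S (b - 1 - 1))).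
have n1 : 0 <= `|b| * S (b - 1) by rewrite mulr_ge0.
have n2 : 0 <= `|b| * (`|b - 1| * S (b - 1 - 1)) by rewrite !mulr_ge0.
split => [|y /= yI|y /= yI|x y /= xI yI].
- exact: addr_ge0 (addr_ge0 (S0 b) n1) n2.
- rewrite ger0_norm ?pospow_ge0// pospow_gt0E ?p//.
  by apply: le_trans (powR_sup b m0 yI) _; rewrite -addrA lerDl addr_ge0.
- rewrite normrM (ger0_norm (pospow_ge0 _ _)) pospow_gt0E ?p//.
  apply: (@le_trans _ _ (`|b| * S (b - 1))); first by rewrite ler_wpM2l// powR_sup.
  by rewrite addrAC lerDr addr_ge0.
- apply: le_trans (taylor_pow_seg m0 xI yI (B := `|b| * (`|b - 1| * S (b - 1 - 1))) _) _.
    move=> s sI; rewrite !normrM ler_wpM2l// ler_wpM2l// ger0_norm ?powR_ge0//.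
    exact: powR_sup.
  by rewrite ler_wpM2r ?sqr_ge0// lerDr addr_ge0.
Qed.

(** For b >= 2 the second derivative b (b - 1) y_+^(b-2) stays bounded across 0. When x and y are on
    different sides of 0, the estimate y^b <= 2^(b-2) y^2 replaces Taylor's formula, because |y - x|
    exceeds the positive one of the two. *)
Lemma taylor_pow_near b : 2 <= b -> taylor_pow [set y | y <= 2] b.
Proof.
move=> b2; have b0 : b != 0 by lra. have b1 : b - 1 != 0 by lra.
pose P := 2 `^ (b - 2) : R; have P0 : 0 <= P by exact: powR_ge0.
have mono e y : 0 <= e -> 0 <= y -> y <= 2 -> y `^ e <= 2 `^ e.
  by move=> e0 y0 y2; apply: ge0_ler_powR; rewrite // nnegrE.
(* In order, the summands bound the power, its derivative, the remainder when x and y are on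
   different sides of 0, and the remainder when both are positive. *)
pose K := 2 `^ b + b * 2 `^ (b - 1) + (1 + b) * P + b * (b - 1) * P : R.
have k1 : 0 <= 2 `^ b :> R by exact: powR_ge0.
have k2 : 0 <= b * 2 `^ (b - 1) by rewrite mulr_ge0 ?powR_ge0//; lra.
have k3 : 0 <= (1 + b) * P by rewrite mulr_ge0//; lra.
have k4 : 0 <= b * (b - 1) * P by rewrite mulr_ge0// mulr_ge0//; lra.
have pw y : 0 < y -> y <= 2 -> y `^ b <= P * y ^+ 2 /\ y `^ (b - 1) <= P * y.
  move=> y0 y2.
  have yP : y `^ (b - 2) <= P by apply: mono => //; [lra|exact: ltW].
  split.
    have {1}-> : b = (b - 2) + 2%:R by lra.
    rewrite powRD ?lt0r_neq0 ?implybT// (powR_mulrn 2 (ltW y0)).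
    by rewrite ler_wpM2r ?sqr_ge0.
  have -> : b - 1 = (b - 2) + 1 by ring.
  by rewrite powRD ?lt0r_neq0 ?implybT// (powRr1 (ltW y0)) ler_wpM2r// ltW.
exists K; split => [|y /= yI|y /= yI|x y /= xI yI].
- by rewrite !addr_ge0.
- rewrite ger0_norm ?pospow_ge0//; apply: (@le_trans _ _ (2 `^ b)); last by rewrite /K; lra.
  have [y0|y0] := leP y 0; first by rewrite pospow_le0E.
  by rewrite pospow_gt0E//; apply: mono => //; [lra|exact: ltW].
- rewrite ger0_norm ?mulr_ge0 ?pospow_ge0//; last lra.
  apply: (@le_trans _ _ (b * 2 `^ (b - 1))); last by rewrite /K; lra.
  rewrite ler_wpM2l//; first lra.
  have [y0|y0] := leP y 0; first by rewrite pospow_le0E// powR_ge0.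
  by rewrite pospow_gt0E//; apply: mono => //; [lra|exact: ltW].
have D2 : 0 <= (y - x) ^+ 2 by exact: sqr_ge0.
have [x0|x0] := leP x 0; have [y0|y0] := leP y 0.
- by rewrite !pospow_le0E// !mulr0 mul0r !subr0 normr0 mulr_ge0// /K; lra.
- rewrite (pospow_le0E b0 x0) (pospow_le0E b1 x0) mulr0 mul0r !subr0.
  rewrite ger0_norm ?pospow_ge0// pospow_gt0E//.
  have [h _] := pw y y0 yI; apply: (le_trans h).
  apply: (@le_trans _ _ (P * (y - x) ^+ 2)).
    by rewrite ler_wpM2l// ler_pXn2r ?nnegrE//; lra.
  have bP : 0 <= b * P by rewrite mulr_ge0//; lra.
  by rewrite ler_wpM2r// /K mulrDl mul1r; lra.
- rewrite (pospow_le0E b0 y0) !pospow_gt0E// sub0r.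
  have [h1 h2] := pw x x0 xI.
  have p1 : 0 <= x `^ b by exact: powR_ge0.
  have p2 : 0 <= x `^ (b - 1) by exact: powR_ge0.
  have q1 : 0 <= b * x `^ (b - 1) * (x - y) by rewrite !mulr_ge0//; lra.
  have q2 : b * x `^ (b - 1) * (x - y) <= b * (P * x) * (x - y).
    by rewrite ler_wpM2r ?ler_wpM2l//; lra.
  have r1 : P * x ^+ 2 <= P * (y - x) ^+ 2 by rewrite ler_wpM2l//; nra.
  have r2 : b * (P * x) * (x - y) <= b * P * (y - x) ^+ 2.
    have -> : b * (P * x) * (x - y) = b * P * (x * (x - y)) by ring.
    by rewrite ler_wpM2l ?mulr_ge0//; [lra|nra].
  have r3 : 0 <= b * (b - 1) * P * (y - x) ^+ 2 by rewrite mulr_ge0.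
  have r4 := mulr_ge0 k1 D2; have r5 := mulr_ge0 k2 D2.
  have -> : K * (y - x) ^+ 2 = 2 `^ b * (y - x) ^+ 2 + b * 2 `^ (b - 1) * (y - x) ^+ 2 +
    (P * (y - x) ^+ 2 + b * P * (y - x) ^+ 2) + b * (b - 1) * P * (y - x) ^+ 2.
    by rewrite /K; ring.
  by rewrite ler_norml; apply/andP; split; lra.
- pose m := Num.min x y; have m0 : 0 < m by rewrite lt_min x0.
  have xm : m <= x <= 2 by rewrite ge_min lexx xI.
  have ym : m <= y <= 2 by rewrite ge_min lexx orbT yI.
  apply: le_trans (taylor_pow_seg m0 xm ym (B := b * (b - 1) * P) _) _.
    move=> s /andP[ms s2].
    have sP : s `^ (b - 1 - 1) <= P.
      have -> : b - 1 - 1 = b - 2 by ring.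
      by apply: mono; lra.
    have s0 : 0 <= s `^ (b - 1 - 1) by exact: powR_ge0.
    rewrite ger0_norm; last by rewrite !mulr_ge0//; lra.
    by rewrite mulrA ler_wpM2l// mulr_ge0//; lra.
  by rewrite ler_wpM2r// /K; lra.
Qed.

Lemma cls_pospow I J b f : taylor_pow J b -> (forall x, I x -> J (f x)) -> cls I f ->
  cls I (fun x => pospow b (f x)).
Proof.
move=> [K [K0 h1 h2 h3]] fJ cf.
exact: (@cls_comp R I J (pospow b) (fun y => b * pospow (b - 1) y) f K).
Qed.

Lemma is_derive_pospow J b y (d : R) : taylor_pow J b -> 0 < d ->
  (forall h : R, `|h| < d -> J (y + h)) -> is_derive y (1 : R) (pospow b) (b * pospow (b - 1) y).
Proof.
move=> [K [_ _ _ h3]] d0 Jy.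
apply: (@is_derive_of_quadratic _ _ _ _ K d d0) => h hd.
have Jy0 : J y by have := Jy 0; rewrite normr0 addr0; exact.
by have := h3 y (y + h) Jy0 (Jy _ hd); rewrite (addrC y h) addrK.
Qed.

Definition riesz_quot b x : R := if x == 0 then b else (1 - pospow b (1 - x ^+ 2)) / x ^+ 2.

Lemma riesz_quotE b x : 1 - pospow b (1 - x ^+ 2) = x ^+ 2 * riesz_quot b x.
Proof.
rewrite /riesz_quot; have [->|x0] := eqVneq x 0; last by field.
by rewrite expr0n mul0r subr0 pospow_gt0E// powR1 subrr.
Qed.

(** The quotient is the integral over 0 <= s <= 1 of 2 b s (1 - (s x)^2)_+^(b-1), so [cls_average]
    applies with p = 1 and the regularity needed is that of the exponent b - 1. The margin [d]
    around the values 1 - x^2 gives differentiability from the estimate on [J]. *)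
Lemma cls_riesz_quot I J b (Z d : R) : taylor_pow J b -> taylor_pow J (b - 1) -> 0 < d ->
  (forall x, I x -> `|x| <= Z) -> (forall x s, I x -> 0 <= s <= 1 -> I (s * x)) ->
  (forall x (h : R), I x -> `|h| < d -> J (1 - x ^+ 2 + h)) ->
  cls I (riesz_quot b).
Proof.
move=> tb tb1 d0 IZ stI JI.
pose psi x s := if x == 0 then b * s ^+ 2 else (x ^+ 2)^-1 * (1 - pospow b (1 - (s * x) ^+ 2)).
apply: (@eq_cls _ _ (fun x => psi x 1)).
  move=> x _; rewrite /psi /riesz_quot; case: ifP => _; first by rewrite expr1n mulr1.
  by rewrite mul1r mulrC.
have cI : cls I (fun x => 2 * b * pospow (b - 1) (1 - x ^+ 2)).
  apply: clsZ; apply: (cls_pospow tb1).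
    by move=> x Ix; have := JI x 0 Ix; rewrite normr0 addr0; exact.
  apply: clsB; first exact: cls_cst.
  apply: (@eq_cls _ _ (fun x => x * x)); first by move=> x _; rewrite expr2.
  by apply: clsM; apply: cls_sub (cls_id Z).
apply: (@cls_average _ _ _ psi 1 stI) cI.
  move=> x _; rewrite /psi; case: ifP => _; first by rewrite expr0n mulr0.
  by rewrite mul0r expr0n subr0 pospow_gt0E// powR1 subrr mulr0.
have d2 s : is_derive s (1 : R) (fun r : R => r ^+ 2) (2 * s).
  apply: (@is_derive_of_quadratic _ _ _ _ 1 1) => // h _.
  have -> : (s + h) ^+ 2 - s ^+ 2 - 2 * s * h = h ^+ 2 by ring.
  by rewrite mul1r ger0_norm ?sqr_ge0.
move=> x s Ix s01; rewrite /psi; have [x0|x0] := eqVneq x 0.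
  rewrite x0 mulr0 expr0n subr0 pospow_gt0E// powR1.
  by apply: (is_derive_eq (is_derive_cmul _ (d2 s))); ring.
have dp := is_derive_pospow tb d0 (fun h hd => JI _ h (stI _ _ Ix s01) hd).
have di : is_derive s (1 : R) (fun r => 1 - (r * x) ^+ 2) (- (x ^+ 2 * (2 * s))).
  have := is_deriveB (is_derive_cst (1 : R) s 1) (is_derive_cmul (x ^+ 2) (d2 s)).
  rewrite sub0r (_ : _ - _ = fun r => 1 - (r * x) ^+ 2)//.
  by apply/funext => r; rewrite /= exprMn mulrC.
have := is_deriveB (is_derive_cst (1 : R) s 1) 
  (@is_derive1_comp R (pospow b) (fun r => 1 - (r * x) ^+ 2) s _ _ dp di).
move=> /(is_derive_cmul (x ^+ 2)^-1) h; apply: (is_derive_eq h).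
by field.
Qed.

(** b >= 3 keeps b - 1 >= 2, as [taylor_pow_near] demands; the radius 3 exceeds the support |x| <= 2
    of [chi]. *)
Lemma cls_riesz_quot_near b : 3 <= b -> cls [set x | `|x| <= 3] (riesz_quot b).
Proof.
move=> b3.
apply: (@cls_riesz_quot _ [set y | y <= 2] b 3 1) => //.
- by apply: taylor_pow_near; lra.
- by apply: taylor_pow_near; lra.
- move=> x s /= x3 /andP[s0 s1]; rewrite normrM (ger0_norm s0).
  by apply: le_trans x3; rewrite ler_piMl.
- by move=> x h _ h1 /=; have := sqr_ge0 x; have := ler_norm h; lra.
Qed.

(** Here 1 - x^2 >= 7/16 stays above 1/4 even after a perturbation by 1/8, so every exponent is
    allowed; the radius 3/4 contains the support |x| <= 1/4 of chi(8 x). *)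
Lemma cls_riesz_quot_far b : cls [set x | `|x| <= 3 / 4] (riesz_quot b).
Proof.
apply: (@cls_riesz_quot _ [set y | 4^-1 <= y <= 2] b (3 / 4) 8^-1) => //.
- by apply: taylor_pow_far; rewrite invr_gt0.
- by apply: taylor_pow_far; rewrite invr_gt0.
- move=> x s /= x3 /andP[s0 s1]; rewrite normrM (ger0_norm s0).
  by apply: le_trans x3; rewrite ler_piMl.
- move=> x h /= x3 h1; have x2 : x ^+ 2 <= (3 / 4) ^+ 2.
    by rewrite -(real_normK (num_real x)) ler_pXn2r ?nnegrE//; lra.
  have := sqr_ge0 x; have := ler_norm h; have := ler_norm (- h); rewrite normrN.
  by move=> *; apply/andP; split; lra.
Qed.

(** For |x| <= 1 one has (1 - x^2)^b <= 1 - x^2, so the quotient is at least 1; beyond, it is x^-2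
    >= 1/9. *)
Lemma riesz_quot_ge b x : 1 <= b -> `|x| <= 3 -> 9^-1 <= riesz_quot b x.
Proof.
move=> b1 x3; rewrite /riesz_quot; have [_|x0] := eqVneq x 0; first lra.
have x2 : 0 < x ^+ 2 by rewrite lt0r sqrf_eq0 x0 sqr_ge0.
have x9 : x ^+ 2 <= 9.
  have -> : 9 = 3 ^+ 2 :> R by ring.
  by rewrite -(real_normK (num_real x)) ler_pXn2r ?nnegrE.
rewrite ler_pdivlMr//; have [w|w] := leP (1 - x ^+ 2) 0.
  by rewrite pospow_le0E//; lra.
rewrite pospow_gt0E//.
have : (1 - x ^+ 2) `^ b <= 1 - x ^+ 2.
  by apply: ge1r_powR => //; rewrite w /=; lra.
by lra.
Qed.

(** The tangent at the midpoint lies above the graph; added at u and v, the linear terms cancel. *)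
Lemma powR_midpoint_concave a (u v : R) : 0 < a <= 1 -> 0 <= u -> 0 <= v ->
  u `^ a + v `^ a <= 2 * ((u + v) / 2) `^ a.
Proof.
move=> /andP[a0 a1] u0 v0.
have [c0|c0] := eqVneq (u + v) 0.
  have uE : u = 0 by lra. have vE : v = 0 by lra.
  by rewrite uE vE powR0 ?lt0r_neq0// addr0 mulr_ge0// powR_ge0.
pose c := (u + v) / 2; have cp : 0 < c by rewrite /c lt0r; apply/andP; split; [lra|lra].
have tangent y : 0 <= y -> y `^ a <= c `^ a + a * c `^ (a - 1) * (y - c).
  rewrite le_eqVlt => /predU1P[<-|y0].
    rewrite powR0 ?lt0r_neq0//.
    have -> : a * c `^ (a - 1) * (0 - c) = - (a * (c * c `^ (a - 1))) by ring.
    rewrite (mulr_powRB1 (ltW cp) a0).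
    have : 0 <= (1 - a) * c `^ a by rewrite mulr_ge0 ?powR_ge0// subr_ge0.
    by lra.
  have d s : 0 < s -> is_derive s (1 : R) (fun s => s `^ a) (a * s `^ (a - 1)).
    by move=> s0; exact: is_derive1_powR.
  have dec s s' : 0 < s -> s <= s' -> s' `^ (a - 1) <= s `^ (a - 1).
    move=> s0 ss; have -> : a - 1 = - (1 - a) by ring.
    have s'0 : 0 < s' by exact: lt_le_trans ss.
    rewrite !powRN lef_pV2 ?posrE ?powR_gt0//.
    by apply: ge0_ler_powR; rewrite ?nnegrE ?subr_ge0 ?(ltW s0) ?(ltW s'0).
  have cont lo hi : 0 < lo -> {within `[lo, hi], continuous (fun s : R => s `^ a)}.
    move=> l0; apply: derivable_within_continuous => s; rewrite in_itv /= => /andP[ls _].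
    by have [] := d s (lt_le_trans l0 ls).
  have [yc|cy] := leP y c.
    have [s|s ys E] := @MVT_segment R (fun s => s `^ a) (fun s => a * s `^ (a - 1)) y c yc _ (cont _ _ y0).
      by rewrite in_itv /= => /andP[ys _]; apply: d; exact: lt_trans ys.
    move: ys; rewrite in_itv /= => /andP[ys sc].
    have := dec s c (lt_le_trans y0 ys) sc => h.
    have : a * c `^ (a - 1) * (c - y) <= a * s `^ (a - 1) * (c - y).
      by rewrite ler_wpM2r ?subr_ge0// ler_wpM2l// ltW.
    by rewrite -E; lra.
  have [s|s ys E] := @MVT_segment R (fun s => s `^ a) (fun s => a * s `^ (a - 1)) c y (ltW cy) _ (cont _ _ cp).
    by rewrite in_itv /= => /andP[ys _]; apply: d; exact: lt_trans ys.
  move: ys; rewrite in_itv /= => /andP[ys sc].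
  have := dec c s cp ys => h.
  have : a * s `^ (a - 1) * (y - c) <= a * c `^ (a - 1) * (y - c).
    by rewrite ler_wpM2r ?subr_ge0 ?(ltW cy)// ler_wpM2l// ltW.
  by rewrite -E; lra.
have := lerD (tangent u u0) (tangent v v0).
have -> : c `^ a + a * c `^ (a - 1) * (u - c) + (c `^ a + a * c `^ (a - 1) * (v - c)) =
  2 * c `^ a + a * c `^ (a - 1) * (u + v - 2 * c) by ring.
have -> : u + v - 2 * c = 0 by rewrite /c; field.
by rewrite mulr0 addr0.
Qed.

(* hypotheses ensuring the decay [n (1 + n|t|)^(-1-a)] of the kernel of [psi] *)
Definition concave_window (psi : R -> R) a C := [/\ forall x, 1 <= `|x| -> psi x = 0,
  forall x, 0 <= psi x, forall x, `|x| <= 1 -> psi x <= C * (1 - `|x|) `^ a &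
  forall x t, `|x + t| <= 1 -> `|x - t| <= 1 -> psi (x + t) + psi (x - t) <= 2 * psi x].

(** In 1 - x^2 = (1 + |x|)(1 - |x|) the first factor to a power a <= 1 is at most 2, hence the
    constant. Midpoint concavity comes from that of t^a, which is also increasing, and from that of
    1 - x^2. *)
Lemma concave_window_riesz a : 0 < a <= 1 -> concave_window (riesz a) a 2.
Proof.
move=> a01; case/andP: (a01) => a0 a1.
have sq x : x ^+ 2 = `|x| ^+ 2 by rewrite real_normK ?num_real.
split => [x x1|x|x x1|x t p m].
- by rewrite /riesz max_r ?powR0 ?lt0r_neq0// sq; nra.
- exact: powR_ge0.
- have nx := normr_ge0 x.
  have x2 : `|x| ^+ 2 <= 1 by rewrite exprn_ile1.
  rewrite /riesz max_l sq; last lra.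
  have -> : 1 - `|x| ^+ 2 = (1 + `|x|) * (1 - `|x|) by ring.
  rewrite powRM; [|lra|lra]; rewrite ler_wpM2r ?powR_ge0//.
  apply: (@le_trans _ _ (1 + `|x|)); last lra.
  by apply: ler1_powR => //; lra.
have tri : `|x| <= 1.
  have := ler_normD (x + t) (x - t); have -> : x + t + (x - t) = 2 * x by ring.
  by rewrite normrM gtr0_norm//; lra.
have w1 y : `|y| <= 1 -> 0 <= 1 - y ^+ 2 by move=> h; rewrite sq subr_ge0 exprn_ile1.
rewrite /riesz !max_l ?w1//.
apply: le_trans (powR_midpoint_concave a01 (w1 _ p) (w1 _ m)) _.
rewrite ler_wpM2l//; apply: ge0_ler_powR; rewrite ?nnegrE ?(ltW a0)// ?w1//.
  by rewrite divr_ge0// addr_ge0 ?w1.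
by have := sqr_ge0 t; nra.
Qed.

Lemma concave_window_fejer : concave_window (@fejer R) 1 1.
Proof.
split => [x x1|x|x x1|x t p m].
- by rewrite /fejer max_r//; lra.
- by rewrite /fejer le_max lexx orbT.
- by rewrite /fejer max_l ?powRr1 ?mul1r ?subr_ge0.
have tri : 2 * `|x| <= `|x + t| + `|x - t|.
  have := ler_normD (x + t) (x - t); have -> : x + t + (x - t) = 2 * x by ring.
  by rewrite normrM gtr0_norm.
by rewrite /fejer !max_l ?subr_ge0//; lra.
Qed.

(** Reduces an exponent above 1 to one in (0, 1], where the window is concave, and conversely raises
    a small exponent to a smooth one. *)
Lemma riesz_power a p : 0 < a -> (0 < p)%N -> forall x, riesz a x = riesz (a / p%:R) x ^+ p :> R.
Proof.
move=> a0 p0 x; rewrite /riesz -(powR_mulrn p (powR_ge0 _ _)) -powRrM divfK//.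
by rewrite pnatr_eq0 -lt0n.
Qed.

Lemma riesz_pospow a x : riesz a x = pospow a (1 - x ^+ 2) :> R.
Proof. by []. Qed.

End TruncatedPowers.

(** * Decay of kernels *)

Section KernelDecay.
Variable R : realType.
Implicit Types (G : R -> R) (a : int -> R) (t x s q C : R) (L m n j Z : nat) (k : int).

Lemma cexpi_conj_sum t : cexpi t + cexpi (- t) - 2 = ((2 * cos t - 2 : R)%:C) :> R[i].
Proof.
apply: complex_eq; rewrite ?ReD ?ImD ?ReN ?ImN /= ?cosN ?sinN.
  by ring.
by ring.
Qed.

Definition second_diff m a k := a (k + m%:Z) + a (k - m%:Z) - 2 * a k.

(** Multiplying the kernel by exp(imt) + exp(-imt) - 2 replaces its coefficients by their second
    differences of step m: a double summation by parts. The range grows by m to hold the shifted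
    coefficients. *)
Lemma tkernel_second_diff a L m t : (forall k, (L < `|k|)%N -> a k = 0) ->
  modulus (tkernel L (fun k => (a k)%:C) t) * (2 - 2 * cos (m%:R * t)) <=
  isum (L + m) (fun k => `|second_diff m a k|).
Proof.
move=> a0; set K := tkernel _ _ _.
pose E k : R[i] := cexpi (k%:~R * t).
have ED k k' : E (k + k') = E k * E k' by rewrite /E intrD mulrDl cexpiD.
pose F k := (a k)%:C * E k.
have F0 k : (L < `|k|)%N -> F k = 0 by move=> /a0 E0; rewrite /F E0 mul0r.
have S1 : isum (L + m) (fun k => (a (k - m%:Z))%:C * E k) = E m%:Z * K.
  rewrite -[K]/(isum L F) -(isum_subn m F0) -isumZ; apply: eq_isum => k _.
  by rewrite /F mulrCA -ED; congr (_ * E _); lia.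
have S2 : isum (L + m) (fun k => (a (k + m%:Z))%:C * E k) = E (- m%:Z) * K.
  rewrite -[K]/(isum L F) -(isum_addn m F0) -isumZ; apply: eq_isum => k _.
  by rewrite /F mulrCA -ED; congr (_ * E _); lia.
have S3 : isum (L + m) (fun k => (a k)%:C * E k) = K.
  by apply: isum_widen => //; exact: leq_addr.
have S : isum (L + m) (fun k => (second_diff m a k)%:C * E k) = (2 * cos (m%:R * t) - 2)%:C * K.
  rewrite -cexpi_conj_sum.
  have -> : cexpi (m%:R * t) = E m%:Z by [].
  have -> : cexpi (- (m%:R * t)) = E (- m%:Z) by rewrite /E mulrNz mulNr.
  rewrite mulrBl mulrDl -S1 -S2 -{1}S3 -isumZ -isumD -isumN -isumD.
  by apply: eq_isum => k _; rewrite /second_diff CB CD CM Cnat; ring.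
have c1 : 0 <= 2 - 2 * cos (m%:R * t).
  by have := cos_le1 (m%:R * t); lra.
have -> : modulus K * (2 - 2 * cos (m%:R * t)) = modulus ((2 * cos (m%:R * t) - 2)%:C * K).
  by rewrite modulusM modulus_real -normrN opprB (ger0_norm c1) mulrC.
rewrite -S; apply: le_trans (modulus_isum _ _) _; apply: ler_isum => k _.
by rewrite modulusM modulus_real modulus_cexpi mulr1.
Qed.

Lemma pi_le4 : pi <= 4 :> R.
Proof. by have := pihalf_lt2 R; lra. Qed.

(** [m] is the first integer with m |t| > pi / 2. Then m |t| is at most pi / 2 + |t| <= 3 pi / 2 <=
    6, and the cosine is not positive there. A step of order 1 / |t| keeps 2 - 2 cos(m t) bounded
    below uniformly in t. *)
Lemma exists_good_step t : 0 < `|t| -> `|t| <= pi ->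
  exists m : nat, [/\ (0 < m)%N, 2 <= 2 - 2 * cos (m%:R * t) & m%:R * `|t| <= 6].
Proof.
move=> t0 tpi; have p0 := pi_gt0 R; have p4 := pi_le4.
pose y := pi / (2 * `|t|).
have y0 : 0 <= y by rewrite divr_ge0// ?ltW// mulr_gt0.
have yt : y * `|t| = pi / 2 by rewrite /y; field; rewrite lt0r_neq0.
exists (Num.truncn y).+1.
have /andP[hi lo] := truncn_itv y0.
move: hi; rewrite -(lerD2r 1) natr1 => hi.
set m := (Num.truncn y).+1 in lo hi *.
have h1 : pi / 2 < m%:R * `|t| by rewrite -yt ltr_pM2r.
have h2 : m%:R * `|t| <= pi / 2 + `|t| by rewrite -yt -[X in _ + X]mul1r -mulrDl ler_wpM2r.
have hc : cos (m%:R * t) = cos (m%:R * `|t|).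
  by have [t1|t1] := ger0P t => //; rewrite mulrN cosN.
split => //; last by lra.
have -> : cos (m%:R * t) = - cos (m%:R * `|t| - pi).
  by rewrite hc -[in RHS](cosN) opprB cosB cospi sinpi; ring.
have : 0 <= cos (m%:R * `|t| - pi) by apply: cos_ge0_pihalf; apply/andP; split; lra.
by lra.
Qed.

(** Dyadic form, up to constants, of |K(t)| <= C n (1 + n|t|)^(-1-theta) with q = 2^-theta; q < 1 is
    what makes the sum over dyadic boxes converge. *)
Definition kdecay n C q (K : R -> R[i]) :=
  (forall t, modulus (K t) <= C * n%:R) /\
  forall j t, `|t| <= pi -> 2 ^+ j <= n%:R * `|t| -> modulus (K t) <= C * n%:R * (q / 2) ^+ j.

Definition wker G n L t : R[i] := tkernel L (fun k => (G (k%:~R / n%:R))%:C) t.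

Definition window (T : zmodType) Z (G : R -> T) := forall x, Z%:R < `|x| -> G x = 0.

Lemma window_scaled (T : zmodType) Z (G : R -> T) n k : (0 < n)%N -> window Z G ->
  (Z * n < `|k|)%N -> G (k%:~R / n%:R) = 0.
Proof.
move=> n0 wG kZ; apply: wG.
rewrite normrM normfV (ger0_norm (ler0n _ n)) ltr_pdivlMr ?ltr0n// -natrM.
by rewrite -intr_norm -pmulrn ltr_nat.
Qed.

Lemma wker_widen Z G n L t : (0 < n)%N -> window Z G -> (Z * n <= L)%N ->
  wker G n L t = wker G n (Z * n) t.
Proof.
move=> n0 wG ZL; apply: isum_widen => // k kZ.
by rewrite (window_scaled n0 wG kZ) mul0r.
Qed.

(** With a step m of order 1 / |t|, a second difference of k -> G(k/n) is O((m/n)^2) = O(4^-j), and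
    O(n) of them occur: hence n 4^-j, that is q = 1/2. *)
Lemma smooth_kdecay Z G : cls setT G -> window Z G ->
  exists2 C, 0 <= C & forall n L, (0 < n)%N -> (Z * n <= L)%N -> kdecay n C 2^-1 (wker G n L).
Proof.
move=> [C [C0 b _ s]] wG.
(* 18 is half of 6^2, from m / n <= 6 2^-j and the lower bound 2 for 2 - 2 cos(m t); there are 2 (Z
   n + m) + 1 <= (2 Z + 13) n terms because m <= 6 n. *)
pose C' := 18 * C * (2 * Z%:R + 13).
have Z0 : 0 <= Z%:R :> R by exact: ler0n.
have C'0 : 0 <= C' by rewrite !mulr_ge0// addr_ge0// mulr_ge0.
exists C' => // n L n0 ZL.
have n1 : 1 <= n%:R :> R by rewrite ler1n.
have np : 0 < n%:R :> R by lra.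
split => [t|j t tpi jt]; rewrite (wker_widen _ n0 wG ZL).
  apply: le_trans (modulus_isum _ _) _.
  apply: (@le_trans _ _ (isum (Z * n) (fun=> C))).
    apply: ler_isum => k _; rewrite modulusM modulus_cexpi mulr1 modulus_real; exact: b.
  rewrite isum_cst natrD !natrM.
  have : C * (2 * (Z%:R * n%:R) + 1) <= C * ((2 * Z%:R + 13) * n%:R).
    by rewrite ler_wpM2l//; nra.
  have : 0 <= C * ((2 * Z%:R + 13) * n%:R) by rewrite !mulr_ge0 ?addr_ge0 ?mulr_ge0.
  by rewrite /C'; lra.
have t0 : 0 < `|t|.
  have : 0 < n%:R * `|t| by apply: lt_le_trans jt; rewrite exprn_gt0.
  by rewrite pmulr_rgt0.
have [m [m0 mc mt]] := exists_good_step t0 tpi.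
pose r := 2^-1 ^+ j : R; have r0 : 0 < r by rewrite exprn_gt0// invr_gt0.
have r1 : r <= 1 by rewrite exprn_ile1//; lra.
have mr : m%:R / n%:R <= 6 * r.
  rewrite ler_pdivrMr//; have : m%:R * 2 ^+ j <= 6 * n%:R :> R.
    apply: (@le_trans _ _ (m%:R * (n%:R * `|t|))); first by rewrite ler_wpM2l.
    by nra.
  move=> /(ler_wpM2r (ltW r0)).
  have r2 : 2 ^+ j * r = 1 by rewrite /r -exprMn divff// expr1n.
  by rewrite -(mulrA m%:R) r2 mulr1; lra.
have m6 : m%:R <= 6 * n%:R :> R.
  by move: mr; rewrite ler_pdivrMr//; nra.
have key : modulus (wker G n (Z * n) t) * 2 <= isum (Z * n + m) (fun=> C * (36 * r ^+ 2)).
  apply: (@le_trans _ _ (modulus (wker G n (Z * n) t) * (2 - 2 * cos (m%:R * t)))).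
    by rewrite ler_wpM2l// modulus_ge0.
  have := @tkernel_second_diff (fun k => G (k%:~R / n%:R)) (Z * n) m t
    (fun k => @window_scaled _ Z G n k n0 wG).
  move=> /le_trans; apply.
  apply: ler_isum => k _; rewrite /second_diff intrD intrB.
  rewrite (mulrDl (k%:~R : R)) (mulrBl n%:R^-1 (k%:~R : R)).
  apply: le_trans (s _ _ I I I) _; rewrite ler_wpM2l//.
  have -> : 36 * r ^+ 2 = (6 * r) ^+ 2 by ring.
  by rewrite ler_pXn2r ?nnegrE ?divr_ge0// mulr_ge0// ltW.
rewrite isum_cst natrD natrM natrD natrM in key.
have cnt : 2 * (Z%:R * n%:R + m%:R) + 1 <= (2 * Z%:R + 13) * n%:R :> R by nra.
have cr : 0 <= C * (36 * r ^+ 2) by rewrite mulr_ge0// mulr_ge0// sqr_ge0.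
have := le_trans key (ler_wpM2l cr cnt).
have -> : (2^-1 / 2) ^+ j = r ^+ 2 :> R.
  by rewrite /r -exprM mulnC exprM; congr (_ ^+ _); field.
have -> : C' * n%:R * r ^+ 2 = C * (36 * r ^+ 2) * ((2 * Z%:R + 13) * n%:R) / 2.
  by rewrite /C'; field.
by lra.
Qed.

(** Inside, second differences are nonpositive by concavity, and over all k they sum to zero. So the
    sum of their moduli is governed by the O(m) indices near the edges, where psi is O(2^(-j al));
    as m is O(n 2^-j) this gives n 2^(-j (1 + al)). *)
Lemma concave_kdecay psi (al C : R) : 0 < al <= 1 -> concave_window psi al C ->
  exists2 C', 0 <= C' &
    forall n L, (0 < n)%N -> (n <= L)%N -> kdecay n C' (2^-1 `^ al) (wker psi n L).
Proof.
move=> /andP[al0 al1] [w0 wp wb wc].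
have C0 : 0 <= C.
  have := wb 0; rewrite normr0 subr0 powR1 mulr1 => /(_ ler01).
  exact: le_trans (wp 0).
have wZ : window 1 psi by move=> x x1; apply: w0; exact: ltW.
have p1 x : psi x <= C.
  have [x1|x1] := leP 1 `|x|; first by rewrite w0.
  apply: le_trans (wb _ (ltW x1)) _; rewrite -[leRHS]mulr1 ler_wpM2l//.
  apply: (@le_trans _ _ (1 `^ al)); last by rewrite powR1.
  apply: ge0_ler_powR; rewrite ?nnegrE ?subr_ge0 ?(ltW al0) ?(ltW x1) ?powR1//.
pose C1 := 12 * (12 * C).
have C10 : 0 <= C1 by rewrite /C1 !mulr_ge0.
exists (10 * C1); first by rewrite mulr_ge0.
move=> n L n0 nL.
have n1 : 1 <= n%:R :> R by rewrite ler1n.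
have np : 0 < n%:R :> R by lra.
have E1 t : wker psi n L t = wker psi n n t.
  by have := @wker_widen 1 psi n L t n0 wZ; rewrite mul1n; exact.
split => [t|j t tpi jt]; rewrite E1.
  apply: le_trans (modulus_isum _ _) _.
  apply: (@le_trans _ _ (isum n (fun=> C))).
    by apply: ler_isum => k _; rewrite modulusM modulus_cexpi mulr1 modulus_real ger0_norm.
  rewrite isum_cst natrD natrM -mulrA.
  have : C * (2 * n%:R + 1) <= C * (3 * n%:R) by rewrite ler_wpM2l//; lra.
  have : 0 <= C * n%:R by rewrite mulr_ge0// ltW.
  by rewrite /C1; lra.
have t0 : 0 < `|t|.
  have : 0 < n%:R * `|t| by apply: lt_le_trans jt; rewrite exprn_gt0.
  by rewrite pmulr_rgt0.
have [m [m0 mc mt]] := exists_good_step t0 tpi.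
pose r := 2^-1 ^+ j : R; have r0 : 0 < r by rewrite exprn_gt0// invr_gt0.
have r1 : r <= 1 by rewrite exprn_ile1//; lra.
have m1 : 1 <= m%:R :> R by rewrite ler1n.
have mr : m%:R <= 6 * r * n%:R.
  have : m%:R * 2 ^+ j <= 6 * n%:R :> R.
    apply: (@le_trans _ _ (m%:R * (n%:R * `|t|))); first by rewrite ler_wpM2l.
    by nra.
  move=> /(ler_wpM2r (ltW r0)).
  have r2 : 2 ^+ j * r = 1 by rewrite /r -exprMn divff// expr1n.
  by rewrite -(mulrA m%:R) r2 mulr1; lra.
pose a k : R := psi (k%:~R / n%:R).
have aE k : `|k%:~R / n%:R| = `|k|%N%:R / n%:R :> R.
  by rewrite normrM normfV (ger0_norm (ltW np)) -intr_norm -pmulrn.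
(* Bound for psi within distance 2 m / n of the edge, given m / n <= 6 r. *)
pose M := C * (2 * (6 * r)) `^ al.
have M0 : 0 <= M by rewrite mulr_ge0 ?powR_ge0.
have edge k : (n <= `|k| + 2 * m)%N -> 0 <= a k <= M.
  move=> kn; rewrite wp /=.
  have [x1|x1] := leP 1 `|k%:~R / n%:R : R|; first by rewrite /a w0.
  apply: le_trans (wb _ (ltW x1)) _; rewrite ler_wpM2l//.
  apply: ge0_ler_powR; rewrite ?nnegrE ?subr_ge0 ?(ltW al0) ?(ltW x1)//.
    by rewrite !mulr_ge0// ltW.
  rewrite aE; have -> : 1 - `|k|%N%:R / n%:R = (n%:R - `|k|%N%:R) / n%:R :> R.
    by field; rewrite lt0r_neq0.
  rewrite ler_pdivrMr//; move: kn; rewrite -(ler_nat R) natrD natrM; lra.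
have a0 k : (n < `|k|)%N -> a k = 0.
  by move=> kn; apply: (@window_scaled _ 1 psi n k n0 wZ); rewrite mul1n.
have inner k : (`|k| + m <= n)%N -> second_diff m a k <= 0.
  move=> kn; have kn' : `|k|%N%:R + m%:R <= n%:R :> R by rewrite -natrD ler_nat.
  rewrite /second_diff /a intrD intrB subr_le0.
  rewrite (mulrDl (k%:~R : R)) (mulrBl n%:R^-1 (k%:~R : R)).
  have nm : `|m%:R / n%:R| = m%:R / n%:R :> R by rewrite ger0_norm// divr_ge0.
  apply: wc.
    apply: le_trans (ler_normD _ _) _.
    by rewrite aE nm -mulrDl ler_pdivrMr// mul1r.
  apply: le_trans (ler_normB _ _) _.
  by rewrite aE nm -mulrDl ler_pdivrMr// mul1r.
have total : isum (n + m) (second_diff m a) = 0.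
  rewrite isumD isumD isumN isumZ.
  rewrite (isum_addn m a0) (isum_subn m a0) (isum_widen (leq_addr m n) a0); ring.
pose c k := if (`|k| + m <= n)%N then 0 else 4 * M.
(* Near the edge the difference is at most 2 M, so its modulus exceeds its opposite by at most 4 M;
   after summation the opposites cancel by [total]. *)
have bnd k : `|second_diff m a k| <= - second_diff m a k + c k.
  rewrite /c; case: leqP => kn; first by rewrite addr0 ler0_norm// inner.
  have /andP[a1 a2] : 0 <= a (k + m%:Z) <= M by apply: edge; clear -kn; lia.
  have /andP[b1 b2] : 0 <= a (k - m%:Z) <= M by apply: edge; clear -kn; lia.
  have /andP[c1 c2] : 0 <= a k <= M by apply: edge; clear -kn; lia.
  by rewrite /second_diff ler_norml; apply/andP; split; lra.
have M4 : 0 <= 4 * M by rewrite mulr_ge0.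
(* If m <= n, exactly 4 m indices satisfy n - m < |k| <= n + m; otherwise the whole range has 2 (n +
   m) + 1 <= 4 m indices. *)
have count : isum (n + m) c <= 4 * M * (4 * m%:R).
  have [mn|nm] := leqP m n.
    pose c' k := if (`|k| + m <= n)%N then 4 * M else 0.
    have -> : isum (n + m) c = isum (n + m) (fun k => 4 * M + - c' k).
      by apply: eq_isum => k _; rewrite /c /c'; case: ifP => _; ring.
    rewrite isumD isumN isum_cst (@isum_widen _ (n - m) (n + m) c'); last 2 first.
    - by clear -mn; lia.
    - by move=> k kn; rewrite /c' ifN//; clear -kn mn; lia.
    rewrite (eq_isum (G := fun=> 4 * M)); last by move=> k kn; rewrite /c' ifT//; clear -kn mn; lia.
    rewrite isum_cst -mulrBr ler_wpM2l// -natrB; last by clear -mn; lia.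
    by rewrite -natrM ler_nat; clear -mn; lia.
  apply: (@le_trans _ _ (isum (n + m) (fun=> 4 * M))).
    by apply: ler_isum => k _; rewrite /c; case: ifP.
  by rewrite isum_cst ler_wpM2l// -natrM ler_nat; clear -nm m0; lia.
have key : modulus (wker psi n n t) * 2 <= 4 * M * (4 * m%:R).
  apply: (@le_trans _ _ (modulus (wker psi n n t) * (2 - 2 * cos (m%:R * t)))).
    by rewrite ler_wpM2l// modulus_ge0.
  have := tkernel_second_diff m t a0; move=> /le_trans; apply.
  apply: (@le_trans _ _ (isum (n + m) (fun k => - second_diff m a k + c k))).
    by apply: ler_isum => k _; exact: bnd.
  by rewrite isumD isumN total oppr0 add0r.
have Mle : M <= C * (12 * r `^ al).
  rewrite /M ler_wpM2l//; have -> : 2 * (6 * r) = 12 * r by ring.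
  rewrite powRM//; last exact: ltW.
  by rewrite ler_wpM2r ?powR_ge0// ler1_powR//; lra.
have qj : (2^-1 `^ al / 2) ^+ j = r `^ al * r.
  have h2 : 0 <= 2^-1 :> R by rewrite invr_ge0.
  by rewrite exprMn -(powR_mulrn j (powR_ge0 (2^-1 : R) al)) powRAC (powR_mulrn j h2).
rewrite qj.
have ra : 0 <= r `^ al by exact: powR_ge0.
have s1 : 4 * M * (4 * m%:R) <= 4 * (C * (12 * r `^ al)) * (4 * (6 * r * n%:R)).
  apply: ler_pM; [exact: M4|by rewrite mulr_ge0|by rewrite ler_wpM2l|by rewrite ler_wpM2l].
have := le_trans key s1.
have -> : 4 * (C * (12 * r `^ al)) * (4 * (6 * r * n%:R)) =
  8 * C1 * n%:R * (r `^ al * r) by rewrite /C1; ring.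
have : 0 <= C1 * n%:R * (r `^ al * r).
  exact: mulr_ge0 (mulr_ge0 C10 (ltW np)) (mulr_ge0 ra (ltW r0)).
by lra.
Qed.

(** The dyadic size of n|t| selects one box of radius 2^(j+1) / n that contains t and whose height
    dominates the kernel there. The number [n + 3] of boxes is generous: n|t| <= 4 n < 2^(n+2) on a
    period. *)
Lemma kdecay_majorant n C q (K : R -> R[i]) (w : R -> R) : (0 < n)%N -> 0 <= C -> 0 <= q ->
  kdecay n C q K -> lebesgue_measurable_fun (fun t => modulus (K (- t))) ->
  loc_integrable w -> (forall t, 0 <= w t) ->
  itv_integral (- pi) pi (fun t => w t * modulus (K (- t))) <=
  \sum_(j < n + 3) C * n%:R * (q / 2) ^+ j *
     itv_integral (- (2 ^+ j.+1 / n%:R)) (2 ^+ j.+1 / n%:R) w.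
Proof.
move=> n0 C0 q0 [Kb Kd] mK jw w0.
have np : 0 < n%:R :> R by rewrite ltr0n.
have q2 : 0 <= q / 2 by rewrite divr_ge0.
pose r j : R := 2 ^+ j.+1 / n%:R.
have r0 j : 0 < r j by rewrite divr_gt0// exprn_gt0.
pose c j : R := C * n%:R * (q / 2) ^+ j.
have c0 j : 0 <= c j by rewrite mulr_ge0 ?exprn_ge0// mulr_ge0// ltW.
pose B j t : R := \1_`[- r j, r j] t.
have BE j t : B j t = if `|t| <= r j then 1 else 0.
  by rewrite /B indicE mem_setE in_itv /= -ler_norml; case: ifP.
have B0 j t : 0 <= B j t by rewrite BE; case: ifP.
have mB j : lebesgue_measurable_fun (B j).
  by apply: borel_lebesgue_fun; apply: measurable_indic; exact: measurable_itv.
have jwB j : loc_integrable (fun t => w t * B j t).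
  apply: (loc_integrableM (k := 1)) => // t; rewrite BE; case: ifP => _; first by rewrite normr1.
  by rewrite normr0.
have dom t : - pi <= t <= pi -> modulus (K (- t)) <= \sum_(j < n + 3) c j * B j t.
  move=> tpi.
  have nt : `|- t| <= pi by rewrite normrN ler_norml.
  have one (j : nat) : (j < n + 3)%N -> `|t| <= r j -> modulus (K (- t)) <= c j ->
      modulus (K (- t)) <= \sum_(j < n + 3) c j * B j t.
    move=> jn tr Kc; rewrite (bigD1 (Ordinal jn))//= BE tr mulr1.
    apply: le_trans Kc _; rewrite lerDl sumr_ge0// => i _.
    exact: mulr_ge0.
  have [nt1|nt1] := ltP (n%:R * `|t|) 1.
    apply: (one 0%N); first by rewrite addn3.
      rewrite /r expr1 ler_pdivlMr// mulrC; lra.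
    by rewrite /c expr0 mulr1; exact: Kb.
  pose N := Num.truncn (n%:R * `|t|).
  have /andP[N1 N2] : N%:R <= n%:R * `|t| < N.+1%:R by apply: truncn_itv; lra.
  have Np : (0 < N)%N.
    by rewrite lt0n; apply/eqP => N0; move: N2; rewrite N0; lra.
  have /andP[l1 l2] := trunc_log_bounds (isT : (1 < 2)%N) Np.
  set j := trunc_log 2 N in l1 l2.
  have e1 : 2 ^+ j <= n%:R * `|t|.
    by apply: le_trans N1; rewrite -natrX ler_nat.
  have e2 : n%:R * `|t| <= 2 ^+ j.+1.
    by apply: le_trans (ltW N2) _; rewrite -natrX ler_nat.
  apply: (one j).
  - have : 2 ^+ j <= (4 * n)%:R :> R.
      apply: (le_trans e1); rewrite natrM mulrC ler_wpM2r//.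
      by rewrite -normrN (le_trans nt)// pi_le4.
    rewrite -natrX ler_nat => h.
    have h3 : (4 * n < 2 ^ (n + 2))%N.
      by rewrite expnD mulnC ltn_pmul2r//; exact: ltn_expl.
    have := leq_ltn_trans h h3; rewrite ltn_exp2l//; clear; lia.
  - by rewrite /r ler_pdivlMr// mulrC.
  - by apply: Kd => //; rewrite normrN.
have jS : loc_integrable (fun t => \sum_(j < n + 3) c j * (w t * B j t)).
  elim: (n + 3)%N => [|N ih].
    rewrite (_ : (fun t => _) = fun=> 0); first exact: loc_integrable_cst.
    by apply/funext => t; rewrite big_ord0.
  rewrite (_ : (fun t => _) = fun t => \sum_(j < N) c j * (w t * B j t) + c N * (w t * B N t)).
    by apply: loc_integrableD => //; exact: loc_integrableZ.
  by apply/funext => t; rewrite big_ord_recr.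
have IS : itv_integral (- pi) pi (fun t => \sum_(j < n + 3) c j * (w t * B j t)) =
    \sum_(j < n + 3) c j * itv_integral (- pi) pi (fun t => w t * B j t).
  elim: (n + 3)%N => [|N ih].
    rewrite big_ord0 (eq_itv_integral (g := fun=> 0)).
      rewrite itv_integral_cst ?mul0r//; have := pi_gt0 R; lra.
    by move=> t _; rewrite big_ord0.
  rewrite big_ord_recr /= -ih -itv_integralZ// -itv_integralD; last 2 first.
  - elim: N {ih} => [|N ih].
      rewrite (_ : (fun t => _) = fun=> 0); first exact: loc_integrable_cst.
      by apply/funext => t; rewrite big_ord0.
    rewrite (_ : (fun t => _) = fun t => \sum_(j < N) c j * (w t * B j t) + c N * (w t * B N t)).
      by apply: loc_integrableD => //; exact: loc_integrableZ.
    by apply/funext => t; rewrite big_ord_recr.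
  - exact: loc_integrableZ.
  by apply: eq_itv_integral => t _; rewrite big_ord_recr.
have jK : loc_integrable (fun t => w t * modulus (K (- t))).
  apply: (loc_integrableM (k := C * n%:R)) => // t.
  by rewrite ger0_norm ?modulus_ge0.
apply: (@le_trans _ _ (itv_integral (- pi) pi (fun t => \sum_(j < n + 3) c j * (w t * B j t)))).
  apply: itv_integral_le => // t tpi.
  apply: le_trans (ler_wpM2l (w0 t) (dom t tpi)) _.
  by rewrite mulr_sumr; apply: ler_sum => j _; rewrite mulrCA.
rewrite IS; apply: ler_sum => j _; rewrite ler_wpM2l//.
have pp := pi_gt0 R.
(* A box may be longer than the period, so both intervals are placed in a common larger one before
   the indicator is used. *)
apply: (@le_trans _ _ (itv_integral (- Num.max pi (r j)) (Num.max pi (r j)) (fun t => w t * B j t))).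
  apply: itv_integral_widen => //.
  - by move=> t; rewrite mulr_ge0.
  - by rewrite lerN2 le_max lexx.
  - lra.
  - by rewrite le_max lexx.
set b := Num.max pi (r j).
have rb : r j <= b by rewrite le_max lexx orbT.
rewrite le_eqVlt; apply/orP; left; apply/eqP.
rewrite /itv_integral -/(r j).
have -> : `[- r j, r j]%classic = `[- b, b] `&` `[- r j, r j].
  apply/seteqP; split => t /=; rewrite !in_itv /=; last by case.
  by move=> /andP[t1 t2]; split; [apply/andP; split; lra|rewrite t1].
rewrite Rintegral_mkcondr; apply: eq_Rintegral => t _.
rewrite patchE /B indicE; case: (t \in _); first by rewrite mulr1.
by rewrite mulr0.
Qed.
End KernelDecay.

(** * Multipliers on a Banach lattice *)

Section LatticeBasics.
Variables (R : realType) (X : banachLattice R).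
Implicit Types (f g : R -> R[i]) (c h s x : R) (L n Z : nat) (k : int).
Local Notation "`‖ f ‖" := (bl_norm X f) (format "`‖ f ‖").

Lemma ploc_torus_fun f : ploc f -> torus_fun f.
Proof. by move=> [[[mr _] [mi _]] pf]; split. Qed.

(** Taking the whole circle as [E] in [bl_indic] gives integrability over a period. *)
Lemma X_ploc f : X f -> ploc f.
Proof.
move=> Xf; have tf := bl_torus_fun Xf; split; last by case: tf.
apply: torus_fun_cloc => //.
have mT : lebesgue_measurable_set (@torus R) by apply: borel_lebesgue_set; exact: measurable_itv.
have [_ [c c0 /(_ f Xf) h]] := bl_indic X mT (@subset_refl _ _).
exact: le_lt_trans h (ltry _).
Qed.

Lemma X_one : X (fun=> 1).
Proof.
have mT : lebesgue_measurable_set (@torus R) by apply: borel_lebesgue_set; exact: measurable_itv.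
have [h _] := bl_indic X mT (@subset_refl _ _).
rewrite (_ : (fun=> 1) = torus_indic (@torus R))//.
apply/funext => x; rewrite /torus_indic indicE mem_set//=.
by have [m mx] := period_reduce x; exists m; rewrite /torus /= in_itv.
Qed.

Lemma X_cst (z : R[i]) : X (fun=> z).
Proof.
rewrite (_ : (fun=> z) = fun=> z * 1); first exact: (bl_scale z X_one).
by apply/funext => x; rewrite mulr1.
Qed.

Lemma X_add f g : X f -> X g -> X (fun x => f x + g x).
Proof. exact: bl_add. Qed.

Lemma X_sub f g : X f -> X g -> X (fun x => f x - g x).
Proof.
move=> Xf Xg; have := bl_add Xf (bl_scale (-1) Xg).
by rewrite (_ : f \+ _ = fun x => f x - g x)//; apply/funext => x /=; rewrite mulN1r.
Qed.

Lemma norm_ge0 f : X f -> 0 <= `‖f‖.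
Proof. exact: bl_norm_ge0. Qed.

Lemma norm_add f g : X f -> X g -> bl_norm X (fun x => f x + g x) <= `‖f‖ + `‖g‖.
Proof. exact: bl_normD. Qed.

Lemma norm_scale (z : R[i]) f : X f -> bl_norm X (fun x => z * f x) = modulus z * `‖f‖.
Proof. exact: bl_normZ. Qed.

Lemma norm_sub f g : X f -> X g -> bl_norm X (fun x => f x - g x) <= `‖f‖ + `‖g‖.
Proof.
move=> Xf Xg; have := norm_add Xf (bl_scale (-1) Xg).
rewrite norm_scale// modulusN modulus1 mul1r.
by rewrite (_ : (fun x => f x + _) = fun x => f x - g x)//; apply/funext => x; rewrite mulN1r.
Qed.

Lemma X_dom f g : torus_fun f -> X g -> (forall x, modulus (f x) <= modulus (g x)) ->
  X f /\ `‖f‖ <= `‖g‖.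
Proof. exact: bl_ideal. Qed.

Lemma X_bounded f K : torus_fun f -> (forall x, modulus (f x) <= K) -> X f.
Proof.
move=> tf fK; apply: (X_dom tf (X_cst K%:C) _).1 => x.
by rewrite modulus_real (le_trans (fK x))// ler_norm.
Qed.

Lemma torus_fun_abs f : torus_fun f -> torus_fun (fun x => (modulus (f x))%:C).
Proof.
move=> [pf mr mi]; split => [x||]; first by rewrite pf.
  exact: modulus_measurable.
exact: measurable_cst.
Qed.

Lemma X_abs f : X f -> X (fun x => (modulus (f x))%:C) /\
  bl_norm X (fun x => (modulus (f x))%:C) <= `‖f‖.
Proof.
move=> Xf; apply: X_dom => //; first by apply: torus_fun_abs; exact: bl_torus_fun Xf.
by move=> x; rewrite modulus_real ger0_norm ?modulus_ge0.
Qed.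

(** The ideal property compares two elements of [X], so the sum of the moduli is first shown to be
    one. *)
Lemma X_sum_dom g (N : nat) (U : nat -> R -> R[i]) : torus_fun g ->
  (forall j, (j < N)%N -> X (U j)) ->
  (forall x, modulus (g x) <= \sum_(j < N) modulus (U j x)) ->
  X g /\ `‖g‖ <= \sum_(j < N) `‖U j‖.
Proof.
move=> tg XU gU.
pose S (K : nat) x : R[i] := (\sum_(j < K) modulus (U j x))%:C.
have HS K : (K <= N)%N -> X (S K) /\ `‖S K‖ <= \sum_(j < K) `‖U j‖.
  elim: K => [_|K ih KN].
    have E : S 0%N = fun=> 0 * 1 by apply/funext => x; rewrite /S big_ord0 mul0r.
    rewrite big_ord0 E; split; first exact: (bl_scale 0 X_one).
    by rewrite norm_scale ?modulus0 ?mul0r//; exact: X_one.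
  have [X1 n1] := ih (ltnW KN); have [X2 n2] := X_abs (XU K KN).
  have E : S K.+1 = fun x => S K x + (modulus (U K x))%:C.
    by apply/funext => x; rewrite /S big_ord_recr CD.
  rewrite E big_ord_recr /=; split; first exact: X_add.
  by apply: le_trans (norm_add X1 X2) _; exact: lerD.
have [XS nS] := HS N (leqnn N).
have [Xg ng] : X g /\ `‖g‖ <= `‖S N‖.
  apply: X_dom => // x; apply: le_trans (gU x) _.
  by rewrite modulus_real ler_norm.
by split => //; exact: le_trans nS.
Qed.

Lemma X_sum_le g (N : nat) (U : nat -> R -> R[i]) (c : nat -> R) : torus_fun g ->
  (forall j, (j < N)%N -> X (U j)) -> (forall j, (j < N)%N -> `‖U j‖ <= c j) ->
  (forall x, modulus (g x) <= \sum_(j < N) modulus (U j x)) ->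
  X g /\ `‖g‖ <= \sum_(j < N) c j.
Proof.
move=> tg XU Uc gU; have [Xg ng] := X_sum_dom tg XU gU; split => //.
by apply: le_trans ng _; apply: ler_sum => j _; exact: Uc.
Qed.

Lemma X_tmul L m f : X (tmul L m f).
Proof.
apply: (@X_bounded _ (isum L (fun k => modulus (m k * fourier_coef f k)))).
  by apply: ploc_torus_fun; exact: ploc_tmul.
move=> x; apply: le_trans (modulus_isum _ _) _; apply: ler_isum => k _.
by rewrite modulusM modulus_cexpi mulr1.
Qed.

(** The Steklov average of |f|, as [steklov_abs] records; real-valued, so that majorants are
    compared pointwise. *)
Definition Av s f x : R := s^-1 * itv_integral (x - s / 2) (x + s / 2) (fun t => modulus (f t)).

Lemma steklov_abs s f x : steklov s (fun x => (modulus (f x))%:C) x = (Av s f x)%:C.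
Proof.
rewrite /steklov /Av CM; congr (_ * _).
apply: complex_eq; rewrite ?Re_citv ?Im_citv //=.
rewrite -/(itv_integral (x - s / 2) (x + s / 2) (fun=> 0)).
have [ab|ba] := leP (x - s / 2) (x + s / 2); first by rewrite itv_integral_cst// mul0r.
by rewrite /itv_integral set_itv_ge ?Rintegral_set0// bnd_simp -ltNge.
Qed.

Lemma Av_ge0 s f x : 0 < s -> 0 <= Av s f x.
Proof.
move=> s0; rewrite mulr_ge0 ?invr_ge0 ?(ltW s0)//.
by apply: itv_integral_ge0 => t _; exact: modulus_ge0.
Qed.

Lemma itv_integral_Av s f x a b : ploc f -> 0 < s -> x - s / 2 <= a -> a <= b ->
  b <= x + s / 2 -> itv_integral a b (fun t => modulus (f t)) <= s * Av s f x.
Proof.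
move=> [jf _] s0 xa ab bx; rewrite /Av mulrA divff ?lt0r_neq0// mul1r.
apply: itv_integral_widen => //; first exact: cloc_modulus.
by move=> t; exact: modulus_ge0.
Qed.

(** The window of length s at y lies in the window of length s' at x; the ratio corrects the
    normalization. *)
Lemma Av_shift s s' f x y : ploc f -> 0 < s -> `|x - y| <= (s' - s) / 2 ->
  Av s f y <= s' / s * Av s' f x.
Proof.
move=> pf s0 xy; have ss : s <= s' by have := normr_ge0 (x - y); lra.
rewrite {1}/Av -mulrA mulrCA ler_wpM2l ?invr_ge0 ?(ltW s0)//.
have := ler_norm (x - y); have := ler_norm (- (x - y)); rewrite normrN => h1 h2.
by apply: itv_integral_Av => //; lra.
Qed.

Lemma steklov_Av h f x : ploc f -> 0 < h -> modulus (steklov h f x) <= Av h f x.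
Proof.
move=> [jf _] h0; rewrite modulusM modulus_real ger0_norm ?invr_ge0 ?(ltW h0)//.
by rewrite ler_wpM2l ?invr_ge0 ?(ltW h0)//; exact: modulus_citv.
Qed.

Lemma geometric_sum_le (q : R) N : 0 <= q < 1 -> \sum_(j < N) q ^+ j <= (1 - q)^-1.
Proof.
move=> /andP[q0 q1]; have q1' : 0 < 1 - q by rewrite subr_gt0.
rewrite -(ler_pM2r q1') mulVf ?lt0r_neq0//.
have -> : (\sum_(j < N) q ^+ j) * (1 - q) = 1 - q ^+ N.
  by rewrite mulrC -[in RHS](expr1n _ N) subrXX; congr (_ * _); apply: eq_bigr => j _; rewrite expr1n mul1r.
by rewrite gerBl exprn_ge0.
Qed.

(** A box of radius 2^(j+1) / n is an average of length 2^(j+2) / n, whose normalization cancels the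
    factor n 2^-j of the kernel bound; C q^j remains, times 2 / pi <= 1. *)
Lemma tmul_majorant n L (C q : R) m f x : (0 < n)%N -> 0 <= C -> 0 <= q ->
  kdecay n C q (tkernel L m) -> ploc f ->
  modulus (tmul L m f x) <= \sum_(j < n + 3) C * q ^+ j * Av (2 ^+ j.+2 / n%:R) f x.
Proof.
move=> n0 C0 q0 kd pf; have np : 0 < n%:R :> R by rewrite ltr0n.
have jf := (ploc_shift x pf).1; have pp := pi_gt0 R; have p2 := pi_ge2 R.
rewrite tmul_conv// modulusM modulus_real ger0_norm; last by rewrite invr_ge0 mulr_ge0// ltW.
have jK : cloc (fun t => f (t + x) * tkernel L m (- t)).
  have -> : (fun t => f (t + x) * tkernel L m (- t)) =
      (fun t => isum L (fun k => m k * (f (t + x) * cexpi ((- k%:~R) * t)))).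
    apply/funext => t; rewrite /tkernel /isum mulr_sumr; apply: eq_bigr => k _.
    by rewrite mulrCA mulrN mulNr.
  by apply: cloc_sum => k _; apply: clocZ; exact: cloc_cexpi_mul.
have mK : lebesgue_measurable_fun (fun t => modulus (tkernel L m (- t))).
  have h : cloc (fun t => tkernel L m (- t)).
    have -> : (fun t => tkernel L m (- t)) =
        (fun t => isum L (fun k => m k * cexpi ((- k%:~R) * t))).
      by apply/funext => t; apply: eq_bigr => k _; rewrite mulrN mulNr.
    by apply: cloc_sum => k _; apply: clocZ; exact: cloc_cexpi.
  by case: (cloc_modulus h).
have jm := cloc_modulus jf.
apply: (@le_trans _ _ ((2 * pi)^-1 * itv_integral (- pi) pi (fun t => modulus (f (t + x)) * modulus (tkernel L m (- t))))).
  rewrite ler_wpM2l ?invr_ge0 ?mulr_ge0 ?(ltW pp)//.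
  apply: le_trans (modulus_citv _ _ jK) _; rewrite le_eqVlt; apply/orP; left; apply/eqP.
  by apply: eq_itv_integral => t _; rewrite modulusM.
apply: le_trans (ler_wpM2l _ (kdecay_majorant n0 C0 q0 kd mK jm (fun t => modulus_ge0 _))) _.
  by rewrite invr_ge0 mulr_ge0// ltW.
rewrite mulr_sumr; apply: ler_sum => j _.
have s0 : 0 < 2 ^+ j.+2 / n%:R :> R by rewrite divr_gt0// exprn_gt0.
have -> : itv_integral (- (2 ^+ j.+1 / n%:R)) (2 ^+ j.+1 / n%:R) (fun t => modulus (f (t + x))) =
    2 ^+ j.+2 / n%:R * Av (2 ^+ j.+2 / n%:R) f x.
  rewrite /Av mulrA divff ?lt0r_neq0// mul1r.
  rewrite (itv_integral_shift (f := fun t => modulus (f t)) _ _ x); last exact: cloc_modulus pf.1.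
  have -> : 2 ^+ j.+2 / n%:R / 2 = 2 ^+ j.+1 / n%:R :> R.
    by rewrite exprS; field; rewrite lt0r_neq0.
  by rewrite (addrC _ x) (addrC _ x).
have -> : (2 * pi)^-1 * (C * n%:R * (q / 2) ^+ j * (2 ^+ j.+2 / n%:R * Av (2 ^+ j.+2 / n%:R) f x)) =
    (C * q ^+ j * Av (2 ^+ j.+2 / n%:R) f x) * (2 / pi).
  move: (lt0r_neq0 pp); move: (pi : R) => P P0.
  rewrite expr_div_n !exprS; field.
  by rewrite P0 lt0r_neq0// lt0r_neq0// exprn_gt0.
rewrite -[leRHS]mulr1 ler_wpM2l//; first by rewrite (mulr_ge0 (mulr_ge0 C0 (exprn_ge0 _ q0)) (Av_ge0 _ _ s0)).
by rewrite ler_pdivrMr// mul1r.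
Qed.

Hypothesis HA : assumptionA X.

Lemma X_steklov h f : X f -> 0 < h -> X (steklov h f).
Proof. by case: HA => h1 _; exact: h1. Qed.

(** Assumption A speaks of the unit ball; homogeneity does the rest. *)
Lemma steklov_bounded : exists2 M, 1 <= M &
  forall f h, X f -> 0 < h -> bl_norm X (steklov h f) <= M * `‖f‖.
Proof.
case: HA => XA [M HM].
pose M' := `|M| + 1; have M1 : 1 <= M' by rewrite /M'; have := normr_ge0 M; lra.
exists M' => // f h Xf h0.
have nf := norm_ge0 Xf; have nA := norm_ge0 (XA _ _ Xf h0).
have jf := (X_ploc Xf).1.
have sc (r : R) : 0 < r -> r * `‖f‖ <= 1 -> r * bl_norm X (steklov h f) <= `|M|.
  move=> r0 r1; apply: le_trans (ler_norm M).
  have := HM _ h (bl_scale r%:C Xf) h0.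
  rewrite norm_scale// modulus_real gtr0_norm// => /(_ r1).
  have -> : steklov h (fun x => r%:C * f x) = fun x => r%:C * steklov h f x.
    by apply/funext => x; rewrite steklovZ.
  by rewrite norm_scale ?modulus_real ?gtr0_norm//; exact: XA.
(* If f has norm zero, all its multiples are in the unit ball, and a nonzero norm of the average
   could be scaled beyond |M|. *)
have [n0|n0] := eqVneq (`‖f‖) 0.
  rewrite n0 mulr0 leNgt; apply/negP => A0.
  have := sc (M' / bl_norm X (steklov h f)); rewrite n0 mulr0 ler01.
  rewrite divr_gt0//; last lra.
  by move=> /(_ isT isT); rewrite divfK ?lt0r_neq0// /M'; lra.
have np : 0 < `‖f‖ by rewrite lt0r n0.
have := sc (`‖f‖)^-1; rewrite invr_gt0 np mulVf// => /(_ isT (lexx _)).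
rewrite mulrC ler_pdivrMr// => h1; apply: le_trans h1 _.
by rewrite ler_wpM2r// lerDl.
Qed.

Lemma Av_bounded : exists2 M, 1 <= M & forall f s, X f -> 0 < s ->
  X (fun x => (Av s f x)%:C) /\ bl_norm X (fun x => (Av s f x)%:C) <= M * `‖f‖.
Proof.
have [M M1 HM] := steklov_bounded; exists M => // f s Xf s0.
have [Xa na] := X_abs Xf.
have -> : (fun x => (Av s f x)%:C) = steklov s (fun x => (modulus (f x))%:C).
  by apply/funext => x; rewrite steklov_abs.
split; first exact: X_steklov.
by apply: le_trans (HM _ _ Xa s0) _; rewrite ler_wpM2l//; lra.
Qed.

(** The ideal property combined with the uniform bound on averages: the sum of the coefficients
    matters, not the lengths or the number of the averages. *)
Lemma majorize_bounded : exists2 M, 1 <= M & forall f g (N : nat) (c s : nat -> R),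
  X f -> torus_fun g -> (forall j, 0 <= c j) -> (forall j, 0 < s j) ->
  (forall x, modulus (g x) <= \sum_(j < N) c j * Av (s j) f x) ->
  X g /\ `‖g‖ <= (\sum_(j < N) c j) * (M * `‖f‖).
Proof.
have [M M1 HM] := Av_bounded; exists M => // f g N c s Xf tg c0 s0 gc.
pose U j x : R[i] := (c j)%:C * (Av (s j) f x)%:C.
have XU j : X (U j) by apply: bl_scale; case: (HM f (s j) Xf (s0 j)).
have nU j : `‖U j‖ <= c j * (M * `‖f‖).
  have [h1 h2] := HM f (s j) Xf (s0 j).
  by rewrite norm_scale// modulus_real ger0_norm// ler_wpM2l.
rewrite mulr_suml; apply: (X_sum_le tg (fun j _ => XU j) (fun j _ => nU j)) => x.
apply: le_trans (gc x) _; apply: ler_sum => j _.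
by rewrite modulusM !modulus_real !ger0_norm// Av_ge0.
Qed.

(* BM: the Fourier multipliers [G (k / n)] are bounded on [X] uniformly in [n] *)
Definition BM (G : R -> R[i]) := exists Z C, [/\ window Z G, 0 <= C &
  forall n L f, (0 < n)%N -> (Z * n <= L)%N -> X f ->
    bl_norm X (tmul L (fun k => G (k%:~R / n%:R)) f) <= C * `‖f‖].

(** The coefficients C q^j of the majorant sum to at most C / (1 - q), independently of n. *)
Lemma kdecay_BM Z (G : R -> R) (C q : R) : 0 <= C -> 0 <= q < 1 -> window Z G ->
  (forall n L, (0 < n)%N -> (Z * n <= L)%N -> kdecay n C q (wker G n L)) ->
  BM (fun x => (G x)%:C).
Proof.
move=> C0 /andP[q0 q1] wG kd; have [M M1 HM] := majorize_bounded.
exists Z, (C * (1 - q)^-1 * M); split => [x xZ||n L f n0 ZL Xf].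
- by rewrite wG.
- by rewrite !mulr_ge0 ?invr_ge0 ?subr_ge0 ?(ltW q1)//; lra.
have pf := X_ploc Xf.
have := HM f (tmul L (fun k => (G (k%:~R / n%:R))%:C) f) (n + 3)%N
  (fun j => C * q ^+ j) (fun j => 2 ^+ j.+2 / n%:R) Xf.
move=> [||||_ h].
- by apply: ploc_torus_fun; exact: ploc_tmul.
- by move=> j; rewrite mulr_ge0 ?exprn_ge0.
- by move=> j; rewrite divr_gt0 ?exprn_gt0 ?ltr0n.
- by move=> x; apply: tmul_majorant => //; exact: kd.
apply: le_trans h _; rewrite -mulr_sumr -!mulrA ler_wpM2l//.
rewrite ler_wpM2r//; last by apply: geometric_sum_le; rewrite q0.
by rewrite mulr_ge0 ?norm_ge0//; lra.
Qed.

Lemma BM_smooth Z (G : R -> R) : cls setT G -> window Z G -> BM (fun x => (G x)%:C).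
Proof.
move=> cG wG; have [C C0 kd] := smooth_kdecay cG wG.
by apply: (@kdecay_BM Z G C 2^-1) => //; lra.
Qed.

Lemma BM_concave psi (al C : R) : 0 < al <= 1 -> concave_window psi al C ->
  BM (fun x => (psi x)%:C).
Proof.
move=> al01 cw; have [C' C0' kd] := concave_kdecay al01 cw.
apply: (@kdecay_BM 1 psi C' (2^-1 `^ al)) => //.
- rewrite powR_ge0 /=; case/andP: al01 => al0 _.
  have := gt0_ltr_powR al0 (x := 2^-1) (y := 1); rewrite powR1; apply; rewrite ?nnegrE; lra.
- by case: cw => w0 _ _ _ x x1; apply: w0; exact: ltW.
- by move=> n L n0; rewrite mul1n; exact: kd.
Qed.

Lemma BM_ext (G H : R -> R[i]) : G =1 H -> BM G -> BM H.
Proof. by move=> /funext ->. Qed.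

Lemma tmul_window_widen Z (G : R -> R[i]) n L L' f : (0 < n)%N -> window Z G ->
  (Z * n <= L)%N -> (Z * n <= L')%N ->
  tmul L (fun k => G (k%:~R / n%:R)) f = tmul L' (fun k => G (k%:~R / n%:R)) f.
Proof.
move=> n0 wG h h'; rewrite (@tmul_widen R (Z * n)) ?(@tmul_widen R (Z * n) L')// => k kZ;
  exact: window_scaled wG kZ.
Qed.

Lemma BMD (G H : R -> R[i]) : BM G -> BM H -> BM (fun x => G x + H x).
Proof.
move=> [Z [C [wG C0 hG]]] [Z' [C' [wH C0' hH]]].
exists (maxn Z Z'), (C + C'); split => [x|| n L f n0 ZL Xf].
- move=> xZ; rewrite wG ?wH ?addr0//; apply: le_lt_trans xZ; rewrite ler_nat.
    exact: leq_maxr.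
  exact: leq_maxl.
- exact: addr_ge0.
have h1 : (Z * n <= L)%N by apply: leq_trans ZL; rewrite leq_mul2r leq_maxl orbT.
have h2 : (Z' * n <= L)%N by apply: leq_trans ZL; rewrite leq_mul2r leq_maxr orbT.
rewrite (_ : tmul L _ f = fun x => tmul L (fun k => G (k%:~R / n%:R)) f x +
    tmul L (fun k => H (k%:~R / n%:R)) f x); last by apply/funext => x; rewrite tmulD.
apply: le_trans (norm_add (X_tmul _ _ _) (X_tmul _ _ _)) _.
by rewrite mulrDl lerD// ?hG// hH.
Qed.

Lemma BMZ (z : R[i]) (G : R -> R[i]) : BM G -> BM (fun x => z * G x).
Proof.
move=> [Z [C [wG C0 hG]]]; exists Z, (modulus z * C); split => [x xZ||n L f n0 ZL Xf].
- by rewrite wG// mulr0.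
- by rewrite mulr_ge0// modulus_ge0.
rewrite (_ : tmul L _ f = fun x => z * tmul L (fun k => G (k%:~R / n%:R)) f x); last first.
  by apply/funext => x; rewrite tmulZ.
by rewrite norm_scale; [rewrite -mulrA ler_wpM2l ?modulus_ge0// hG|exact: X_tmul].
Qed.

Lemma BMM (G H : R -> R[i]) : BM G -> BM H -> BM (fun x => G x * H x).
Proof.
move=> [Z [C [wG C0 hG]]] [Z' [C' [wH C0' hH]]].
exists Z, (C * C'); split => [x xZ||n L f n0 ZL Xf].
- by rewrite wG// mul0r.
- exact: mulr_ge0.
rewrite -(@tmulM R L (Z' * n) (fun k => G (k%:~R / n%:R)) (fun k => H (k%:~R / n%:R))).
  rewrite -mulrA; apply: le_trans (hG n L _ n0 ZL (X_tmul _ _ _)) _.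
  by rewrite ler_wpM2l// hH.
by move=> k kZ; exact: window_scaled wH kZ.
Qed.

End LatticeBasics.

(** * Sampling at the nodes *)

Section Step.
Variable R : realType.
Implicit Types (f g : R -> R[i]) (a : nat -> R[i]) (h s x y : R) (L n N : nat) (k : int).

Lemma eq_citv_co x y f g : cloc f -> cloc g -> x <= y ->
  (forall t, x <= t < y -> f t = g t) -> citv x y f = citv x y g.
Proof.
move=> [fr fi] [gr gi] xy fg.
have ext (F G : R -> R) : loc_integrable F -> loc_integrable G ->
    (forall t, x <= t < y -> F t = G t) -> itv_integral x y F = itv_integral x y G.
  move=> jF jG FG; rewrite !itv_integral_cc_co//.
  by apply: eq_Rintegral => t; rewrite inE /= in_itv /= => /FG.
by apply: complex_eq; rewrite ?Re_citv ?Im_citv; apply: ext => // t /fg ->.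
Qed.

Definition step n a x : R[i] :=
  \sum_(j < 2 * n + 1) a j * torus_indic `[node R n j, node R n j.+1[ x.

Lemma sample_step_step n f : sample_step n f = step n (fun j => (modulus (f (node R n j)))%:C).
Proof. by []. Qed.

Lemma odd_gt0 n : 0 < (2 * n + 1)%:R :> R. Proof. by rewrite ltr0n addn1. Qed.

Definition mesh n : R := 2 * pi / (2 * n + 1)%:R.

Lemma mesh_gt0 n : 0 < mesh n.
Proof. by rewrite divr_gt0 ?odd_gt0// mulr_gt0// pi_gt0. Qed.

Lemma nodeE n j : node R n j = mesh n * j%:R.
Proof. by rewrite /node /mesh mulrAC. Qed.

Lemma nodeS n j : node R n j.+1 = node R n j + mesh n.
Proof. by rewrite !nodeE -natr1 mulrDr mulr1. Qed.

Lemma node0 n : node R n 0 = 0. Proof. by rewrite nodeE mulr0. Qed.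

Lemma node_last n : node R n (2 * n + 1) = 2 * pi.
Proof. by rewrite nodeE /mesh divfK// lt0r_neq0// odd_gt0. Qed.

Lemma node_le n i j : (i <= j)%N -> node R n i <= node R n j.
Proof. by move=> ij; rewrite !nodeE ler_pM2l ?mesh_gt0// ler_nat. Qed.

Lemma node_cell n x : 0 <= x < 2 * pi ->
  exists2 j, (j < 2 * n + 1)%N & node R n j <= x < node R n j.+1.
Proof.
move=> /andP[x0 x2].
have: exists j, x < node R n j by exists (2 * n + 1)%N; rewrite node_last.
move=> /ex_minnP[[|j] xj jmin]; first by move: xj; rewrite node0; lra.
exists j; last by rewrite xj andbT leNgt; apply/negP => /jmin; rewrite ltnn.
by apply: jmin; rewrite node_last.
Qed.

Lemma cell_unique n x i j : node R n i <= x < node R n i.+1 ->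
  node R n j <= x < node R n j.+1 -> i = j.
Proof.
move=> /andP[i1 i2] /andP[j1 j2].
case: (ltngtP i j) => // ij; exfalso.
  by have := node_le n ij; lra.
by have := node_le n ij; lra.
Qed.

Lemma int_period_small (m : int) : `|m%:~R * (2 * pi) : R| < 2 * pi -> m = 0.
Proof.
have pp : 0 < 2 * pi :> R by rewrite mulr_gt0// pi_gt0.
rewrite normrM (gtr0_norm pp) -[ltRHS]mul1r (ltr_pM2r pp) -intr_norm -[1]/(1%:~R) ltr_int.
by lia.
Qed.

(** The cells partition a period, so a single summand survives. The pair [j], [m] does not depend on
    [a], which allows several step functions to be compared at x through the same cell. *)
Lemma step_pick n x : exists j (m : int), [/\ (j < 2 * n + 1)%N,
  node R n j <= x + m%:~R * (2 * pi) < node R n j.+1 &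
  forall a, step n a x = a j].
Proof.
have pp := pi_gt0 R.
(* Cells start at 0 whereas [period_reduce] lands in [-pi, pi), hence the shift by pi. *)
have [m0 m0P] := period_reduce (x - pi).
pose m := m0; have xm : 0 <= x + m%:~R * (2 * pi) < 2 * pi by rewrite /m; lra.
have [j jN jx] := node_cell n xm.
exists j, m; split => // a; rewrite /step (bigD1 (Ordinal jN))//= big1 ?addr0.
  rewrite /torus_indic indicE mem_set ?mulr1//=.
  by exists m; rewrite in_itv.
move=> i ij; rewrite /torus_indic indicE memNset ?mulr0//= => -[m' /=].
rewrite in_itv/= => im'; move: ij; rewrite -val_eqE/= => /eqP; apply.
suff E : m' = m by apply: (cell_unique im'); rewrite E.
have h0 := node_le n (leq0n i); have h1 := node_le n (ltn_ord i).
rewrite node0 in h0; rewrite node_last in h1.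
have im0 : 0 <= x + m'%:~R * (2 * pi) < 2 * pi by move: im'; lra.
apply/eqP; rewrite -subr_eq0; apply/eqP/int_period_small; rewrite intrB mulrBl ltr_norml.
by move: xm im0; clear; move=> /andP[? ?] /andP[? ?]; apply/andP; split; lra.
Qed.

Lemma torus_fun_indic x y : torus_fun (torus_indic `[x, y[ : R -> R[i]).
Proof.
pose E := [set t : R | exists m : int, `[x, y[%classic (t + m%:~R * (2 * pi))].
have mE : measurable E.
  have -> : E = \bigcup_(m in [set: int]) (fun t => t + m%:~R * (2 * pi)) @^-1` `[x, y[%classic.
    by apply/seteqP; split => [t [m mt]|t [m _ mt]]; exists m.
  apply: countable_bigcupT_measurable; first exact: countableP.
  move=> m; rewrite -[X in measurable X]setTI.
  by apply: (measurable_funD (@measurable_id _ _ _) (@measurable_cst _ _ _ _ _ _)).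
split.
- move=> t; rewrite /torus_indic !indicE; congr ((_ : bool)%:R).
  apply/idP/idP => /set_mem -[m mt]; apply/mem_set.
    by exists (m + 1); rewrite intrD mulrDl mul1r (addrC (_ * _)) addrA.
  exists (m - 1); rewrite intrB mulrBl mul1r.
  by rewrite (_ : t + 2 * pi + _ = t + m%:~R * (2 * pi))//; lra.
- rewrite (_ : (fun _ => _) = \1_E); first by apply: borel_lebesgue_fun; exact: measurable_indic.
  by apply/funext => t; rewrite /torus_indic !indicE; case: (t \in E).
- rewrite (_ : (fun _ => _) = fun=> 0); first exact: measurable_cst.
  by apply/funext => t; rewrite /torus_indic !indicE; case: (t \in E).
Qed.

Lemma torus_funZ (z : R[i]) f : torus_fun f -> torus_fun (fun x => z * f x).
Proof.
move=> [pf mr mi]; split => [x||]; first by rewrite pf.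
- rewrite (_ : (fun x => _) = fun x => complex.Re z * complex.Re (f x) -
    complex.Im z * complex.Im (f x)); last by apply/funext => x; rewrite ReM.
  by apply: measurable_funB; apply: measurable_funM => //; exact: measurable_cst.
- rewrite (_ : (fun x => _) = fun x => complex.Re z * complex.Im (f x) +
    complex.Im z * complex.Re (f x)); last by apply/funext => x; rewrite ImM.
  by apply: measurable_funD; apply: measurable_funM => //; exact: measurable_cst.
Qed.

Lemma torus_funD f g : torus_fun f -> torus_fun g -> torus_fun (fun x => f x + g x).
Proof.
move=> [pf mr mi] [pg nr ni]; split => [x||]; first by rewrite pf pg.
- rewrite (_ : (fun x => _) = fun x => complex.Re (f x) + complex.Re (g x)); last first.
    by apply/funext => x; rewrite ReD.
  exact: measurable_funD.
- rewrite (_ : (fun x => _) = fun x => complex.Im (f x) + complex.Im (g x)); last first.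
    by apply/funext => x; rewrite ImD.
  exact: measurable_funD.
Qed.

Lemma torus_fun_step n a : torus_fun (step n a).
Proof.
have h K : torus_fun (fun x => \sum_(j < K) a j * torus_indic `[node R n j, node R n j.+1[ x).
  elim: K => [|K ih].
    rewrite (_ : (fun x => _) = fun x => 0 * torus_indic `[0, 1[ x); last first.
      by apply/funext => x; rewrite big_ord0 mul0r.
    by apply: torus_funZ; exact: torus_fun_indic.
  rewrite (_ : (fun x => _) = fun x => \sum_(j < K) a j * torus_indic `[node R n j, node R n j.+1[ x
     + a K * torus_indic `[node R n K, node R n K.+1[ x); last first.
    by apply/funext => x; rewrite big_ord_recr.
  by apply: torus_funD => //; apply: torus_funZ; exact: torus_fun_indic.
exact: h.
Qed.

Lemma smult_sinc h k : 0 < h -> smult h k = (sinc (k%:~R * h / 2))%:C.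
Proof.
move=> h0; rewrite smultE// /sinc !mulf_eq0 intr_eq0 (gt_eqF h0) orbF.
by rewrite (_ : (2^-1 == 0 :> R) = false) ?orbF// gt_eqF.
Qed.

Lemma modulus_step n a x : modulus (step n a x) <= \sum_(j < 2 * n + 1) modulus (a j).
Proof.
apply: le_trans (modulus_sum _ _ _) _; apply: ler_sum => j _.
rewrite modulusM -[leRHS]mulr1 ler_wpM2l ?modulus_ge0// /torus_indic indicE.
by case: (_ \in _); rewrite ?modulus1 ?modulus0.
Qed.

Lemma cloc_step n a : cloc (step n a).
Proof.
have [_ mr mi] := torus_fun_step n a.
have := cloc_bounded_mul (cloc_cst 1) mr mi (modulus_step n a).
by congr cloc; apply/funext => x; rewrite mul1r.
Qed.

Definition dcoef n a k : R[i] :=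
  ((2 * n + 1)%:R^-1) * \sum_(j < 2 * n + 1) a j * cexpi (- (k%:~R * node R n j)).

(** On a cell, the integral of the exponential is a Steklov average at the midpoint; the offset by
    half a cell gives the phase. Both factors are divided out in [quasi_bounded]. *)
Lemma fourier_coef_step n a k : fourier_coef (step n a) k =
  cexpi (- (k%:~R * mesh n / 2)) * (sinc (k%:~R * mesh n / 2))%:C * dcoef n a k.
Proof.
have [pu _ _] := torus_fun_step n a; have ju := cloc_step n a.
have d0 := mesh_gt0 n; have pp := pi_gt0 R.
pose v x := step n a x * cexpi (- k%:~R * x).
have jv : cloc v by exact: cloc_cexpi_mul.
have pv x : v (x + 2 * pi) = v x by rewrite /v pu -intrN cexpi_periodic.
rewrite fourier_coefE// -(citv_periodic 0 jv pv) add0r -[X in citv 0 X](node_last n).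
have cat N : citv 0 (node R n N) v = \sum_(j < N) citv (node R n j) (node R n j.+1) v.
  elim: N => [|N ih].
    rewrite big_ord0 node0 (eq_citv_co jv (cloc_cst 0))//; last by move=> t h; exfalso; lra.
    by rewrite citv_cst// mul0r.
  rewrite big_ord_recr /= -ih -citv_cat//; first by have := node_le n (leq0n N); rewrite node0.
  exact: node_le.
rewrite cat /dcoef mulr_sumr [in RHS]mulrA mulr_sumr; apply: eq_bigr => j _.
have cell : citv (node R n j) (node R n j.+1) v =
    a j * (mesh n)%:C * steklov (mesh n) (fun x => cexpi ((- k)%:~R * x)) (node R n j + mesh n / 2).
  rewrite (@eq_citv_co _ _ v (fun x => a j * cexpi ((- k)%:~R * x)))//.
  - rewrite citvZ; last exact: cloc_cexpi.
    rewrite -[RHS]mulrA; congr (_ * _); rewrite /steklov mulrA -CM divff ?lt0r_neq0// mul1r addrK.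
    by rewrite (_ : node R n j + mesh n / 2 + mesh n / 2 = node R n j.+1)// nodeS; lra.
  - by apply: clocZ; exact: cloc_cexpi.
  - exact: node_le.
  move=> t tj; rewrite /v intrN; congr (_ * _).
  have [i [m [iN im ->]]] := step_pick n t.
  have h0 := node_le n (leq0n j); have h1 := node_le n (ltn_ord j).
  rewrite node0 in h0; rewrite node_last in h1.
  have h2 := node_le n (leq0n i); have h3 := node_le n iN.
  rewrite node0 in h2; rewrite node_last in h3.
  have m0 : m = 0.
    apply: int_period_small; rewrite ltr_norml.
    by move: tj im h0 h1 h2 h3; clear; move=> /andP[? ?] /andP[? ?] *; apply/andP; split; lra.
  by congr (a _); apply: (cell_unique im); rewrite m0 mul0r addr0.
rewrite cell steklov_cexpi smult_sinc// intrN.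
have -> : - k%:~R * (node R n j + mesh n / 2) =
    - (k%:~R * node R n j) + - (k%:~R * mesh n / 2) by lra.
rewrite cexpiD.
have -> : - k%:~R * mesh n / 2 = - (k%:~R * mesh n / 2) by rewrite !mulNr.
have sincN x : sinc (- x) = sinc x.
  by rewrite /sinc oppr_eq0 sinN invrN mulrNN.
rewrite sincN.
have -> : (2 * n + 1)%:R^-1 = ((2 * pi)^-1)%:C * (mesh n)%:C :> R[i].
  by rewrite -CM /mesh mulrA mulVf ?two_pi_neq0// mul1r CV Cnat.
ring.
Qed.

Lemma kernel_polyE psi n x : kernel_poly psi n x =
  tkernel n (fun k => (psi (k%:~R / n%:R))%:C) x.
Proof.
apply: eq_bigr => j _.
by rewrite (_ : ((j : nat)%:Z - n%:Z)%:~R = j%:R - n%:R :> R)// intrB.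
Qed.

Lemma quasi_interpE psi n f x : quasi_interp psi n f x =
  isum n (fun k => (psi (k%:~R / n%:R))%:C * dcoef n (fun j => f (node R n j)) k * cexpi (k%:~R * x)).
Proof.
rewrite /quasi_interp /dcoef.
transitivity (isum n (fun k => ((2 * n + 1)%:R)^-1 *
   \sum_(j < 2 * n + 1) f (node R n j) * ((psi (k%:~R / n%:R))%:C * cexpi (k%:~R * (x - node R n j))))).
  rewrite isumZ; congr (_ * _); rewrite /isum exchange_big; apply: eq_bigr => j _ /=.
  by rewrite kernel_polyE /tkernel /isum mulr_sumr.
apply: eq_isum => k _; rewrite mulrCA -mulrA; congr (_ * _).
rewrite -?mulrA ?mulr_suml ?mulr_sumr; apply: eq_bigr => j _.
by rewrite mulrBr cexpiD; ring.
Qed.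

Lemma quasi_interp_funB psi n f g x :
  quasi_interp psi n (fun x => f x - g x) x = quasi_interp psi n f x - quasi_interp psi n g x.
Proof.
by rewrite /quasi_interp -mulrBr -sumrB; congr (_ * _); apply: eq_bigr => j _; rewrite mulrBl.
Qed.

(** Geometric sum of a root of unity w; w = 1 would force sin(pi k / (2 n + 1)) = 0, impossible for
    0 < |k| < 2 n + 1. *)
Lemma node_sum n k : (`|k| < 2 * n + 1)%N ->
  \sum_(j < 2 * n + 1) cexpi (k%:~R * node R n j) = (if k == 0 then (2 * n + 1)%:R else 0 : R[i]).
Proof.
move=> kN; pose w : R[i] := cexpi (k%:~R * mesh n).
have wE j : cexpi (k%:~R * node R n j) = w ^+ j.
  rewrite nodeE mulrA; elim: j => [|j ih]; first by rewrite mulr0 cexpi0.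
  by rewrite exprSr -ih -natr1 mulrDr mulr1 cexpiD.
have -> : \sum_(j < 2 * n + 1) cexpi (k%:~R * node R n j) = \sum_(j < 2 * n + 1) w ^+ j.
  by apply: eq_bigr => j _; rewrite wE.
have wN : w ^+ (2 * n + 1) = 1 by rewrite -wE node_last cexpi_int2pi.
have [k0|k0] := eqVneq k 0.
  have -> : w = 1 by rewrite /w k0 mul0r cexpi0.
  by under eq_bigr do rewrite expr1n; rewrite sumr_const card_ord.
have w1 : w != 1.
  apply/eqP => /(congr1 (@complex.Re R)) /= c1.
  have /andP[_ _] := cos_quadratic (k%:~R * mesh n).
  have := coscE (k%:~R * mesh n); rewrite c1 subrr => /esym /eqP.
  rewrite mulf_eq0 expf_eq0 /= mulf_eq0 intr_eq0 (negbTE k0) (gt_eqF (mesh_gt0 n)) /=.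
  rewrite /cosc /sinc mulf_eq0 invr_eq0 pnatr_eq0 orbF expf_eq0 /=.
  have kd : k%:~R * mesh n / 2 = pi * (k%:~R / (2 * n + 1)%:R) :> R.
    by rewrite /mesh; field; rewrite lt0r_neq0// odd_gt0.
  have nz : k%:~R * mesh n / 2 != 0.
    by rewrite (mulf_neq0 (mulf_neq0 _ (lt0r_neq0 (mesh_gt0 n))) _) ?intr_eq0// invr_eq0 pnatr_eq0.
  rewrite (negbTE nz) mulf_eq0 invr_eq0 (negbTE nz) orbF kd.
  have pos (q : R) : 0 < q < 1 -> sin (pi * q) != 0.
    move=> /andP[q0 q1]; apply: lt0r_neq0; apply: sin_gt0_pi; rewrite mulr_gt0 ?pi_gt0//=.
    by rewrite -[ltRHS]mulr1 ltr_pM2l ?pi_gt0.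
  have Np := odd_gt0 n.
  case: k k0 kN {w wE wN c1 kd nz} => [k|k] k0 kN.
    apply/negP; apply: pos; rewrite (divr_gt0 _ Np) ?ltr0n ?lt0n//=.
    by rewrite ltr_pdivrMr// mul1r ltr_nat; exact: kN.
  rewrite NegzE intrN !mulNr mulrN sinN oppr_eq0; apply/negP; apply: pos.
  rewrite (divr_gt0 _ Np) ?ltr0n//=.
  by rewrite ltr_pdivrMr// mul1r ltr_nat; exact: kN.
have := subrX1 w (2 * n + 1); rewrite wN subrr => /esym /eqP.
by rewrite mulf_eq0 subr_eq0 (negbTE w1) /= => /eqP.
Qed.

(** No aliasing: two frequencies of modulus at most n differ by at most 2 n, less than the number of
    nodes. *)
Lemma dcoef_isum n (c : int -> R[i]) k : (`|k| <= n)%N ->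
  dcoef n (fun j => isum n (fun l => c l * cexpi (l%:~R * node R n j))) k = c k.
Proof.
move=> kn; rewrite /dcoef.
under eq_bigr => j _ do rewrite mulr_suml.
rewrite exchange_big /=.
rewrite (_ : \sum_(_ < _) _ = isum n (fun l => if l == k then c k * (2 * n + 1)%:R else 0)).
  rewrite (isum_delta n (fun=> c k * (2 * n + 1)%:R)) kn mulrC mulfK//.
transitivity (isum n (fun l => \sum_(j < 2 * n + 1)
    c l * cexpi (l%:~R * node R n j) * cexpi (- (k%:~R * node R n j)))) => //.
apply: eq_isum => l ln.
rewrite (eq_bigr (fun j : 'I_(2 * n + 1) => c l * cexpi ((l - k)%:~R * node R n j))); last first.
  by move=> j _; rewrite -mulrA -cexpiD intrB mulrBl.
rewrite -mulr_sumr node_sum; last lia.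
by rewrite subr_eq0; case: eqP => [->//|_]; rewrite mulr0.
Qed.

Lemma quasi_interp_tmul psi n m f x : quasi_interp psi n (tmul n m f) x =
  tmul n (fun k => (psi (k%:~R / n%:R))%:C * m k) f x.
Proof.
rewrite quasi_interpE; apply: eq_isum => k kn.
by rewrite (dcoef_isum (fun k => m k * fourier_coef f k))// !mulrA.
Qed.

End Step.

(** * Inverting the symbol of the passage from samples to cells *)

Section Quotients.
Variable R : realType.
Implicit Types (x y Z : R) (A B : R -> R).

Lemma sinc_gt0 y : `|y| < pi -> 0 < sinc y.
Proof.
have pos z : 0 < z -> z < pi -> 0 < sin z / z.
  by move=> z0 zp; rewrite divr_gt0// sin_gt0_pi// z0.
move=> yp; rewrite /sinc; case: ifPn => [_|y0]; first exact: ltr01.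
have [y1|y1] := ltP 0 y; first by apply: pos => //; apply: le_lt_trans yp; exact: ler_norm.
have y2 : y < 0 by rewrite lt_neqAle y0.
by rewrite -mulrNN -sinN -invrN pos ?oppr_gt0// -ltr0_norm.
Qed.

Lemma cls_quot A B Z : 0 <= Z -> cls setT A -> (forall x, Z <= `|x| -> A x = 0) ->
  cls setT B -> (forall x, `|x| <= Z + 1 -> 0 < B x) -> cls setT (fun x => A x / B x).
Proof.
move=> Z0 cA A0 cB B0; apply: (@cls_cutoff_mul _ A _ Z (Z + 1)) => //; first by lra.
have Z1 : 0 <= Z + 1 by lra.
have [c c0 cB'] := cls_lower_bound Z1 cB B0.
by apply: (cls_inv c0) => //; exact: cls_sub cB.
Qed.

(** 1 / sinc(pi x) for |x| <= 1/2, continued to 0 within the class. The second square keeps the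
    denominator positive: sinc(pi x) can vanish only for |x| >= 1, where the cutoff is 0. *)
Definition dual_cutoff x : R :=
  chi (2 * x) * sinc (pi * x) / (sinc (pi * x) ^+ 2 + (1 - chi (2 * x)) ^+ 2).

Lemma dual_cutoff_eq0 x : 1 <= `|x| -> dual_cutoff x = 0.
Proof. by move=> x1; rewrite /dual_cutoff chi0 ?mul0r// normrM gtr0_norm//; lra. Qed.

Lemma dual_cutoffE x : `|x| <= 2^-1 -> dual_cutoff x = (sinc (pi * x))^-1.
Proof.
move=> x1; have pp := pi_gt0 R.
have s0 : 0 < sinc (pi * x).
  by apply: sinc_gt0; rewrite normrM gtr0_norm// -[ltRHS]mulr1 ltr_pM2l//; lra.
rewrite /dual_cutoff chi1; last by rewrite normrM gtr0_norm//; lra.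
by rewrite subrr expr0n/= addr0 mul1r expr2 invfM mulVKf// lt0r_neq0.
Qed.

Lemma cls_dual_cutoff : cls setT dual_cutoff.
Proof.
have c1 := cls_chi_lin (2 : R); have c2 := cls_setT_lin pi (@cls_sinc R).
have pp := pi_gt0 R.
apply: (@cls_quot _ (fun x => sinc (pi * x) ^+ 2 + (1 - chi (2 * x)) ^+ 2) 1).
- exact: ler01.
- exact: clsM.
- by move=> x x1; rewrite chi0 ?mul0r// normrM gtr0_norm//; lra.
- have c3 := clsB (cls_cst setT 1) c1.
  apply: (@eq_cls _ _ (fun x => sinc (pi * x) * sinc (pi * x) +
      (1 - chi (2 * x)) * (1 - chi (2 * x)))); first by move=> x _; rewrite -!expr2.
  by apply: clsD; exact: clsM.
move=> x _; have [x1|x1] := leP 1 `|x|.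
  by rewrite chi0 ?subr0 ?expr1n ?ltr_wpDl ?sqr_ge0// normrM gtr0_norm//; lra.
rewrite ltr_pwDl ?sqr_ge0// exprn_gt0// sinc_gt0// normrM gtr0_norm//.
by rewrite -[ltRHS]mulr1 ltr_pM2l.
Qed.

End Quotients.

(** * The discrete semi-norm of averages and of polynomials *)

Section Discrete.
Variables (R : realType) (X : banachLattice R).
Implicit Types (f g : R -> R[i]) (c h s x : R) (L n Z : nat) (k : int).
Local Notation "`‖ f ‖" := (bl_norm X f) (format "`‖ f ‖").

Lemma X_step n a : X (step n a).
Proof. by apply: X_bounded (modulus_step n a); exact: torus_fun_step. Qed.

Lemma X_sample n f : X (sample_step n f).
Proof. by rewrite sample_step_step; exact: X_step. Qed.

Lemma discrete_ge0 n f : 0 <= discrete_norm X n f.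
Proof. by apply: norm_ge0; exact: X_sample. Qed.

Lemma norm_step n f : bl_norm X (step n (fun j => f (node R n j))) <= discrete_norm X n f.
Proof.
apply: (X_dom (torus_fun_step _ _) (X_sample n f) _).2 => x.
have [j [m [_ _ E]]] := step_pick n x.
by rewrite sample_step_step !E modulus_real ger0_norm// modulus_ge0.
Qed.

Lemma discrete_add n f g :
  discrete_norm X n (fun x => f x + g x) <= discrete_norm X n f + discrete_norm X n g.
Proof.
apply: le_trans (norm_add (X_sample n f) (X_sample n g)).
apply: (X_dom _ (X_add (X_sample n f) (X_sample n g)) _).2.
  exact: bl_torus_fun (X_sample _ _).
move=> x; have [j [m [_ _ E]]] := step_pick n x.
rewrite !sample_step_step !E -CD !modulus_real !ger0_norm ?addr_ge0 ?modulus_ge0//.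
exact: modulusD.
Qed.

Lemma discrete_opp n f : discrete_norm X n (fun x => - f x) = discrete_norm X n f.
Proof.
congr bl_norm; apply/funext => x.
by apply: eq_bigr => j _; rewrite modulusN.
Qed.

Lemma discrete_sub n f g :
  discrete_norm X n (fun x => f x - g x) <= discrete_norm X n f + discrete_norm X n g.
Proof. by rewrite -(discrete_opp n g); exact: discrete_add. Qed.

Lemma Av_periodic s f x (m : int) : ploc f -> Av s f (x + m%:~R * (2 * pi)) = Av s f x.
Proof.
move=> [jf pf]; rewrite /Av; congr (_ * _).
have -> : x + m%:~R * (2 * pi) - s / 2 = x - s / 2 + m%:~R * (2 * pi) by lra.
have -> : x + m%:~R * (2 * pi) + s / 2 = x + s / 2 + m%:~R * (2 * pi) by lra.
rewrite -itv_integral_shift; last exact: cloc_modulus.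
by apply: eq_itv_integral => t _; rewrite (periodic_int pf).
Qed.

Hypothesis HA : assumptionA X.

Lemma mesh_le n : (0 < n)%N -> mesh R n <= pi / n%:R.
Proof.
move=> n0; have pp := pi_gt0 R.
have np : 0 < n%:R :> R by rewrite ltr0n.
rewrite /mesh ler_pdivrMr ?odd_gt0// mulrAC ler_pdivlMr// natrD natrM.
have -> : 2 * pi * n%:R = pi * (2 * n%:R) :> R by rewrite mulrAC mulrC mulrCA mulrA.
by rewrite ler_pM2l// lerDl.
Qed.

(* The averages over cells adjacent to a point are dominated by slightly longer
   averages at the point, so that averages do not see the discretization. *)
Lemma discrete_majorant : exists2 M, 1 <= M & forall (s0 : R) n f g (N : nat) (c s : nat -> R),
  (0 < n)%N -> 0 < s0 -> X f -> (forall j, 0 <= c j) -> (forall j, s0 / n%:R <= s j) ->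
  (forall k : nat, modulus (g (node R n k)) <= \sum_(j < N) c j * Av (s j) f (node R n k)) ->
  discrete_norm X n g <= (\sum_(j < N) c j) * (1 + 2 * pi / s0) * (M * `‖f‖).
Proof.
have [M M1 HM] := majorize_bounded HA; exists M => // s0 n f g N c s n0 s00 Xf c0 ss gc.
have pp := pi_gt0 R; have np : 0 < n%:R :> R by rewrite ltr0n.
have sp j : 0 < s j by apply: lt_le_trans (ss j); rewrite divr_gt0.
have pf := X_ploc Xf.
pose b := 1 + 2 * pi / s0.
have b0 : 0 <= b by rewrite /b addr_ge0// divr_ge0// ?mulr_ge0// ltW.
have := HM f (sample_step n g) N (fun j => c j * b) (fun j => s j + 2 * pi / n%:R) Xf.
move=> [||||_].
- exact: bl_torus_fun (X_sample _ _).
- by move=> j; exact: mulr_ge0.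
- by move=> j; rewrite addr_gt0// divr_gt0// mulr_gt0.
- move=> x; have [j [m [_ jx E]]] := step_pick n x.
  rewrite sample_step_step E modulus_real ger0_norm ?modulus_ge0//.
  apply: le_trans (gc j) _; apply: ler_sum => i _; rewrite -mulrA ler_wpM2l//.
  rewrite -[Av (s i + _) f x](Av_periodic _ _ m)//.
  apply: le_trans (Av_shift (s' := s i + 2 * pi / n%:R) (x := x + m%:~R * (2 * pi)) pf (sp i) _) _.
    have := mesh_le n0; move: jx; rewrite nodeS => /andP[j1 j2] ml.
    by rewrite ger0_norm; lra.
  rewrite ler_wpM2r ?Av_ge0 ?addr_gt0 ?divr_gt0 ?mulr_gt0//.
  rewrite mulrDl divff ?lt0r_neq0// lerD2l -!mulrA ler_pM2l// ler_pM2l//.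
  rewrite -invfM lef_pV2 ?posrE// ?mulr_gt0//.
  by have := ss i; rewrite ler_pdivrMr// mulrC.
by rewrite -mulr_suml.
Qed.

(** The case of a single average in [discrete_majorant], with windows of length exactly a / n. *)
Lemma discrete_steklov a : 0 < a -> exists2 C, 0 <= C & forall n f, (0 < n)%N -> X f ->
  discrete_norm X n (steklov (a / n%:R) f) <= C * `‖f‖.
Proof.
move=> a0; have [M M1 HM] := discrete_majorant.
exists ((1 + 2 * pi / a) * M) => [|n f n0 Xf].
  by rewrite mulr_ge0 ?addr_ge0 ?divr_ge0 ?mulr_ge0 ?pi_ge0 ?(ltW a0)//; lra.
have np : 0 < n%:R :> R by rewrite ltr0n.
have := HM a n f (steklov (a / n%:R) f) 1%N (fun=> 1) (fun=> a / n%:R) n0 a0 Xf.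
rewrite big_ord1 mul1r mulrA; apply => // k.
by rewrite big_ord1 mul1r steklov_Av ?divr_gt0//; exact: X_ploc Xf.
Qed.

Lemma lowpass_trig n m f : (0 < n)%N ->
  tmul (2 * n) (fun k => (chi (k%:~R / n%:R : R))%:C) (tmul n m f) = tmul n m f.
Proof.
move=> n0; have np : 0 < n%:R :> R by rewrite ltr0n.
rewrite [LHS](_ : _ = tmul (2 * n) (fun k => if (`|k| <= n)%N then m k else 0) f); last first.
  apply: eq_tmul => k _; rewrite fourier_coef_tmul; case: leqP => kn; last by rewrite mulr0 mul0r.
  rewrite chi1 ?mul1r// normrM normfV (gtr0_norm np) ler_pdivrMr// mul1r -intr_norm.
  by rewrite -[n%:R]/((n%:Z)%:~R) ler_int; lia.
rewrite (@tmul_widen _ n); last by move=> k kn; rewrite leqNgt kn.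
  by apply: eq_tmul => k ->.
by rewrite leq_pmull.
Qed.

(** A polynomial of degree at most n is reproduced by a smooth low-pass filter, hence dominated
    pointwise by averages of itself of lengths at least 4 / n, and [discrete_majorant] applies: an
    inequality of Marcinkiewicz-Zygmund type. *)
Lemma discrete_tmul : exists2 C, 0 <= C & forall n m f, (0 < n)%N ->
  discrete_norm X n (tmul n m f) <= C * bl_norm X (tmul n m f).
Proof.
have [M M1 HM] := discrete_majorant.
have wchi : window 2 (@chi R) by move=> x x2; rewrite chi0// ltW.
have [C C0 kd] := smooth_kdecay (@cls_chi R) wchi.
exists (C * 2 * (1 + 2 * pi / 4) * M) => [|n m f n0].
  by rewrite !mulr_ge0 ?addr_ge0 ?divr_ge0 ?mulr_ge0 ?pi_ge0//; lra.
set T := tmul n m f; have XT : X T by exact: X_tmul.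
have TE : T = tmul (2 * n) (fun k => (chi (k%:~R / n%:R : R))%:C) T := esym (lowpass_trig m f n0).
apply: le_trans (HM 4 n T T (n + 3)%N (fun j => C * 2^-1 ^+ j) (fun j => 2 ^+ j.+2 / n%:R)
  n0 _ XT _ _ _) _.
- by [].
- by move=> j; rewrite mulr_ge0 ?exprn_ge0.
- move=> j; rewrite ler_wpM2r ?invr_ge0// !exprS mulrA.
  have : 1 <= 2 ^+ j :> R by apply: exprn_ege1; lra.
  lra.
- move=> k; rewrite {1}TE; apply: tmul_majorant => //; last exact: X_ploc XT.
  by apply: kd.
rewrite mulrA ler_wpM2r ?norm_ge0// ler_wpM2r//; first lra.
rewrite ler_wpM2r ?addr_ge0 ?divr_ge0 ?mulr_ge0 ?pi_ge0// -mulr_sumr ler_wpM2l//.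
have := @geometric_sum_le R 2^-1 (n + 3).
by rewrite (_ : (1 - 2^-1)^-1 = 2 :> R); [apply; lra|field].
Qed.

Lemma BM_cplx_smooth Z (A B : R -> R) : cls setT A -> cls setT B -> window Z A -> window Z B ->
  BM X (fun x => (A x)%:C + 'i * (B x)%:C).
Proof.
move=> cA cB wA wB; have hA := BM_smooth HA cA wA; have hB := BM_smooth HA cB wB.
by apply: (BMD hA); exact: BMZ.
Qed.

(** Two multipliers lead from the step function [u] of the samples to Q_n f. One, at scale N = 2 n +
    1, has symbol exp(i pi x) / sinc(pi x) for |x| <= 1/2 and recovers the discrete Fourier
    coefficients; the other, at scale n, applies psi. *)
Lemma quasi_bounded (psi : R -> R) : BM X (fun x => (psi x)%:C) -> window 1 psi ->
  exists2 C, 0 <= C & forall n f, (0 < n)%N ->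
    bl_norm X (quasi_interp psi n f) <= C * discrete_norm X n f.
Proof.
move=> [Z [C [wZ C0 HC]]] w1.
pose G x := (dual_cutoff x * cos (pi * x))%:C + 'i * (dual_cutoff x * sin (pi * x))%:C.
have wd (F : R -> R) : window 1 (fun x => dual_cutoff x * F x).
  by move=> x x1; rewrite dual_cutoff_eq0 ?mul0r// ltW.
have [Z' [C' [wZ' C0' HC']]] : BM X G.
  apply: (@BM_cplx_smooth 1); rewrite ?wd//.
    by apply: (clsM (@cls_dual_cutoff R)); exact: cls_setT_lin (@cls_cos R).
  by apply: (clsM (@cls_dual_cutoff R)); exact: cls_setT_lin (@cls_sin R).
exists (C * C') => [|n f n0]; first exact: mulr_ge0.
have GE x : G x = (dual_cutoff x)%:C * cexpi (pi * x).
  by rewrite /G !CM mulrCA -mulrDr; congr (_ * _); apply: complex_eq; rewrite /= ; ring.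
pose N := (2 * n + 1)%N; have N0 : (0 < N)%N by rewrite /N addn1.
set u := step n (fun j => f (node R n j)).
have Xu : X u by exact: X_step.
have -> : quasi_interp psi n f = tmul (Z * n + n) (fun k => (psi (k%:~R / n%:R))%:C)
    (tmul (Z' * N + n) (fun k => G (k%:~R / N%:R)) u).
  rewrite (@tmul_widen _ n) ?leq_addl//; last first.
    by move=> k kn; rewrite (window_scaled n0 w1)// mul1n.
  apply/funext => x; rewrite quasi_interpE; apply: eq_isum => k kn; congr (_ * _ * _).
  rewrite fourier_coef_tmul (leq_trans kn) ?leq_addl// fourier_coef_step GE.
  have -> : k%:~R * mesh R n / 2 = pi * (k%:~R / N%:R).
    by rewrite /mesh -/N; field; rewrite lt0r_neq0// ltr0n.
  have Np : 0 < N%:R :> R by rewrite ltr0n.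
  have kN : `|k%:~R / N%:R| <= 2^-1 :> R.
    rewrite normrM normfV (gtr0_norm Np) ler_pdivrMr// -intr_norm.
    rewrite -(ler_pM2l (ltr0Sn _ 1)) mulrA mulfV ?pnatr_eq0// mul1r.
    by rewrite -[2]/(2%:~R) -intrM -[N%:R]/((N%:Z)%:~R) ler_int /N; lia.
  rewrite dual_cutoffE// cexpiN.
  set S := sinc _; have S0 : S%:C != 0 :> R[i].
    apply/eqP => /(congr1 (@complex.Re R)) /= /eqP; rewrite gt_eqF// sinc_gt0//.
    by rewrite normrM gtr0_norm ?pi_gt0// -[ltRHS]mulr1 ltr_pM2l ?pi_gt0//; lra.
  have E0 := cexpi_neq0 (pi * (k%:~R / N%:R) : R).
  by rewrite CV; field; rewrite S0 E0.
apply: le_trans (HC n _ _ n0 _ (X_tmul _ _ _ _)) _; first exact: leq_addr.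
rewrite -mulrA ler_wpM2l//; apply: le_trans (HC' N _ _ N0 _ Xu) _; first exact: leq_addr.
by rewrite ler_wpM2l// norm_step.
Qed.

End Discrete.

(** * Multipliers of the Steklov averages *)

Section LocallySmooth.
Variable R : realType.
Implicit Types (f g : R -> R) (x c z Z : R).

(** Enough for symbols that will be multiplied by a cutoff, such as x itself or 1 / [den], and
    stable under products without any growth condition. *)
Definition lcls f := forall Z, cls [set x | `|x| <= Z] f.

Lemma lclsT f : cls setT f -> lcls f.
Proof. by move=> cf Z; exact: cls_sub cf. Qed.

Lemma lclsD f g : lcls f -> lcls g -> lcls (fun x => f x + g x).
Proof. by move=> cf cg Z; exact: clsD. Qed.

Lemma lclsM f g : lcls f -> lcls g -> lcls (fun x => f x * g x).
Proof. by move=> cf cg Z; exact: clsM. Qed.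

Lemma lclsZ f c : lcls f -> lcls (fun x => c * f x).
Proof. by move=> cf Z; exact: clsZ. Qed.

Lemma lcls_id : lcls (fun x => x).
Proof. by move=> Z; exact: cls_id. Qed.

Lemma lcls_lin f c : lcls f -> lcls (fun x => f (c * x)).
Proof.
move=> cf Z; apply: cls_sub (cls_lin c (cf (`|c| * Z))) => x /= xZ.
by rewrite normrM ler_wpM2l.
Qed.

Lemma lcls_den_inv : lcls (fun z => (den z)^-1).
Proof.
move=> Z; have M0 : 0 < Num.max Z 1 by rewrite lt_max ltr01 orbT.
by apply: cls_sub (cls_den_inv M0) => x /= xZ; rewrite le_max xZ.
Qed.

Lemma lcls_sinr : lcls (@sinr R). Proof. exact: lclsT (@cls_sinr R). Qed.
Lemma lcls_cosc : lcls (@cosc R). Proof. exact: lclsT (@cls_cosc R). Qed.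

Lemma chi_cut c x : 0 < c -> 2 / c <= `|x| -> chi (c * x) = 0.
Proof. by move=> c0 cx; rewrite chi0// normrM gtr0_norm// mulrC -ler_pdivrMr. Qed.

Lemma chi_flat c x : 0 < c -> `|x| <= c^-1 -> chi (c * x) = 1.
Proof. by move=> c0 cx; rewrite chi1// normrM gtr0_norm// -ler_pdivlMl// mulr1. Qed.

Lemma window_cut c g (Z : nat) : 0 < c -> 2 / c <= Z%:R -> window Z (fun x => chi (c * x) * g x).
Proof.
by move=> c0 cZ x Zx; rewrite chi_cut ?mul0r//; apply: le_trans cZ (ltW Zx).
Qed.

(* [1 - dotm z = - i z bmult z], where [dotm] is the multiplier of [steklov_dot] *)
Definition bmult z : R[i] := cosc z +i* (z * sinr z).

Lemma bmult_neq0 z : bmult z != 0.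
Proof.
apply/eqP => b0; have := den_gt0 z; rewrite /den.
have := congr1 (@complex.Re R) b0; have := congr1 (@complex.Im R) b0.
by rewrite /= => -> ->; rewrite expr0n /= addr0 ltxx.
Qed.

Lemma bmultV z : (bmult z)^-1 = (cosc z * (den z)^-1) +i* (- (z * sinr z * (den z)^-1)).
Proof.
apply: (mulfI (bmult_neq0 z)); rewrite divff ?bmult_neq0//.
Qed.

(** The function (exp(iz) - 1) / (iz), in the form that comes from shifting a centred average by
    half its length; z stands for k h. *)
Definition dotm z : R[i] := cexpi (z / 2) * (sinc (z / 2))%:C.

Lemma sin_sinc z : sin z = z * sinc z.
Proof.
by rewrite /sinc; case: eqP => [->|/eqP z0]; rewrite ?sin0 ?mul0r// mulrC divfK.
Qed.

Lemma cos_sinc_half z : cos (z / 2) * sinc (z / 2) = sinc z.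
Proof.
have [->|z0] := eqVneq z 0; first by rewrite mul0r cos0 mul1r.
apply: (mulfI z0); rewrite -sin_sinc.
rewrite [in RHS](_ : z = z / 2 + z / 2) ?sinD; last by lra.
by rewrite !(sin_sinc (z / 2)); lra.
Qed.

Lemma dotmE z : 1 - dotm z = - (0 +i* 1) * z%:C * bmult z.
Proof.
have E1 : complex.Re (dotm z) = sinc z by rewrite ReM /= cos_sinc_half mulr0 subr0.
have E2 : complex.Im (dotm z) = z * cosc z.
  by rewrite ImM /= mulr0 add0r sin_sinc /cosc; lra.
apply: complex_eq.
  have := sinrE z; rewrite ReD ReN E1 => /= ->.
  by rewrite ?ReM ?ImM /=; ring.
by rewrite ImD ImN E2 ?ReM ?ImM /=; ring.
Qed.

Lemma dotm_sqr z : (1 - dotm z) ^+ 2 = - (z ^+ 2)%:C * bmult z ^+ 2.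
Proof.
rewrite dotmE !exprMn (_ : (- (0 +i* 1)) ^+ 2 = -1 :> R[i]); last first.
  by rewrite sqrrN; apply: complex_eq; rewrite /= ?ReM ?ImM /=; ring.
by rewrite expr2 -CM -expr2 mulN1r.
Qed.

End LocallySmooth.

(** * Division by the symbols of the averages *)

Section Multipliers.
Variables (R : realType) (X : banachLattice R).
Implicit Types (f g : R -> R[i]) (c h s x : R) (L n Z : nat) (k : int).
Local Notation "`‖ f ‖" := (bl_norm X f) (format "`‖ f ‖").
Hypothesis HA : assumptionA X.

(** Replaces the window hidden in [BM] by a prescribed one, so that the truncation degree can be
    taken as [Z * n]. *)
Lemma BM_window Z (G : R -> R[i]) : BM X G -> window Z G ->
  exists2 C, 0 <= C & forall n L f, (0 < n)%N -> (Z * n <= L)%N -> X f ->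
    bl_norm X (tmul L (fun k => G (k%:~R / n%:R)) f) <= C * `‖f‖.
Proof.
move=> [Z' [C [_ C0 HC]]] wG; exists C => // n L f n0 ZL Xf.
rewrite (tmul_window_widen (L' := Z' * n + Z * n) _ n0 wG ZL) ?leq_addl//.
by apply: HC => //; exact: leq_addr.
Qed.

Lemma BM_cut_on c (g : R -> R) (Z : R) : 0 < c -> 2 / c < Z -> cls [set x | `|x| <= Z] g ->
  BM X (fun x => (chi (c * x) * g x)%:C).
Proof.
move=> c0 cZ cg; have c2 : 0 <= 2 / c by rewrite divr_ge0// ltW.
have [N NP] : exists N : nat, 2 / c <= N%:R.
  by exists (Num.bound (2 / c)); apply/ltW/archi_boundP.
apply: (BM_smooth HA (Z := N)); last exact: window_cut.
apply: (cls_cutoff_mul c2 cZ _ _ cg) => [|x x1]; first exact: cls_chi_lin.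
exact: chi_cut.
Qed.

Lemma BM_cut c (g : R -> R) : 0 < c -> lcls g -> BM X (fun x => (chi (c * x) * g x)%:C).
Proof. by move=> c0 cg; apply: (@BM_cut_on _ _ (2 / c + 1)) => //; lra. Qed.

Lemma BM_chi c : 0 < c -> BM X (fun x => (chi (c * x))%:C).
Proof.
move=> c0; apply: BM_ext (BM_cut c0 (lclsT (cls_cst setT 1))) => x.
by rewrite mulr1.
Qed.

Lemma BM_cplx_cut c (g1 g2 : R -> R) : 0 < c -> lcls g1 -> lcls g2 ->
  BM X (fun x => (chi (c * x))%:C * (g1 x +i* g2 x)).
Proof.
move=> c0 h1 h2.
apply: BM_ext (BMD (BM_cut c0 h1) (BMZ (0 +i* 1) (BM_cut c0 h2))) => x.
by apply: complex_eq; rewrite ?ReD ?ImD ?ReM ?ImM /=; ring.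
Qed.

Lemma BM_bmult c a : 0 < c -> BM X (fun x => (chi (c * x))%:C * bmult (a * x)).
Proof.
move=> c0; apply: (BM_cplx_cut c0).
  exact: (lcls_lin a (@lcls_cosc R)).
exact: (lcls_lin a (lclsM (@lcls_id R) (@lcls_sinr R))).
Qed.

Lemma BM_bmultV c a : 0 < c -> BM X (fun x => (chi (c * x))%:C * (bmult (a * x))^-1).
Proof.
move=> c0; have h1 := lcls_lin a (lclsM (@lcls_cosc R) (@lcls_den_inv R)).
have h2 := lclsZ (-1) (lcls_lin a (lclsM (lclsM (@lcls_id R) (@lcls_sinr R)) (@lcls_den_inv R))).
apply: BM_ext (BM_cplx_cut c0 h1 h2) => x.
by rewrite bmultV mulN1r.
Qed.

Lemma chi_nest c c' x : 0 < c' -> c' <= c / 2 -> chi (c * x) * chi (c' * x) = chi (c * x).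
Proof.
move=> c'0 cc; have c0 : 0 < c by lra.
have [xc|xc] := leP (2 / c) `|x|; first by rewrite chi_cut// mul0r.
rewrite (@chi_flat _ c')// ?mulr1// (le_trans (ltW xc))// -[leLHS]invrK lef_pV2 ?posrE ?invr_gt0 ?divr_gt0//.
by rewrite invfM invrK mulrC.
Qed.

(** 1 / [bmult] has no compact window of its own, so it is applied to symbols absorbed by some
    cutoff. *)
Lemma BM_bmultV2 c a (G : R -> R[i]) : 0 < c -> BM X G -> (forall x, G x * (chi (c * x))%:C = G x) ->
  BM X (fun x => G x / bmult (a * x)).
Proof.
move=> c0 hG Gc; apply: BM_ext (BMM hG (BM_bmultV a c0)) => x.
by rewrite mulrA Gc.
Qed.

(* The difference of the two cutoffs vanishes near the origin, so that the
   quotient by [z ^+ 2] is smooth. *)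
Lemma BM_band c c' a : 0 < c -> 0 < c' -> 0 < a ->
  BM X (fun x => (chi (c * x) - chi (c' * x))%:C / (1 - dotm (a * x)) ^+ 2).
Proof.
move=> c0 c'0 a0.
(* Both cutoffs equal 1 for |x| <= 1 / e, and chi(d x) = 1 wherever one of them is nonzero. *)
pose e := Num.max c c'; pose d := Num.min c c' / 2.
have e0 : 0 < e by rewrite lt_max c0.
have d0 : 0 < d by rewrite divr_gt0// lt_min c0.
have dc : d <= c / 2 by rewrite ler_pM2r// ge_min lexx.
have dc' : d <= c' / 2 by rewrite ler_pM2r// ge_min lexx orbT.
have ce : c <= e by rewrite le_max lexx.
have c'e : c' <= e by rewrite le_max lexx orbT.
(* A denominator bounded below on the whole line and equal to x^2 for |x| >= 1 / e, outside of which
   the difference of the cutoffs vanishes. *)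
pose D x := x ^+ 2 + chi (2 * e * x) ^+ 2.
have cD : lcls D.
  move=> Z; apply: (@eq_cls _ _ (fun x => x * x + chi (2 * e * x) * chi (2 * e * x))).
    by move=> x _; rewrite -!expr2.
  have h := lclsT (cls_chi_lin (2 * e)).
  exact: (lclsD (lclsM (@lcls_id R) (@lcls_id R)) (lclsM h h)).
have e20 : 0 < 2 * e by rewrite mulr_gt0.
pose m := Num.min 1 ((2 * e)^-1 ^+ 2).
have m0 : 0 < m by rewrite lt_min ltr01 exprn_gt0// invr_gt0.
have Dm x : m <= D x.
  have [x1|x1] := leP `|x| (2 * e)^-1.
    by rewrite /D chi_flat// expr1n ge_min; apply/orP; left; rewrite lerDr sqr_ge0.
  rewrite /m ge_min; apply/orP; right; rewrite /D.
  apply: (@le_trans _ _ (x ^+ 2)); last by rewrite lerDl sqr_ge0.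
  by rewrite -[leRHS]real_normK ?num_real// lerXn2r ?nnegrE ?invr_ge0 ?(ltW e20) ?(ltW x1).
have cDi : lcls (fun x => (D x)^-1) by move=> Z; apply: (cls_inv m0).
have hG : BM X (fun x => ((chi (c * x) - chi (c' * x)) * (D x)^-1)%:C).
  apply: BM_ext (BMD (BM_cut c0 cDi) (BMZ (-1) (BM_cut c'0 cDi))) => x.
  by rewrite (mulrBl (D x)^-1 (chi (c * x)) (chi (c' * x))) (CB (chi (c * x) / D x)) mulN1r.
have nest x : (chi (c * x) - chi (c' * x)) * chi (d * x) = chi (c * x) - chi (c' * x).
  by rewrite (mulrBl (chi (d * x)) (chi (c * x)) (chi (c' * x))) !chi_nest.
have N1 x : ((chi (c * x) - chi (c' * x)) * (D x)^-1)%:C * (chi (d * x))%:C =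
    ((chi (c * x) - chi (c' * x)) * (D x)^-1)%:C :> R[i].
  by rewrite -CM mulrAC nest.
have hG1 := BM_bmultV2 a d0 hG N1.
have N2 x : ((chi (c * x) - chi (c' * x)) * (D x)^-1)%:C / bmult (a * x) * (chi (d * x))%:C =
    ((chi (c * x) - chi (c' * x)) * (D x)^-1)%:C / bmult (a * x).
  by rewrite mulrAC N1.
have hG2 := BMZ (- (a ^- 2))%:C (BM_bmultV2 a d0 hG1 N2).
apply: BM_ext hG2 => x; rewrite dotm_sqr.
have [xe|xe] := leP `|x| e^-1.
  rewrite !chi_flat// ?subrr ?mul0r ?mulr0//.
    by apply: le_trans xe _; rewrite lef_pV2.
  by apply: le_trans xe _; rewrite lef_pV2.
have x0 : x != 0 by rewrite -normr_gt0 (lt_trans _ xe)// invr_gt0.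
have -> : D x = x ^+ 2.
  rewrite /D chi_cut// ?expr0n/= ?addr0//.
  by rewrite invfM mulrA divff// mul1r ltW.
have b0 := bmult_neq0 (a * x); set b := bmult _ in b0 *.
have a0' : a%:C != 0 :> R[i] by apply/eqP => /(congr1 (@complex.Re R)) /= /eqP; rewrite gt_eqF.
have x0' : x%:C != 0 :> R[i] by apply/eqP => /(congr1 (@complex.Re R)) /= /eqP; rewrite (negbTE x0).
rewrite !(expr2, CM, CV, rmorphN) /=.
by field; rewrite ?a0' ?x0' ?b0.
Qed.

Lemma dotE h f x : steklov_dot h f x = (h^-1)%:C * citv x (x + h) f.
Proof.
rewrite /steklov_dot /steklov addrK (_ : x + h / 2 + h / 2 = x + h)//; lra.
Qed.

(** The interval [x, x + h] lies in the centred window of length 2 h. *)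
Lemma dot_Av h f x : ploc f -> 0 < h -> modulus (steklov_dot h f x) <= 2 * Av (2 * h) f x.
Proof.
move=> pf h0; apply: le_trans (steklov_Av _ pf h0) _.
apply: le_trans (Av_shift (s' := 2 * h) (x := x) pf h0 _) _.
  by rewrite opprD addrA subrr add0r normrN ger0_norm; lra.
by rewrite mulrK// unitfE lt0r_neq0.
Qed.

Lemma dot_bounded : exists2 M, 1 <= M & forall h f, X f -> 0 < h ->
  X (steklov_dot h f) /\ bl_norm X (steklov_dot h f) <= M * `‖f‖.
Proof.
have [M M1 HM] := majorize_bounded HA; exists (2 * M) => [|h f Xf h0]; first by lra.
have h20 : 0 < 2 * h by rewrite mulr_gt0.
have tf : torus_fun (steklov_dot h f).
  by apply/ploc_torus_fun/ploc_shift; apply: (X_ploc (X_steklov HA Xf h0)).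
have := HM f _ 1%N (fun=> 2) (fun=> 2 * h) Xf tf.
rewrite big_ord1 mulrA; apply => // x.
by rewrite big_ord1 dot_Av//; exact: X_ploc Xf.
Qed.

Lemma fourier_coef_dot h f k : X f -> 0 < h ->
  fourier_coef (steklov_dot h f) k = dotm (h * k%:~R) * fourier_coef f k.
Proof.
move=> Xf h0; have pA := X_ploc (X_steklov HA Xf h0).
rewrite (fourier_coef_shift (h / 2) k pA) fourier_coef_steklov//; last by case: pA.
  by rewrite smult_sinc// /dotm (mulrC h k%:~R) !mulrA.
exact: X_ploc Xf.
Qed.

End Multipliers.

(** * A Jackson inequality for averaged functions *)

Section Jackson.
Variables (R : realType) (X : banachLattice R).
Implicit Types (f g u v : R -> R[i]) (c h s x y : R) (L n N Z : nat) (k : int).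
Local Notation "`‖ f ‖" := (bl_norm X f) (format "`‖ f ‖").

Lemma dotD h f g : cloc f -> cloc g ->
  steklov_dot h (fun x => f x + g x) = fun x => steklov_dot h f x + steklov_dot h g x.
Proof. by move=> jf jg; apply/funext => x; rewrite /steklov_dot steklovD. Qed.

Lemma dotB h f g : cloc f -> cloc g ->
  steklov_dot h (fun x => f x - g x) = fun x => steklov_dot h f x - steklov_dot h g x.
Proof. by move=> jf jg; apply/funext => x; rewrite /steklov_dot steklovB. Qed.

Lemma dotZ h (z : R[i]) f : cloc f ->
  steklov_dot h (fun x => z * f x) = fun x => z * steklov_dot h f x.
Proof. by move=> jf; apply/funext => x; rewrite /steklov_dot steklovZ. Qed.

Lemma dot_tmul h L m f : exists m', steklov_dot h (tmul L m f) = tmul L m' f.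
Proof.
exists (fun k => smult h k * m k * cexpi (k%:~R * (h / 2))); apply/funext => x.
rewrite /steklov_dot steklov_tmul; apply: eq_isum => k _.
by rewrite mulrDr cexpiD; ring.
Qed.

(** The interval [y, y + h] lies in [x - 3 h, x + 3 h], a window of length 6 h centred at x. *)
Lemma dot_local_bound h g x y : ploc g -> 0 < h -> x - 3 * h <= y -> y <= x + 2 * h ->
  modulus (steklov_dot h g y) <= 6 * Av (6 * h) g x.
Proof.
move=> pg h0 xy yx; rewrite dotE modulusM modulus_real ger0_norm ?invr_ge0 ?(ltW h0)//.
rewrite mulrC ler_pdivrMr//; apply: le_trans (modulus_citv _ _ pg.1) _.
apply: le_trans (itv_integral_Av (s := 6 * h) (x := x) pg _ _ _ _) _; [lra|lra|lra|lra|].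
by rewrite mulrAC.
Qed.

Lemma modulus_citv_bound a b f (K : R) : cloc f -> a <= b ->
  (forall t, a <= t <= b -> modulus (f t) <= K) -> modulus (citv a b f) <= K * (b - a).
Proof.
move=> jf ab fK; apply: le_trans (modulus_citv _ _ jf) _.
rewrite -itv_integral_cst//; apply: itv_integral_le => //; first exact: cloc_modulus.
exact: loc_integrable_cst.
Qed.

(** Moving the outer average from y1 to y2 exchanges two intervals of length y2 - y1, on each of
    which the inner average is at most 6 Av(6 h) g x: hence 12. The inner average supplies local
    boundedness, the outer one the Lipschitz property, so two are used. *)
Lemma dot_lipschitz h g x (y1 y2 : R) : ploc g -> cloc (steklov_dot h g) -> 0 < h ->
  y1 <= y2 -> x - h <= y1 -> y2 <= x + h ->
  modulus (steklov_dot h (steklov_dot h g) y2 - steklov_dot h (steklov_dot h g) y1) <=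
  12 * ((y2 - y1) / h) * Av (6 * h) g x.
Proof.
move=> pg ju h0 y12 xy1 yx2; set u := steklov_dot h g.
rewrite !(dotE h u) -mulrBr.
have -> : citv y2 (y2 + h) u - citv y1 (y1 + h) u = citv (y1 + h) (y2 + h) u - citv y1 y2 u.
  have h1 : citv y1 (y2 + h) u = citv y1 y2 u + citv y2 (y2 + h) u by apply: citv_cat => //; lra.
  have h2 : citv y1 (y2 + h) u = citv y1 (y1 + h) u + citv (y1 + h) (y2 + h) u by apply: citv_cat => //; lra.
  by rewrite -[X in X - _](addKr (citv y1 y2 u)) -h1 h2; ring.
have bd (a b : R) : a <= b -> x - h <= a -> b <= x + 2 * h ->
    modulus (citv a b u) <= 6 * Av (6 * h) g x * (b - a).
  move=> ab xa bx; apply: modulus_citv_bound => // t /andP[t1 t2].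
  by apply: dot_local_bound => //; lra.
rewrite modulusM modulus_real ger0_norm ?invr_ge0 ?(ltW h0)//.
rewrite mulrC ler_pdivrMr//; apply: le_trans (modulusB _ _) _.
have -> : 12 * ((y2 - y1) / h) * Av (6 * h) g x * h = 12 * (y2 - y1) * Av (6 * h) g x.
  by field; rewrite lt0r_neq0.
have := bd _ _ y12 xy1; have := bd (y1 + h) (y2 + h).
have e1 : y1 + h <= y2 + h by lra.
have e2 : x - h <= y1 + h by lra.
have e3 : y2 + h <= x + 2 * h by lra.
have e4 : y2 <= x + 2 * h by lra.
by move=> /(_ e1 e2 e3) b1 /(_ e4) b2; lra.
Qed.

Hypothesis HA : assumptionA X.

Lemma tmul_cst L m (z : R[i]) x : tmul L m (fun=> z) x = m 0 * z.
Proof.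
rewrite -[RHS](isum_delta L (fun=> m 0 * z) 0); apply: eq_isum => k _.
have -> : (fun=> z) = fun x : R => z * cexpi (0%:~R * x).
  by apply/funext => y; rewrite mul0r cexpi0 mulr1.
rewrite fourier_coefZ ?fourier_coef_cexpi; last exact: cloc_cexpi.
rewrite eq_sym; case: eqP => [->|_]; last by rewrite !mulr0 mul0r.
by rewrite mul0r cexpi0 !mulr1.
Qed.

Lemma ler_sqrt_min (t : R) : 0 <= t -> t <= 1 -> t <= Num.sqrt t.
Proof.
move=> t0 t1; rewrite -{1}(sqr_sqrtr t0) expr2 ler_piMr ?sqrtr_ge0//.
by rewrite -sqrtr1 ler_wsqrtr.
Qed.

(** For s <= h the Lipschitz bound gives s / h, at most its square root; for s > h the square root
    exceeds 1 and the triangle inequality suffices. The exponent 1/2 is a compromise: the full power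
    s / h, with s of order 2^j, would exactly cancel the decay 2^-j of the majorant of the kernel of
    [chi]. *)
Lemma Av_oscillation h g v s x : X g -> 0 < h -> 0 < s ->
  v = steklov_dot h (steklov_dot h g) ->
  Av s (fun y => v y - v x) x <=
    12 * Num.sqrt (s / h) * (Av (6 * h) g x + modulus (v x) + Av s v x).
Proof.
move=> Xg h0 s0 vE; have [D D1 HD] := dot_bounded HA.
have Xu := (HD h g Xg h0).1; have Xv := (HD h _ Xu h0).1; rewrite -vE in Xv.
have jv := (X_ploc Xv).1; have jd : cloc (fun y => v y - v x) by apply: clocB => //; exact: cloc_cst.
have sh : 0 < s / h by rewrite divr_gt0.
have q0 : 0 <= Num.sqrt (s / h) by exact: sqrtr_ge0.
have h60 : 0 < 6 * h by lra.
have a1 := Av_ge0 g x h60; have a2 := Av_ge0 v x s0; have a3 := modulus_ge0 (v x).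
have [sle|slt] := leP s h.
  apply: (@le_trans _ _ (12 * (s / h) * Av (6 * h) g x)).
    rewrite {1}/Av mulrC ler_pdivrMr//.
    have <- : itv_integral (x - s / 2) (x + s / 2) (fun=> 12 * (s / h) * Av (6 * h) g x) =
        12 * (s / h) * Av (6 * h) g x * s.
      by rewrite itv_integral_cst; [congr (_ * _)|]; lra.
    apply: itv_integral_le; [exact: cloc_modulus|exact: loc_integrable_cst|].
    move=> t /andP[t1 t2].
    have key (y1 y2 : R) : y1 <= y2 -> x - s / 2 <= y1 -> y2 <= x + s / 2 ->
        modulus (v y2 - v y1) <= 12 * (s / h) * Av (6 * h) g x.
      move=> y12 xy yx; rewrite vE; apply: le_trans (@dot_lipschitz h g x y1 y2 (X_ploc Xg) (X_ploc Xu).1 h0 y12 _ _) _.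
      - lra.
      - lra.
      by rewrite ler_wpM2r// ler_wpM2l// ler_pM2r ?invr_gt0//; lra.
    have [tx|xt] := leP t x; first by rewrite -modulusN opprB; apply: key; lra.
    by apply: key; lra.
  have sl : s / h <= 1 by rewrite ler_pdivrMr// mul1r.
  have := ler_sqrt_min (ltW sh) sl => h1.
  have p12 : 0 <= 12 :> R by lra.
  apply: le_trans (ler_wpM2r a1 (ler_wpM2l p12 h1)) _.
  by rewrite ler_wpM2l ?mulr_ge0//; lra.
apply: (@le_trans _ _ (Av s v x + modulus (v x))).
  rewrite (_ : modulus (v x) = s^-1 * (s * modulus (v x))); last by rewrite mulKf// lt0r_neq0.
  rewrite /Av -mulrDr ler_wpM2l ?invr_ge0 ?(ltW s0)//.
  have -> : s * modulus (v x) = itv_integral (x - s / 2) (x + s / 2) (fun=> modulus (v x)).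
    by rewrite itv_integral_cst; lra.
  have jm := cloc_modulus jv.
  rewrite -itv_integralD//; last exact: loc_integrable_cst.
  apply: itv_integral_le; [exact: cloc_modulus| |by move=> t _; exact: modulusB].
  by apply: loc_integrableD => //; exact: loc_integrable_cst.
have q1 : 1 <= Num.sqrt (s / h).
  by rewrite -sqrtr1 ler_wsqrtr// ler_pdivlMr// mul1r ltW.
by nra.
Qed.

(** As chi(0) = 1, the filter reproduces constants, so its error at x is the filter applied to v -
    v(x) up to sign; the majorant then consists of averages of this oscillation. *)
Lemma jackson : exists2 C, 0 <= C & forall h N g v, 0 < h -> (0 < N)%N -> X g ->
  v = steklov_dot h (steklov_dot h g) ->
  bl_norm X (fun x => v x - tmul (2 * N) (fun k => (chi (k%:~R / N%:R : R))%:C) v x)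
    <= C / Num.sqrt (N%:R * h) * `‖g‖.
Proof.
have [D D1 HD] := dot_bounded HA; have [M M1 HM] := Av_bounded HA.
have wchi : window 2 (@chi R) by move=> x x2; rewrite chi0// ltW.
have [C C0 kd] := smooth_kdecay (@cls_chi R) wchi.
(* Ratio of the resulting series: 2^-j from the kernel, sqrt(2)^j from the oscillation at scale
   2^(j+2) / N. *)
pose r := Num.sqrt 2 / 2 : R.
have s20 : 0 < Num.sqrt 2 :> R by rewrite sqrtr_gt0.
have s22 : Num.sqrt 2 ^+ 2 = 2 :> R by rewrite sqr_sqrtr.
have sq2 : Num.sqrt 2 < 2 :> R.
  rewrite ltNge; apply/negP => h; have := ler_pM _ _ h h; rewrite -(expr2 (Num.sqrt 2)) s22.
  by move=> /(_ (ltW (ltr0Sn _ 1)) (ltW (ltr0Sn _ 1))); lra.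
have r01 : 0 <= r < 1 by rewrite /r; apply/andP; split; lra.
have [r0 r1] := andP r01.
have DD : 0 <= D * D by rewrite mulr_ge0//; lra.
pose A := M + D * D + M * (D * D).
have A0 : 0 <= A by rewrite /A !addr_ge0 ?mulr_ge0//; lra.
exists (24 * C * (1 - r)^-1 * A) => [|h N g v h0 N0 Xg vE].
  by rewrite !mulr_ge0 ?invr_ge0 ?subr_ge0 ?(ltW r1).
have Np : 0 < N%:R :> R by rewrite ltr0n.
have [Xu nu] := HD h g Xg h0; have [Xv nv] := HD h _ Xu h0; rewrite -vE in Xv nv.
have pv := X_ploc Xv; have h60 : 0 < 6 * h by lra.
set m := fun k => _; pose s j := 2 ^+ j.+2 / N%:R : R.
have s0 j : 0 < s j by rewrite /s divr_gt0// exprn_gt0.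
pose P j x := Av (6 * h) g x + modulus (v x) + Av (s j) v x.
have P0 j x : 0 <= P j x by rewrite /P !addr_ge0 ?modulus_ge0 ?Av_ge0.
have XP j : X (fun x => (P j x)%:C) /\ bl_norm X (fun x => (P j x)%:C) <= A * `‖g‖.
  have [X1 n1] := HM g _ Xg h60; have [X2 n2] := X_abs Xv; have [X3 n3] := HM v _ Xv (s0 j).
  have -> : (fun x => (P j x)%:C) = fun x => (Av (6 * h) g x)%:C + (modulus (v x))%:C + (Av (s j) v x)%:C.
    by apply/funext => x; rewrite /P !CD.
  have X12 := X_add X1 X2.
  split; first exact: X_add.
  apply: le_trans (norm_add X12 X3) _; apply: le_trans (lerD (norm_add X1 X2) (lexx _)) _.
  apply: le_trans (lerD (lerD n1 n2) n3) _.
  have nv' : `‖v‖ <= D * D * `‖g‖.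
    by apply: le_trans nv _; rewrite -mulrA ler_wpM2l//; lra.
  have g0 := norm_ge0 Xg.
  have h1 := ler_wpM2l (le_trans ler01 M1) nv'.
  apply: le_trans (lerD (lerD (lexx _) nv') h1) _.
  by rewrite le_eqVlt; apply/orP; left; apply/eqP; rewrite /A; ring.
pose w := Num.sqrt (N%:R * h).
have w0 : 0 < w by rewrite sqrtr_gt0 mulr_gt0.
(* 24 is 12 from [Av_oscillation] times 2 from the square root of s j / h, which is 2 sqrt(2)^j /
   w. *)
pose c j := 24 * C / w * r ^+ j.
have c0 j : 0 <= c j by rewrite /c !mulr_ge0 ?invr_ge0 ?exprn_ge0// ltW.
have sq j : Num.sqrt (s j / h) = 2 * Num.sqrt 2 ^+ j / w.
  have -> : s j / h = (2 * Num.sqrt 2 ^+ j / w) ^+ 2.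
    rewrite !exprMn exprVn exprAC s22 /w sqr_sqrtr ?mulr_ge0 ?(ltW h0)// /s !exprS.
    by field; rewrite !lt0r_neq0.
  by rewrite sqrtr_sqr ger0_norm// !mulr_ge0 ?invr_ge0 ?exprn_ge0// ltW.
have XU j : X (fun x => (c j)%:C * (P j x)%:C) by apply: bl_scale; case: (XP j).
have nU j : bl_norm X (fun x => (c j)%:C * (P j x)%:C) <= c j * (A * `‖g‖).
  have [XPj nP] := XP j; rewrite norm_scale// modulus_real ger0_norm//.
  by rewrite ler_wpM2l.
have tg : torus_fun (fun x => v x - tmul (2 * N) m v x).
  apply: bl_torus_fun (X_sub Xv _); exact: X_tmul.
have [|_ h1] := X_sum_le (N := N + 3) tg (fun j _ => XU j) (fun j _ => nU j).
  move=> x.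
  have -> : v x - tmul (2 * N) m v x = - tmul (2 * N) m (fun y => v y - v x) x.
    rewrite tmul_funB; [|exact: pv.1|exact: cloc_cst].
    by rewrite tmul_cst /m mul0r chi1 ?normr0// mul1r opprB.
  rewrite modulusN.
  apply: le_trans (tmul_majorant (n := N) (C := C) (q := 2^-1) x N0 C0 _ _ _) _.
  - by rewrite invr_ge0.
  - exact: kd.
  - by apply: plocB => //; split; [exact: cloc_cst|].
  apply: ler_sum => j _.
  rewrite modulusM !modulus_real (ger0_norm (c0 j)) (ger0_norm (P0 j x)).
  apply: le_trans (ler_wpM2l _ (Av_oscillation x Xg h0 (s0 j) vE)) _.
    by rewrite mulr_ge0// exprn_ge0// invr_ge0.
  rewrite sq -/(P j x) !mulrA ler_wpM2r// le_eqVlt; apply/orP; left; apply/eqP.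
  rewrite /c /r expr_div_n exprVn; field.
  by rewrite !lt0r_neq0// exprn_gt0.
apply: le_trans h1 _.
rewrite -mulr_suml /c -mulr_sumr mulrA ler_wpM2r ?norm_ge0//.
have := geometric_sum_le (N + 3) r01; set S := \sum_(j < _) _ => hS.
have cw : 0 <= 24 * C / w * A by rewrite !mulr_ge0 ?invr_ge0// ltW.
have -> : 24 * C * (1 - r)^-1 * A / w = 24 * C / w * A * (1 - r)^-1 by ring.
by rewrite mulrAC ler_wpM2l.
Qed.

End Jackson.

(** * Reduction to trigonometric polynomials *)

Section Descent.
Variables (R : realType) (X : banachLattice R).
Implicit Types (f g u v : R -> R[i]) (c h s x y : R) (L n N Z B : nat) (k : int).
Local Notation "`‖ f ‖" := (bl_norm X f) (format "`‖ f ‖").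
Hypothesis HA : assumptionA X.

Definition dotdiff h f : R -> R[i] := fun x => f x - steklov_dot h f x.

Lemma X_dot h f : X f -> 0 < h -> X (steklov_dot h f).
Proof. by have [D _ HD] := dot_bounded HA => Xf h0; case: (HD h f Xf h0). Qed.

Lemma X_dotdiff h f : X f -> 0 < h -> X (dotdiff h f).
Proof. by move=> Xf h0; apply: X_sub => //; exact: X_dot. Qed.

Lemma dotdiff_bounded : exists2 C, 0 <= C & forall h f, X f -> 0 < h ->
  bl_norm X (dotdiff h f) <= C * `‖f‖.
Proof.
have [D D1 HD] := dot_bounded HA; exists (1 + D) => [|h f Xf h0]; first by lra.
have [Xd nd] := HD h f Xf h0.
by apply: le_trans (norm_sub Xf Xd) _; rewrite mulrDl mul1r lerD2l.
Qed.

Lemma dotdiffB h f g : X f -> X g ->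
  dotdiff h (fun x => f x - g x) = fun x => dotdiff h f x - dotdiff h g x.
Proof.
move=> Xf Xg; apply/funext => x; rewrite /dotdiff dotB; [ring|exact: (X_ploc Xf).1|exact: (X_ploc Xg).1].
Qed.

Lemma fourier_coef_dotdiff h f k : X f -> 0 < h ->
  fourier_coef (dotdiff h f) k = (1 - dotm (h * k%:~R)) * fourier_coef f k.
Proof.
move=> Xf h0; rewrite fourier_coefB; [|exact: (X_ploc Xf).1|exact: (X_ploc (X_dot Xf h0)).1].
by rewrite (fourier_coef_dot HA k Xf h0) mulrBl mul1r.
Qed.

Lemma scaleE (a : R) n k : a / n%:R * k%:~R = a * (k%:~R / n%:R).
Proof. by rewrite mulrAC mulrA. Qed.

Definition lowpass N f := tmul (2 * N) (fun k => (chi (k%:~R / N%:R : R))%:C) f.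

Lemma X_lowpass N f : X (lowpass N f). Proof. exact: X_tmul. Qed.

Lemma lowpass_bounded : exists2 C, 0 <= C & forall N f, (0 < N)%N -> X f ->
  bl_norm X (lowpass N f) <= C * `‖f‖.
Proof.
have wchi : window 2 (fun x : R => (chi (1 * x))%:C : R[i]).
  by move=> x x2; rewrite mul1r chi0// ltW.
have [C C0 HC] := BM_window (BM_chi HA ltr01) wchi; exists C => // N f N0 Xf.
have := HC N (2 * N)%N f N0 (leqnn _) Xf.
by rewrite (_ : (fun k => _) = (fun k => (chi (k%:~R / N%:R : R))%:C))//; apply/funext => k; rewrite mul1r.
Qed.

(** Where the two cutoffs differ, the symbol (1 - dotm)^2 of the double forward difference can be
    divided out. *)
Lemma band_bounded (a c c' : R) Z : 0 < a -> 0 < c -> 0 < c' -> 2 / c <= Z%:R -> 2 / c' <= Z%:R ->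
  exists2 C, 0 <= C & forall n f, (0 < n)%N -> X f ->
    bl_norm X (tmul (Z * n) (fun k => (chi (c * (k%:~R / n%:R)) - chi (c' * (k%:~R / n%:R)) : R)%:C) f)
    <= C * bl_norm X (dotdiff (a / n%:R) (dotdiff (a / n%:R) f)).
Proof.
move=> a0 c0 c'0 cZ c'Z.
have wG : window Z (fun x : R => (chi (c * x) - chi (c' * x))%:C / (1 - dotm (a * x)) ^+ 2).
  move=> x xZ; rewrite !chi_cut ?subrr ?mul0r//.
    by apply: le_trans c'Z (ltW xZ).
  by apply: le_trans cZ (ltW xZ).
have [C C0 HC] := BM_window (BM_band HA c0 c'0 a0) wG; exists C => // n f n0 Xf.
have h0 : 0 < a / n%:R by rewrite divr_gt0// ltr0n.
have XJ := X_dotdiff Xf h0; have XF := X_dotdiff XJ h0.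
rewrite [leLHS](_ : _ = bl_norm X (tmul (Z * n) (fun k => (chi (c * (k%:~R / n%:R)) - chi (c' * (k%:~R / n%:R)))%:C
  / (1 - dotm (a * (k%:~R / n%:R))) ^+ 2) (dotdiff (a / n%:R) (dotdiff (a / n%:R) f)))); first exact: HC.
congr bl_norm; apply: eq_tmul => k _.
rewrite !fourier_coef_dotdiff// scaleE; set x := k%:~R / n%:R.
(* At frequency 0 the double difference sees nothing, but both cutoffs are 1 there and the left-hand
   symbol vanishes too. *)
have [->|x0] := eqVneq x 0.
  by rewrite !mulr0 chi1 ?normr0// subrr !mul0r.
have nz : (1 - dotm (a * x)) != 0.
  rewrite dotmE !mulf_neq0 ?bmult_neq0// ?oppr_eq0.
    by apply/eqP => /(congr1 (@complex.Im R)) /= /eqP; rewrite oner_eq0.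
  by apply/eqP => /(congr1 (@complex.Re R)) /= /eqP; rewrite mulf_eq0 (negbTE x0) orbF gt_eqF.
move: (fourier_coef f k) (1 - dotm _) nz (_%:C) => p u u0 q.
by rewrite (mulrA u) -expr2 [RHS]mulrA divfK// expf_neq0.
Qed.

Lemma tmulB L (m m' : int -> R[i]) f x :
  tmul L (fun k => m k - m' k) f x = tmul L m f x - tmul L m' f x.
Proof.
rewrite -[in RHS]mulN1r -tmulZ -tmulD; apply: eq_isum => k _.
by rewrite mulN1r.
Qed.

Lemma lowpass_widen N L f : (0 < N)%N -> (2 * N <= L)%N ->
  tmul L (fun k => (chi (k%:~R / N%:R : R))%:C) f = lowpass N f.
Proof.
move=> N0 NL; rewrite /lowpass (@tmul_widen _ (2 * N) L)// => k kN.
have Np : 0 < N%:R :> R by rewrite ltr0n.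
rewrite chi0// normrM normfV (gtr0_norm Np) ler_pdivlMr// -intr_norm.
by rewrite -natrM -[(2 * N)%:R]/(((2 * N)%N%:Z)%:~R) ler_int; lia.
Qed.

(** Absorption. Let g be f minus its low-pass at N1 = b n. The error of the low-pass at N2 = 2 N1 is
    bounded by the double difference F plus half the norm of g; and g exceeds this error by a band,
    again bounded by F. The factor 1/2 is moved to the left. *)
Lemma descent (a : R) : 0 < a -> exists B C, [/\ (0 < B)%N, 0 <= C & forall n f, (0 < n)%N -> X f ->
  bl_norm X (fun x => f x - lowpass (B * n) f x) <=
    C * bl_norm X (dotdiff (a / n%:R) (dotdiff (a / n%:R) f))].
Proof.
move=> a0; have [CJ CJ0 HJ] := jackson HA; have [D D1 HD] := dot_bounded HA.
have [Cc Cc0 Hc] := lowpass_bounded.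
pose A := 3 + 2 * D; pose Q := 2 * CJ * A.
have A0 : 0 <= A by rewrite /A; lra.
have Q0 : 0 <= Q by rewrite !mulr_ge0.
(* Since N2 h = 2 b a, this b makes the Jackson factor times the bound [A] for the operator 3 - 2
   Adot_h at most 1/2. *)
have [b b0 bQ] : exists2 b, (0 < b)%N & Q ^+ 2 < 2 * b%:R * a.
  exists (Num.bound (Q ^+ 2 / (2 * a))).+1 => //.
  have : Q ^+ 2 / (2 * a) < (Num.bound (Q ^+ 2 / (2 * a)))%:R.
    by apply: archi_boundP; rewrite divr_ge0 ?sqr_ge0// mulr_ge0// ltW.
  rewrite ltr_pdivrMr ?mulr_gt0// => h; rewrite -natr1; lra.
have bp : 0 < b%:R :> R by rewrite ltr0n.
have c1 : 0 < (b%:R : R)^-1 by rewrite invr_gt0.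
have c2 : 0 < (2 * b%:R : R)^-1 by rewrite invr_gt0 mulr_gt0.
have z1 : 2 / (2 * b%:R : R)^-1 <= (2 * (2 * b))%:R by rewrite invrK !natrM.
have z2 : 2 / (b%:R : R)^-1 <= (2 * (2 * b))%:R by rewrite invrK !natrM; lra.
have [C2 C20 HC2] := band_bounded a0 c2 c1 z1 z2.
pose C1 := (1 + Cc) * (1 + 2 * D).
have C10 : 0 <= C1 by rewrite /C1 mulr_ge0//; lra.
exists (2 * b)%N, (2 * C1 + C2); split; [by rewrite muln_gt0|lra|] => n f n0 Xf.
have np : 0 < n%:R :> R by rewrite ltr0n.
set h := a / n%:R; have h0 : 0 < h by rewrite divr_gt0.
set F := dotdiff h (dotdiff h f).
have XF : X F by apply: X_dotdiff => //; exact: X_dotdiff.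
have [N1 N1E] : exists N1, N1 = (b * n)%N by exists (b * n)%N.
have [N2 N2E] : exists N2, N2 = (2 * b * n)%N by exists (2 * b * n)%N.
rewrite -N2E.
have N10 : (0 < N1)%N by rewrite N1E muln_gt0 b0.
have N20 : (0 < N2)%N by rewrite N2E !muln_gt0 b0.
have cl u : X u -> cloc u by move=> Xu; exact: (X_ploc Xu).1.
pose w := lowpass N1 f; pose g x := f x - w x.
have Xw : X w by exact: X_lowpass.
have Xg : X g by exact: X_sub.
(* For [a] the multiplier of [steklov_dot], [1 = (1 - a)^2 (1 + 2 a) + a^2 (3 - 2 a)]. *)
pose P u x : R[i] := 3 * u x - 2 * steklov_dot h u x.
pose S u := steklov_dot h (steklov_dot h (P u)).
have XP u : X u -> X (P u).
  by move=> Xu; apply: X_sub; apply: bl_scale => //; exact: X_dot.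
have XS u : X u -> X (S u) by move=> Xu; apply: X_dot => //; apply: X_dot => //; exact: XP.
have m2 : modulus (2 : R[i]) = 2 by rewrite -Cnat modulus_real ger0_norm.
have m3 : modulus (3 : R[i]) = 3 by rewrite -Cnat modulus_real ger0_norm.
have nP u : X u -> bl_norm X (P u) <= A * bl_norm X u.
  move=> Xu; have [X1 n1] := HD h u Xu h0.
  apply: le_trans (norm_sub (bl_scale 3 Xu) (bl_scale 2 X1)) _.
  by rewrite (norm_scale 3 Xu) (norm_scale 2 X1) m2 m3 /A; lra.
pose hp u x := u x - lowpass N2 u x.
have Xhp u : X u -> X (hp u) by move=> Xu; apply: X_sub => //; exact: X_lowpass.
have nhp u : X u -> bl_norm X (hp u) <= (1 + Cc) * bl_norm X u.
  move=> Xu; apply: le_trans (norm_sub Xu (X_lowpass N2 u)) _.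
  by rewrite mulrDl mul1r lerD2l; exact: Hc.
have hpD u v : X u -> X v -> hp (fun x => u x + v x) = fun x => hp u x + hp v x.
  move=> Xu Xv; apply/funext => x; rewrite /hp /lowpass tmul_funD; [ring|exact: cl|exact: cl].
have step1 : `‖g‖ <= bl_norm X (hp f) + C2 * `‖F‖.
  have E : g = fun x => hp f x + (lowpass N2 f x - lowpass N1 f x).
    by apply/funext => x; rewrite /g /hp /w; ring.
  have Ed : (fun x => lowpass N2 f x - lowpass N1 f x) =
      tmul (2 * (2 * b) * n) (fun k => (chi ((2 * b%:R)^-1 * (k%:~R / n%:R)) - chi (b%:R^-1 * (k%:~R / n%:R)) : R)%:C) f.
    have h1 : (2 * N1 <= 2 * (2 * b) * n)%N by rewrite N1E; clear; lia.
    have h2 : (2 * N2 <= 2 * (2 * b) * n)%N by rewrite N2E; clear; lia.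
    apply/funext => x.
    rewrite [RHS](_ : _ = tmul (2 * (2 * b) * n) (fun k => (chi ((2 * b%:R)^-1 * (k%:~R / n%:R)) : R)%:C -
        (chi (b%:R^-1 * (k%:~R / n%:R)) : R)%:C) f x); last by apply: eq_isum => k _; rewrite CB.
    rewrite tmulB; congr (_ - _).
      rewrite -(congr1 (@^~ x) (lowpass_widen f N20 h2)).
      congr (tmul _ _ _ _); apply/funext => k; rewrite N2E !natrM.
      by congr ((chi _)%:C); field; rewrite !lt0r_neq0.
    rewrite -(congr1 (@^~ x) (lowpass_widen f N10 h1)).
    congr (tmul _ _ _ _); apply/funext => k; rewrite N1E !natrM.
    by congr ((chi _)%:C); field; rewrite !lt0r_neq0.
  rewrite E; apply: le_trans (norm_add (Xhp f Xf) (X_sub (X_lowpass N2 f) (X_lowpass N1 f))) _.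
  by rewrite lerD2l Ed; exact: HC2.
have step2 : bl_norm X (hp f) <= C1 * `‖F‖ + 2^-1 * `‖g‖.
  have XdF := X_dot XF h0.
  pose e x := F x + 2 * steklov_dot h F x.
  have Xe : X e by apply: X_add => //; exact: bl_scale.
  have Xf1 := X_dot Xf h0; have Xf2 := X_dot Xf1 h0; have Xf3 := X_dot Xf2 h0.
  have Ssub : S f = fun x => S g x + S w x.
    have fgw : f = fun x => g x + w x by apply/funext => y; rewrite /g subrK.
    have dgw : steklov_dot h f = fun x => steklov_dot h g x + steklov_dot h w x.
      by rewrite -(dotD h (cl _ Xg) (cl _ Xw)) -fgw.
    have EP : P f = fun x => P g x + P w x.
      by apply/funext => x; rewrite /P dgw [f x](congr1 (@^~ x) fgw); ring.
    rewrite /S EP (dotD h (cl _ (XP _ Xg)) (cl _ (XP _ Xw))) dotD//.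
      by apply: cl; apply: X_dot => //; exact: XP.
    by apply: cl; apply: X_dot => //; exact: XP.
  have SE : S f = fun x => 3 * steklov_dot h (steklov_dot h f) x -
      2 * steklov_dot h (steklov_dot h (steklov_dot h f)) x.
    have lin u v : X u -> X v -> steklov_dot h (fun x => 3 * u x - 2 * v x) =
        fun x => 3 * steklov_dot h u x - 2 * steklov_dot h v x.
      move=> Xu Xv; have c3 := cl _ (bl_scale 3 Xu); have c2' := cl _ (bl_scale 2 Xv).
      by rewrite (dotB h c3 c2') (dotZ h 3 (cl _ Xu)) (dotZ h 2 (cl _ Xv)).
    by rewrite /S /P (lin _ _ Xf Xf1) (lin _ _ Xf1 Xf2).
  have FE : F = fun x => f x - 2 * steklov_dot h f x + steklov_dot h (steklov_dot h f) x.
    apply/funext => x; rewrite /F /dotdiff dotB; [ring|exact: cl|exact: cl].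
  have dFE : steklov_dot h F = fun x => steklov_dot h f x - 2 * steklov_dot h (steklov_dot h f) x
      + steklov_dot h (steklov_dot h (steklov_dot h f)) x.
    have lin u v t : X u -> X v -> X t -> steklov_dot h (fun x => u x - 2 * v x + t x) =
        fun x => steklov_dot h u x - 2 * steklov_dot h v x + steklov_dot h t x.
      move=> Xu Xv Xt; have c2' := cl _ (bl_scale 2 Xv).
      by rewrite (dotD h (clocB (cl _ Xu) c2') (cl _ Xt)) (dotB h (cl _ Xu) c2') (dotZ h 2 (cl _ Xv)).
    by rewrite FE; exact: lin.
  have fE : f = fun x => e x + (S g x + S w x).
    have alg (y F' dF S' p1 p2 p3 : R[i]) : F' = y - 2 * p1 + p2 -> dF = p1 - 2 * p2 + p3 ->
      S' = 3 * p2 - 2 * p3 -> y = F' + 2 * dF + S' by move=> -> -> ->; ring.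
    apply/funext => x.
    apply: etrans (congr1 (fun t => e x + t) (congr1 (@^~ x) Ssub)).
    exact: (alg _ _ _ _ _ _ _ (congr1 (@^~ x) FE) (congr1 (@^~ x) dFE) (congr1 (@^~ x) SE)).
  (* S w is a polynomial of degree at most 2 N1 = N2, left unchanged by the low-pass at N2: this is
     why N2 is twice N1. *)
  have hpw : hp (S w) = fun=> 0.
    have [m Sm] : exists m, S w = tmul N2 m f.
      have [m1 E1] := dot_tmul h N2 (fun k => (chi (k%:~R / N1%:R : R))%:C) f.
      have wE : w = tmul N2 (fun k => (chi (k%:~R / N1%:R : R))%:C) f.
        by rewrite /w /lowpass (_ : (2 * N1 = N2)%N)// N1E N2E; clear; lia.
      have PE : P w = tmul N2 (fun k => 3 * (chi (k%:~R / N1%:R : R))%:C - 2 * m1 k) f.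
        by apply/funext => x; rewrite tmulB !tmulZ -E1 -wE.
      rewrite /S PE; have [m3' ->] := dot_tmul h N2 (fun k => 3 * (chi (k%:~R / N1%:R : R))%:C - 2 * m1 k) f.
      by have [m4 ->] := dot_tmul h N2 m3' f; exists m4.
    by apply/funext => x; rewrite /hp Sm /lowpass lowpass_trig// subrr.
  have hpE : hp f = fun x => hp e x + hp (S g) x.
    rewrite {1}fE hpD; [|exact: Xe|apply: X_add; exact: XS].
    rewrite hpD; [|exact: XS|exact: XS].
    apply/funext => x; apply: etrans (congr1 (fun t => hp e x + (hp (S g) x + t)) (congr1 (@^~ x) hpw)) _.
    by rewrite addr0.
  rewrite hpE; apply: le_trans (@norm_add _ X _ _ (Xhp e Xe) (Xhp (S g) (XS g Xg))) _; apply: lerD.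
    apply: le_trans (nhp _ Xe) _; rewrite /C1 -mulrA ler_wpM2l//; first lra.
    apply: le_trans (norm_add XF (bl_scale 2 XdF)) _.
    rewrite (norm_scale 2 XdF) m2; have := (HD h F XF h0).2; lra.
  apply: le_trans (HJ h N2 (P g) (S g) h0 N20 (XP _ Xg) erefl) _.
  have hs : Q <= Num.sqrt (N2%:R * h).
    rewrite -[leLHS](ger0_norm Q0) -sqrtr_sqr.
    apply: ler_wsqrtr; apply: le_trans (ltW bQ) _.
    rewrite N2E /h !natrM le_eqVlt; apply/orP; left; apply/eqP.
    by field; rewrite lt0r_neq0.
  have s0 : 0 < Num.sqrt (N2%:R * h) by rewrite sqrtr_gt0 mulr_gt0// ltr0n.
  have g0 := norm_ge0 Xg.
  apply: le_trans (ler_wpM2l _ (nP g Xg)) _; first by rewrite divr_ge0// ltW.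
  rewrite mulrA ler_wpM2r// mulrAC ler_pdivrMr//.
  by apply: le_trans (ler_wpM2l _ hs); rewrite ?invr_ge0// /Q; lra.
have F0 := norm_ge0 XF; have g0 := norm_ge0 Xg.
suff : bl_norm X (hp f) <= (2 * C1 + C2) * `‖F‖ by [].
lra.
Qed.

End Descent.

(** * Two-sided estimates *)

Section Transfer.
Variables (R : realType) (X : banachLattice R).
Implicit Types (f g u v : R -> R[i]) (c h s x y : R) (L n N Z B r : nat) (k : int).
Local Notation "`‖ f ‖" := (bl_norm X f) (format "`‖ f ‖").
Local Notation dn := (discrete_norm X).
Hypothesis HA : assumptionA X.

Definition stdiff h f : R -> R[i] := fun x => f x - steklov h f x.

Lemma X_stdiff h f : X f -> 0 < h -> X (stdiff h f).
Proof. by move=> Xf h0; apply: X_sub => //; exact: X_steklov. Qed.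

Lemma X_iter_stdiff h r f : X f -> 0 < h -> X (iter r (stdiff h) f).
Proof. by move=> Xf h0; elim: r => //= r ih; exact: X_stdiff. Qed.

Lemma stdiffB h f g : X f -> X g ->
  stdiff h (fun x => f x - g x) = fun x => stdiff h f x - stdiff h g x.
Proof.
move=> Xf Xg; apply/funext => x; rewrite /stdiff steklovB; [ring|exact: (X_ploc Xf).1|exact: (X_ploc Xg).1].
Qed.

Lemma iter_stdiffB h r f g : X f -> X g -> 0 < h -> iter r (stdiff h) (fun x => f x - g x) =
  fun x => iter r (stdiff h) f x - iter r (stdiff h) g x.
Proof.
move=> Xf Xg h0; elim: r => //= r ->.
by apply: stdiffB; exact: X_iter_stdiff.
Qed.

Lemma stdiff_bounded : exists2 C, 0 <= C & forall h f, X f -> 0 < h ->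
  bl_norm X (stdiff h f) <= C * `‖f‖.
Proof.
have [M M1 HM] := steklov_bounded HA; exists (1 + M) => [|h f Xf h0]; first by lra.
apply: le_trans (norm_sub Xf (X_steklov HA Xf h0)) _.
by rewrite mulrDl mul1r lerD2l; exact: HM.
Qed.

(** The semi-norm of f does not control that of an average of f; the sum of semi-norm and norm is
    stable, so the induction runs on this sum. *)
Lemma discrete_iter a r : 0 < a -> exists2 C, 0 <= C & forall n f, (0 < n)%N -> X f ->
  dn n (iter r (stdiff (a / n%:R)) f) <= C * (dn n f + `‖f‖).
Proof.
move=> a0; have [M M0 HM] := stdiff_bounded; have [K K0 HK] := discrete_steklov HA a0.
exists ((1 + K + M) ^+ r) => [|n f n0 Xf]; first by rewrite exprn_ge0//; lra.
have h0 : 0 < a / n%:R by rewrite divr_gt0// ltr0n.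
suff : dn n (iter r (stdiff (a / n%:R)) f) + bl_norm X (iter r (stdiff (a / n%:R)) f) <=
    (1 + K + M) ^+ r * (dn n f + `‖f‖).
  by have := norm_ge0 (X_iter_stdiff r Xf h0); lra.
elim: r => [|r ih]; first by rewrite expr0 mul1r.
have Xi := X_iter_stdiff r Xf h0; rewrite iterS exprS -mulrA.
have k0 : 0 <= 1 + K + M by lra.
apply: le_trans (ler_wpM2l k0 ih).
move: (iter r (stdiff (a / n%:R)) f) Xi => g Xg.
have h1 := discrete_sub X n g (steklov (a / n%:R) g); have h2 := HK n g n0 Xg.
have h3 := HM _ g Xg h0; have g0 := norm_ge0 Xg; have d0 := discrete_ge0 X n g.
have p1 := mulr_ge0 K0 d0; have p2 := mulr_ge0 M0 d0.
rewrite {1}/stdiff; lra.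
Qed.

(** Peel off f = (I - A_h) f + A_h f: the semi-norm of the second part is bounded by the norm of
    f. *)
Lemma discrete_unroll a r : 0 < a -> exists2 C, 0 <= C & forall n f, (0 < n)%N -> X f ->
  dn n f <= dn n (iter r (stdiff (a / n%:R)) f) + C * `‖f‖.
Proof.
move=> a0; have [M M0 HM] := stdiff_bounded; have [K K0 HK] := discrete_steklov HA a0.
elim: r => [|r [C C0 HC]]; first by exists 0 => // n f _ _; rewrite mul0r addr0.
exists (C * M + K) => [|n f n0 Xf]; first by rewrite addr_ge0 ?mulr_ge0.
have h0 : 0 < a / n%:R by rewrite divr_gt0// ltr0n.
rewrite iterSr; have Xs := X_stdiff Xf h0.
have h1 := discrete_add X n (stdiff (a / n%:R) f) (steklov (a / n%:R) f).
have e1 : (fun x => stdiff (a / n%:R) f x + steklov (a / n%:R) f x) = f.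
  by apply/funext => x; rewrite /stdiff subrK.
rewrite e1 in h1; have h2 := HK n f n0 Xf; have h3 := HC n _ n0 Xs.
have h4 := ler_wpM2l C0 (HM _ f Xf h0).
rewrite mulrA in h4; lra.
Qed.

Lemma tmul_stdiff h L m f : stdiff h (tmul L m f) = tmul L (fun k => m k - smult h k * m k) f.
Proof. by apply/funext => x; rewrite /stdiff steklov_tmul tmulB. Qed.

(** Vanishing beyond degree n may come from the symbol [G], as in the upper estimates, or from the
    spectrum of [F], as in the lower ones. *)
Lemma tmul_le (G : R -> R[i]) : BM X G -> exists2 C, 0 <= C & forall n m f F, (0 < n)%N -> X F ->
  (forall k, (`|k| <= n)%N -> m k * fourier_coef f k = G (k%:~R / n%:R) * fourier_coef F k) ->
  (forall k, (n < `|k|)%N -> G (k%:~R / n%:R) * fourier_coef F k = 0) ->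
  bl_norm X (tmul n m f) <= C * `‖F‖.
Proof.
move=> [Z [C [_ C0 HC]]]; exists C => // n m f F n0 XF mG G0.
have -> : tmul n m f = tmul (Z * n + n) (fun k => G (k%:~R / n%:R)) F.
  rewrite (eq_tmul mG); apply/funext => x; rewrite /tmul; apply/esym/isum_widen; first exact: leq_addl.
  by move=> k kn; rewrite G0// mul0r.
by apply: HC => //; exact: leq_addr.
Qed.

(** The factor 8 keeps frequencies below n / 4, away from the edge |xi| = 1 of the windows, and
    leaves room for the wider cutoff chi(4 x). *)
Definition trunc n f := tmul n (fun k => (chi (8 * (k%:~R / n%:R)) : R)%:C) f.

Lemma chi8_window : window 1 (fun x : R => chi (8 * x)).
Proof. by move=> x x1; rewrite chi0// normrM gtr0_norm//; lra. Qed.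

(** The low-pass of [descent] has degree of order B n; the frequencies between its cutoff and that
    of [trunc] form a band, recovered by [band_bounded]. *)
Lemma trunc_close a : 0 < a -> exists2 C, 0 <= C & forall n f, (0 < n)%N -> X f ->
  bl_norm X (fun x => f x - trunc n f x) <=
    C * bl_norm X (dotdiff (a / n%:R) (dotdiff (a / n%:R) f)).
Proof.
move=> a0; have [B [C [B0 C0 HC]]] := descent HA a0.
have Bp : 0 < B%:R :> R by rewrite ltr0n.
have c1 : 0 < (B%:R : R)^-1 by rewrite invr_gt0.
have c8 : 0 < 8 :> R by lra.
have z1 : 2 / (B%:R : R)^-1 <= (2 * B)%:R by rewrite invrK natrM.
have z2 : 2 / (8 : R) <= (2 * B)%:R.
  have : 1 <= (2 * B)%:R :> R by rewrite ler1n; move: B0; clear; lia.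
  lra.
have [C2 C20 HC2] := band_bounded HA a0 c1 c8 z1 z2.
exists (C + C2) => [|n f n0 Xf]; first exact: addr_ge0.
have Ed : (fun x => lowpass (B * n) f x - trunc n f x) = tmul (2 * B * n)
    (fun k => (chi (B%:R^-1 * (k%:~R / n%:R)) - chi (8 * (k%:~R / n%:R)) : R)%:C) f.
  apply/funext => x.
  rewrite [RHS](_ : _ = tmul (2 * B * n) (fun k => (chi (B%:R^-1 * (k%:~R / n%:R)) : R)%:C -
      (chi (8 * (k%:~R / n%:R)) : R)%:C) f x); last by apply: eq_isum => k _; rewrite CB.
  rewrite tmulB; congr (_ - _).
    rewrite /lowpass mulnA; congr (tmul _ _ _ _); apply/funext => k; rewrite natrM.
    by congr ((chi _)%:C); field; rewrite !lt0r_neq0// ltr0n.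
  rewrite /trunc (@tmul_widen _ n (2 * B * n))//.
    by rewrite leq_pmull// muln_gt0.
  move=> k kn; have := window_scaled n0 chi8_window; rewrite mul1n => /(_ k kn) -> //.
have E : (fun x => f x - trunc n f x) =
    fun x => (f x - lowpass (B * n) f x) + (lowpass (B * n) f x - trunc n f x).
  by apply/funext => x; rewrite addrA subrK.
rewrite E.
apply: le_trans (norm_add (X_sub Xf (X_lowpass _ _ _)) (X_sub (X_lowpass _ _ _) (X_tmul _ _ _ _))) _.
by rewrite Ed mulrDl lerD ?HC// HC2.
Qed.

Variable psi : R -> R.
Hypotheses (bpsi : BM X (fun x => (psi x)%:C)) (wpsi : window 1 psi).
Local Notation Q := (quasi_interp psi).

Lemma quasi_trig n f : Q n f = tmul n (fun=> 1) (Q n f).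
Proof.
apply/funext => x; rewrite {1}(_ : Q n f = (fun x => isum n (fun k => (psi (k%:~R / n%:R))%:C *
    dcoef n (fun j => f (node R n j)) k * cexpi (k%:~R * x)))); last first.
  by apply/funext => y; rewrite quasi_interpE.
apply: eq_isum => k kn; congr (_ * _).
rewrite (_ : Q n f = (fun x => isum n (fun k => (psi (k%:~R / n%:R))%:C *
    dcoef n (fun j => f (node R n j)) k * cexpi (k%:~R * x)))); last first.
  by apply/funext => y; rewrite quasi_interpE.
by rewrite (fourier_coef_isum n (fun k => (psi (k%:~R / n%:R))%:C * dcoef n (fun j => f (node R n j)) k)) kn mul1r.
Qed.

Lemma X_quasi n f : X (Q n f).
Proof. by rewrite quasi_trig; exact: X_tmul. Qed.

Lemma quasi_residual n m f : (fun x => tmul n m f x - Q n (tmul n m f) x) =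
  tmul n (fun k => m k - (psi (k%:~R / n%:R))%:C * m k) f.
Proof. by apply/funext => x; rewrite tmulB quasi_interp_tmul. Qed.

(** [Nf] stands for the norm on the right-hand side, so that both windows are treated at once. The
    hypotheses dispose of T = trunc n f and of the norm of e = f - T; then [discrete_unroll] bounds
    the semi-norm of e, and [quasi_bounded] bounds Q e. *)
Lemma upper_estimate a r (Nf : nat -> (R -> R[i]) -> R) (C1 : R) : 0 < a -> (0 < r)%N -> 0 <= C1 ->
  (forall n f, (0 < n)%N -> X f -> 0 <= Nf n f) ->
  (forall n f, (0 < n)%N -> X f -> [/\ bl_norm X (fun x => f x - trunc n f x) <= C1 * Nf n f,
     bl_norm X (stdiff (a / n%:R) (trunc n f)) <= C1 * Nf n f &
     bl_norm X (fun x => trunc n f x - Q n (trunc n f) x) <= C1 * Nf n f]) ->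
  exists2 C, 0 <= C & forall n f, (0 < n)%N -> X f ->
    bl_norm X (fun x => f x - Q n f x) + dn n (fun x => f x - Q n f x) <=
    C * (Nf n f + dn n (iter r (stdiff (a / n%:R)) f)).
Proof.
case: r => // r a0 _ C10 N0 H; have [Cu Cu0 Hu] := discrete_unroll r.+1 a0.
have [Ci Ci0 Hi] := discrete_iter r a0; have [Cd Cd0 Hd] := discrete_tmul HA.
have [Cq Cq0 Hq] := quasi_bounded HA bpsi wpsi.
pose K1 := 1 + Ci * (Cd + 1) * C1 + Cu * C1.
pose K2 := K1 + (Cd + 1) * C1 + C1 + (Cd + 1) * Cq * K1.
have p1 : 0 <= Ci * (Cd + 1) * C1 by rewrite !mulr_ge0//; lra.
have p2 : 0 <= Cu * C1 by rewrite mulr_ge0.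
have K10 : 0 <= K1 by rewrite /K1; lra.
have p3 : 0 <= (Cd + 1) * C1 by rewrite mulr_ge0//; lra.
have p4 : 0 <= (Cd + 1) * Cq * K1 by rewrite !mulr_ge0//; lra.
exists K2 => [|n f n0 Xf]; first by rewrite /K2; lra.
have h0 : 0 < a / n%:R by rewrite divr_gt0// ltr0n.
have [] := H n f n0 Xf; set T := trunc n f; set h := a / n%:R in h0 *.
move=> H1 H2 H3; have Y0 := N0 n f n0 Xf; set Y := Nf n f in H1 H2 H3 Y0 *; set W := dn n (iter r.+1 (stdiff h) f).
have XT : X T by exact: X_tmul.
pose e x := f x - T x; have Xe : X e by exact: X_sub.
have W0 : 0 <= W by exact: discrete_ge0.
have Xr : X (fun x => T x - Q n T x) by apply: X_sub => //; exact: X_quasi.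
(* One factor I - A_h is spent on T, where its norm is controlled by [Nf]; the remaining ones are
   merely bounded. *)
have e1 : dn n (iter r.+1 (stdiff h) e) <= W + Ci * (Cd + 1) * C1 * Y.
  rewrite (iter_stdiffB _ Xf XT h0); apply: le_trans (discrete_sub _ _ _ _) _.
  rewrite lerD2l iterSr; have Xs := X_stdiff XT h0.
  apply: le_trans (Hi n _ n0 Xs) _; rewrite -!mulrA ler_wpM2l//.
  have d1 : dn n (stdiff h T) <= Cd * bl_norm X (stdiff h T).
    by rewrite /T /trunc tmul_stdiff; exact: Hd.
  have cd1 : 0 <= Cd + 1 by lra.
  have := ler_wpM2l cd1 H2; lra.
have e2 : dn n e <= K1 * (Y + W).
  have u1 := Hu n e n0 Xe; have u2 := ler_wpM2l Cu0 H1.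
  rewrite -/h -/e in u1 u2.
  have q1 : 0 <= Ci * (Cd + 1) * C1 * W by rewrite mulr_ge0.
  have q2 : 0 <= Cu * C1 * W by rewrite mulr_ge0.
  apply: le_trans u1 _; apply: le_trans (lerD e1 u2) _.
  by rewrite /K1; lra.
have e3 : bl_norm X (Q n e) <= Cq * (K1 * (Y + W)).
  by apply: le_trans (Hq n e n0) _; rewrite ler_wpM2l.
have e4 : dn n (Q n e) <= Cd * (Cq * (K1 * (Y + W))).
  by rewrite {1}quasi_trig; apply: le_trans (Hd _ _ _ n0) _; rewrite -quasi_trig ler_wpM2l.
have e5 : dn n (fun x => T x - Q n T x) <= Cd * (C1 * Y).
  apply: (@le_trans _ _ (Cd * bl_norm X (fun x => T x - Q n T x))); last by rewrite ler_wpM2l.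
  by rewrite /T /trunc quasi_residual; exact: Hd.
have E : (fun x => f x - Q n f x) = fun x => e x + (T x - Q n T x) - Q n e x.
  apply/funext => x.
  rewrite (_ : Q n e x = Q n f x - Q n T x); last exact: quasi_interp_funB.
  by rewrite /e; ring.
have XE : X (fun x => e x + (T x - Q n T x)) by exact: X_add.
rewrite E.
have b1 := norm_sub XE (X_quasi n e); have b2 := norm_add Xe Xr.
have b3 := discrete_sub X n (fun x => e x + (T x - Q n T x)) (Q n e).
have b4 := discrete_add X n e (fun x => T x - Q n T x).
have q3 : 0 <= C1 * W by rewrite mulr_ge0.
have q4 : 0 <= (Cd + 1) * C1 * W by rewrite mulr_ge0.
have s1 := le_trans b1 (lerD b2 (lexx _)).
have s2 := le_trans b3 (lerD b4 (lexx _)).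
have s3 := le_trans s1 (lerD (lerD H1 H3) e3).
have s4 := le_trans s2 (lerD (lerD e2 e5) e4).
apply: le_trans (lerD s3 s4) _.
rewrite /K2; lra.
Qed.

(** Split f = e + Q f with e = f - Q f. Everything about the polynomial Q f is bounded by (I - Q) Q
    f, which by linearity is Q e, hence by the semi-norm of e. *)
Lemma lower_estimate a r (Nf : nat -> (R -> R[i]) -> R) (C1 : R) : 0 < a -> (0 < r)%N -> 0 <= C1 ->
  (forall n f, (0 < n)%N -> X f ->
     Nf n f <= C1 * (bl_norm X (fun x => f x - Q n f x) + bl_norm X (fun x => Q n f x - Q n (Q n f) x))) ->
  (forall n f, (0 < n)%N -> X f -> bl_norm X (stdiff (a / n%:R) (Q n f)) <=
     C1 * bl_norm X (fun x => Q n f x - Q n (Q n f) x)) ->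
  exists2 C, 0 <= C & forall n f, (0 < n)%N -> X f ->
    Nf n f + dn n (iter r (stdiff (a / n%:R)) f) <=
    C * (bl_norm X (fun x => f x - Q n f x) + dn n (fun x => f x - Q n f x)).
Proof.
case: r => // r a0 _ C10 H1 H2; have [Cj Cj0 Hj] := discrete_iter r.+1 a0.
have [Ci Ci0 Hi] := discrete_iter r a0; have [Cd Cd0 Hd] := discrete_tmul HA.
have [Cq Cq0 Hq] := quasi_bounded HA bpsi wpsi.
pose K := Ci * (Cd + 1) * C1 * Cq.
have K0 : 0 <= K by rewrite /K !mulr_ge0//; lra.
have p1 : 0 <= C1 * Cq by rewrite mulr_ge0.
exists (C1 + C1 * Cq + Cj + K) => [|n f n0 Xf]; first lra.
have h0 : 0 < a / n%:R by rewrite divr_gt0// ltr0n.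
have H1' := H1 n f n0 Xf; have H2' := H2 n f n0 Xf.
set h := a / n%:R in h0 H2' *; have XQ := X_quasi n f.
pose e x := f x - Q n f x; have Xe : X e by exact: X_sub.
set V := bl_norm X (fun x => Q n f x - Q n (Q n f) x) in H1' H2' *.
set Y := bl_norm X (fun x => f x - Q n f x) in H1' *.
set W := dn n (fun x => f x - Q n f x).
have Y0 : 0 <= Y by exact: norm_ge0 Xe.
have W0 : 0 <= W by exact: discrete_ge0.
have VW : V <= Cq * W.
  apply: le_trans (Hq n e n0); rewrite le_eqVlt; apply/orP; left; apply/eqP.
  congr bl_norm; apply/funext => x; apply/esym; exact: quasi_interp_funB.
have E : iter r.+1 (stdiff h) f =
    fun x => iter r.+1 (stdiff h) e x + iter r.+1 (stdiff h) (Q n f) x.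
  by rewrite (iter_stdiffB _ Xf XQ h0); apply/funext => x; rewrite subrK.
have e1 : dn n (iter r.+1 (stdiff h) e) <= Cj * (W + Y) by exact: Hj.
have e2 : dn n (iter r.+1 (stdiff h) (Q n f)) <= K * W.
  rewrite iterSr; have Xs := X_stdiff XQ h0.
  apply: le_trans (Hi n _ n0 Xs) _; rewrite /K -!mulrA ler_wpM2l//.
  have d1 : dn n (stdiff h (Q n f)) <= Cd * bl_norm X (stdiff h (Q n f)).
    by rewrite quasi_trig tmul_stdiff; exact: Hd.
  have cd1 : 0 <= Cd + 1 by lra.
  have := ler_wpM2l cd1 (le_trans H2' (ler_wpM2l C10 VW)); lra.
have b1 : dn n (iter r.+1 (stdiff h) f) <= Cj * (W + Y) + K * W.
  by rewrite E; apply: le_trans (discrete_add _ _ _ _) _; exact: lerD.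
have b2 : C1 * V <= C1 * (Cq * W) by rewrite ler_wpM2l.
have q1 : 0 <= C1 * Cq * Y by rewrite mulr_ge0.
have q2 : 0 <= K * Y by rewrite mulr_ge0.
have q3 : 0 <= C1 * W by rewrite mulr_ge0.
have q4 : Nf n f <= C1 * Y + C1 * (Cq * W) by apply: le_trans H1' _; rewrite mulrDr lerD2l.
clear -q4 b1 q1 q2 q3; move: q4 b1 q1 q2 q3; move: (Nf n f) (dn n _) => u v q4 b1 q1 q2 q3; lra.
Qed.

End Transfer.

(** * Estimates for the Riesz and Fejer windows *)

Lemma combine_bounds (R : realDomainType) (A B C y v : R) :
  0 <= A -> 0 <= B -> 0 <= C -> 0 <= y -> 0 <= v -> A * y + B * v <= (A + B + C) * (y + v).
Proof.
move=> A0 B0 C0 y0 v0; apply: (@le_trans _ _ (A * (y + v) + B * (y + v))).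
  by rewrite lerD// ler_wpM2l// ?lerDl ?lerDr.
by rewrite -mulrDl ler_wpM2r ?addr_ge0// lerDl.
Qed.

Section Windows.
Variables (R : realType) (X : banachLattice R).
Implicit Types (f g u v : R -> R[i]) (c h s x y : R) (L n N Z B r p : nat) (k : int).
Local Notation "`‖ f ‖" := (bl_norm X f) (format "`‖ f ‖").
Hypothesis HA : assumptionA X.

Lemma CN c : (- c)%:C = - c%:C :> R[i]. Proof. exact: rmorphN. Qed.

Lemma BM_pow (G : R -> R[i]) p : BM X G -> BM X (fun x => G x ^+ p.+1).
Proof.
move=> hG; elim: p => [|p ih]; first by apply: BM_ext hG => x; rewrite expr1.
by apply: BM_ext (BMM hG ih) => x; rewrite -exprS.
Qed.

Lemma riesz_window a : 0 < a -> window 1 (@riesz R a).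
Proof.
move=> a0 x x1; rewrite riesz_pospow pospow_le0E ?lt0r_neq0//.
by rewrite subr_le0 -[leRHS]real_normK ?num_real// exprn_ege1// ltW.
Qed.

Lemma fejer_window : window 1 (@fejer R).
Proof. by move=> x x1; rewrite /fejer; apply/max_idPr; rewrite subr_le0 ltW. Qed.

(** Dividing the exponent by an integer above a gives a concave window; the original one is its
    power. *)
Lemma BM_riesz a : 0 < a -> BM X (fun x => (riesz a x)%:C).
Proof.
move=> a0; pose p := Num.bound a.
have ap : a < p.+1%:R.
  apply: lt_le_trans (archi_boundP (ltW a0)) _.
  by rewrite ler_nat.
have h : 0 < a / p.+1%:R <= 1.
  by rewrite divr_gt0//= ler_pdivrMr// mul1r ltW.
apply: BM_ext (BM_pow p (BM_concave HA h (concave_window_riesz h))) => x.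
by rewrite -rmorphXn /= -riesz_power.
Qed.

Lemma BM_fejer : BM X (fun x => (fejer x)%:C).
Proof.
apply: (@BM_concave _ _ HA _ 1 1); [by rewrite ltr01 lexx|exact: concave_window_fejer].
Qed.

(** The factor [G] stays in front because the term j = 0, the constant 1, has no compact window. *)
Lemma BM_sum_pow (G H : R -> R[i]) p : BM X G -> BM X H ->
  BM X (fun x => G x * \sum_(j < p) H x ^+ j).
Proof.
move=> hG hH; elim: p => [|p ih].
  by apply: BM_ext (BMZ 0 hG) => x; rewrite big_ord0 mulr0 mul0r.
have hp : BM X (fun x => G x * H x ^+ p).
  elim: {ih} p => [|p ih]; first by apply: BM_ext hG => x; rewrite mulr1.
  by apply: BM_ext (BMM hH ih) => x; rewrite exprS mulrCA.
by apply: BM_ext (BMD ih hp) => x; rewrite big_ord_recr /= mulrDr.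
Qed.

Lemma chi_scaled1 n k : (0 < n)%N -> (`|k| <= n)%N -> chi (1 * (k%:~R / n%:R)) = 1 :> R.
Proof.
move=> n0 kn; have np : 0 < n%:R :> R by rewrite ltr0n.
rewrite mul1r chi1// normrM normfV (gtr0_norm np) ler_pdivrMr// mul1r -intr_norm.
by rewrite -[n%:R]/((n%:Z)%:~R) ler_int.
Qed.

Lemma real_neq0 c : c != 0 -> c%:C != 0 :> R[i].
Proof. by move=> c0; apply/eqP => /(congr1 (@complex.Re R)) /= /eqP; rewrite (negbTE c0). Qed.

Lemma fejer_sgz n k : (0 < n)%N -> (`|k| <= n)%N ->
  fejer (k%:~R / n%:R) = 1 - (sgz k)%:~R * (k%:~R / n%:R) :> R.
Proof.
move=> n0 kn; have np : 0 < n%:R :> R by rewrite ltr0n.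
have xE : `|k%:~R / n%:R| = (sgz k)%:~R * (k%:~R / n%:R) :> R.
  by rewrite normrM normfV (gtr0_norm np) mulrA -intrM -intr_norm; congr (_%:~R / _); lia.
rewrite /fejer -xE; apply/max_idPl; rewrite subr_ge0.
rewrite normrM normfV (gtr0_norm np) ler_pdivrMr// mul1r -intr_norm.
by rewrite -[n%:R]/((n%:Z)%:~R) ler_int.
Qed.

Lemma dot_tmulE h L m f : 0 < h ->
  steklov_dot h (tmul L m f) = tmul L (fun k => dotm (h * k%:~R) * m k) f.
Proof.
move=> h0; apply/funext => x; rewrite /steklov_dot steklov_tmul; apply: eq_isum => k _.
rewrite smult_sinc// /dotm mulrDr cexpiD (mulrC h k%:~R) -(mulrA k%:~R h).
ring.
Qed.

Lemma dotdiff_tmul h L m f : 0 < h ->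
  dotdiff h (tmul L m f) = tmul L (fun k => (1 - dotm (h * k%:~R)) * m k) f.
Proof.
move=> h0; apply/funext => x; rewrite /dotdiff dot_tmulE// -tmulB.
by apply: eq_isum => k _; rewrite (mulrBl (m k)) mul1r.
Qed.

Variable a : R.
Hypothesis a0 : 0 < a.

Lemma step_gt0 n : (0 < n)%N -> 0 < a / n%:R.
Proof. by move=> n0; rewrite divr_gt0// ltr0n. Qed.

Lemma smult_residual n k (x := k%:~R / n%:R) : (0 < n)%N ->
  1 - smult (a / n%:R) k = ((x ^+ 2) * (a ^+ 2 / 4 * sinr (a / 2 * x)))%:C.
Proof.
move=> n0; rewrite smult_sinc ?step_gt0//.
have -> : k%:~R * (a / n%:R) / 2 = a / 2 * x by rewrite /x; field; rewrite lt0r_neq0// ltr0n.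
by rewrite -[1 in LHS]/(1%:C) -CB sinrE; congr (_%:C); field.
Qed.

Lemma lcls_sinr_lin c : lcls (fun x => sinr (c * x)).
Proof. exact: (lcls_lin c (@lcls_sinr R)). Qed.

Lemma nest8 (g : R -> R) x : (chi (8 * x) * g x)%:C * (chi (4 * x))%:C = (chi (8 * x) * g x)%:C :> R[i].
Proof. by rewrite -CM mulrAC chi_nest//; lra. Qed.

Lemma BM_cut_bmult (g : R -> R) : BM X (fun x => (chi (8 * x) * g x)%:C) ->
  BM X (fun x => (chi (8 * x) * g x)%:C / bmult (a * x)).
Proof. by move=> hg; apply: (BM_bmultV2 HA a _ hg (nest8 g)); lra. Qed.

Lemma BM_cut_bmult2 (g : R -> R) : BM X (fun x => (chi (8 * x) * g x)%:C) ->
  BM X (fun x => (chi (8 * x) * g x)%:C / bmult (a * x) / bmult (a * x)).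
Proof.
move=> hg; apply: (BM_bmultV2 HA a (c := 4) _ (BM_cut_bmult hg)); first by lra.
by move=> x; rewrite mulrAC nest8.
Qed.

Lemma chi8_out n k : (0 < n)%N -> (n < `|k|)%N -> chi (8 * (k%:~R / n%:R)) = 0 :> R.
Proof. by move=> n0 kn; have := window_scaled n0 (@chi8_window R); rewrite mul1n => ->. Qed.

(** By [dotm_sqr], xi^2 = - (1 - dotm(a xi))^2 / (a bmult(a xi))^2, so a symbol with a factor xi^2
    is bounded by the double difference. *)
Lemma second_order_bound (g : R -> R) : BM X (fun x => (chi (8 * x) * g x)%:C) ->
  exists2 C, 0 <= C & forall n m f, (0 < n)%N -> X f ->
    (forall k, (`|k| <= n)%N -> m k =
       (chi (8 * (k%:~R / n%:R)) * ((k%:~R / n%:R) ^+ 2 * g (k%:~R / n%:R)))%:C) ->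
    bl_norm X (tmul n m f) <= C * bl_norm X (dotdiff (a / n%:R) (dotdiff (a / n%:R) f)).
Proof.
move=> hg; have [C C0 HC] := tmul_le (BMZ (- (a ^- 2))%:C (BM_cut_bmult2 hg)).
exists C => // n m f n0 Xf mE; have h0 := step_gt0 n0.
have XJ := X_dotdiff HA Xf h0; have XF := X_dotdiff HA XJ h0.
apply: HC => // k kn; last first.
  by rewrite chi8_out// !mul0r mulr0 mul0r.
rewrite (fourier_coef_dotdiff HA k XJ h0) (fourier_coef_dotdiff HA k Xf h0) scaleE mE//.
move: (k%:~R / n%:R) => x; move: (fourier_coef f k) => q.
rewrite (mulrA (1 - _) (1 - _)) -expr2 dotm_sqr.
have b0 := bmult_neq0 (a * x); move: (bmult _) b0 => b b0.
have ac := real_neq0 (lt0r_neq0 a0).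
rewrite !expr2 ?invfM !CN !CM !CV.
move: (chi _)%:C (g x)%:C x%:C a%:C ac => c' g' x' a' ac.
by field; rewrite ac b0.
Qed.

Lemma stdiff_trunc_bound : exists2 C, 0 <= C & forall n f, (0 < n)%N -> X f ->
  bl_norm X (stdiff (a / n%:R) (trunc n f)) <=
  C * bl_norm X (dotdiff (a / n%:R) (dotdiff (a / n%:R) f)).
Proof.
have c8 : 0 < 8 :> R by lra.
have hg := BM_cut HA c8 (lclsZ (a ^+ 2 / 4) (lcls_sinr_lin (a / 2))).
have [C C0 HC] := second_order_bound hg; exists C => // n f n0 Xf.
rewrite /trunc tmul_stdiff; apply: HC => // k kn.
rewrite -{1}[(chi _)%:C]mul1r -mulrBl smult_residual// -CM; congr (_%:C).
by rewrite mulrC.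
Qed.

(** On the spectrum of the truncation 1 - rho is xi^2 times the smooth [riesz_quot], whatever the
    exponent. *)
Lemma riesz_upper al r : 0 < al -> (0 < r)%N -> exists2 C, 0 <= C & forall n f, (0 < n)%N -> X f ->
  bl_norm X (fun x => f x - quasi_interp (riesz al) n f x)
    + discrete_norm X n (fun x => f x - quasi_interp (riesz al) n f x) <=
  C * (bl_norm X (dotdiff (a / n%:R) (dotdiff (a / n%:R) f))
    + discrete_norm X n (iter r (stdiff (a / n%:R)) f)).
Proof.
move=> al0 r0; have [C1 C10 H1] := trunc_close HA a0; have [C2 C20 H2] := stdiff_trunc_bound.
have c8 : 0 < 8 :> R by lra.
have z8 : 2 / 8 < 3 / 4 :> R by lra.
have hg := BM_cut_on HA c8 z8 (@cls_riesz_quot_far R al).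
have [C3 C30 H3] := second_order_bound hg.
apply: (@upper_estimate _ _ HA _ (BM_riesz al0) (riesz_window al0) a r
  (fun n f => bl_norm X (dotdiff (a / n%:R) (dotdiff (a / n%:R) f))) (C1 + C2 + C3)) => //.
- by rewrite !addr_ge0.
- move=> n f n0 Xf; apply: norm_ge0; apply: (X_dotdiff HA _ (step_gt0 n0)).
  exact: (X_dotdiff HA Xf (step_gt0 n0)).
move=> n f n0 Xf; have h0 := step_gt0 n0.
have F0 := norm_ge0 (X_dotdiff HA (X_dotdiff HA Xf h0) h0).
split.
- by apply: le_trans (H1 n f n0 Xf) (ler_wpM2r F0 _); rewrite -addrA lerDl addr_ge0.
- by apply: le_trans (H2 n f n0 Xf) (ler_wpM2r F0 _); rewrite addrAC lerDr addr_ge0.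
have -> : (fun x => trunc n f x - quasi_interp (riesz al) n (trunc n f) x) =
   tmul n (fun k => (chi (8 * (k%:~R / n%:R)))%:C - (riesz al (k%:~R / n%:R))%:C * (chi (8 * (k%:~R / n%:R)))%:C) f.
  exact: quasi_residual.
apply: le_trans (H3 n _ f n0 Xf _) (ler_wpM2r F0 _); last by rewrite lerDr addr_ge0.
move=> k kn; rewrite -CM -CB; congr (_%:C).
by rewrite -riesz_quotE -riesz_pospow; ring.
Qed.

(** The Hilbert transform of the forward difference of f has symbol (-i sgn)(-i a xi b) = - a |xi|
    b, so 1 - phi = |xi| is recovered on the truncation by the multiplier -1 / (a b). Double
    differences are bounded by single ones. *)
Lemma fejer_upper r : hilbert_bounded X -> (0 < r)%N -> exists2 C, 0 <= C & forall n f, (0 < n)%N -> X f ->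
  bl_norm X (fun x => f x - quasi_interp (@fejer R) n f x)
    + discrete_norm X n (fun x => f x - quasi_interp (@fejer R) n f x) <=
  C * (bl_norm X (dotdiff (a / n%:R) f)
    + discrete_norm X n (iter r (stdiff (a / n%:R)) f)).
Proof.
move=> [M HM] r0; have [C1 C10 H1] := trunc_close HA a0; have [C2 C20 H2] := stdiff_trunc_bound.
have [D D0 HD] := dotdiff_bounded HA.
have c8 : 0 < 8 :> R by lra.
have hG := BMZ (- a^-1)%:C (BM_cut_bmult (BM_cut HA c8 (lclsT (cls_cst setT 1)))).
have [C3 C30 H3] := tmul_le hG.
apply: (@upper_estimate _ _ HA _ BM_fejer fejer_window a r
  (fun n f => bl_norm X (dotdiff (a / n%:R) f)) ((C1 + C2) * D + C3 * `|M|)) => //.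
- by rewrite addr_ge0 ?mulr_ge0 ?addr_ge0.
- by move=> n f n0 Xf; apply: norm_ge0; exact: (X_dotdiff HA Xf (step_gt0 n0)).
move=> n f n0 Xf; have h0 := step_gt0 n0.
have XJ := X_dotdiff HA Xf h0; have J0 := norm_ge0 XJ; have FJ := HD _ _ XJ h0.
set J := bl_norm X (dotdiff (a / n%:R) f) in J0 FJ *.
have i1 := le_trans (H1 n f n0 Xf) (ler_wpM2l C10 FJ).
have i2 := le_trans (H2 n f n0 Xf) (ler_wpM2l C20 FJ).
have p1 : 0 <= C1 * (D * J) by rewrite !mulr_ge0.
have p2 : 0 <= C2 * (D * J) by rewrite !mulr_ge0.
have p3 : 0 <= C3 * (`|M| * J) by rewrite !mulr_ge0.
split; [lra|lra|].
have [g [Xg [_ _ gE] ng]] := HM _ XJ.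
have ng' : `‖g‖ <= `|M| * J by apply: le_trans ng _; rewrite ler_wpM2r// ler_norm.
have -> : (fun x => trunc n f x - quasi_interp (@fejer R) n (trunc n f) x) =
   tmul n (fun k => (chi (8 * (k%:~R / n%:R)))%:C - (fejer (k%:~R / n%:R))%:C * (chi (8 * (k%:~R / n%:R)))%:C) f.
  exact: quasi_residual.
apply: le_trans (H3 n _ f g n0 Xg _ _) _; last first.
- by apply: le_trans (ler_wpM2l C30 ng') _; rewrite mulrA ler_wpM2r// lerDr mulr_ge0// addr_ge0.
- by move=> k kn; rewrite chi8_out// !mul0r mulr0 mul0r.
move=> k kn; rewrite gE (fourier_coef_dotdiff HA k Xf h0) scaleE.
rewrite fejer_sgz// dotmE.
move: (fourier_coef f k) => q.
have -> : (sgz k)%:~R = ((sgz k)%:~R : R)%:C :> R[i] by rewrite rmorph_int.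
move: (k%:~R / n%:R) ((sgz k)%:~R : R) => x s; move: (chi (8 * x)) => t.
have b0 := bmult_neq0 (a * x); move: (bmult _) b0 => b b0.
have ac := real_neq0 (lt0r_neq0 a0).
have ii : (0 +i* 1) * (0 +i* 1) = -1 :> R[i] by apply: complex_eq; rewrite /= ?ReM ?ImM /=; ring.
rewrite !CB !CN !CM !CV rmorph1.
move: t%:C x%:C s%:C a%:C (0 +i* 1) ac ii => c' x' s' a' i ac ii.
transitivity (- (i * i) * (c' * (s' * x') * q)); first by rewrite ii; ring.
by field; rewrite ac b0.
Qed.

(** Relative to Q f, the function (I - Q) Q f has symbol 1 - rho. A bounded multiplier S with S (1 -
    rho) = xi^2 on [-1, 1] turns it into the two quantities of second order, (I - Adot_h)^2 Q f and
    (I - A_h) Q f. *)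
Lemma riesz_lower al r : 0 < al -> (0 < r)%N -> exists2 C, 0 <= C & forall n f, (0 < n)%N -> X f ->
  bl_norm X (dotdiff (a / n%:R) (dotdiff (a / n%:R) f))
    + discrete_norm X n (iter r (stdiff (a / n%:R)) f) <=
  C * (bl_norm X (fun x => f x - quasi_interp (riesz al) n f x)
    + discrete_norm X n (fun x => f x - quasi_interp (riesz al) n f x)).
Proof.
move=> al0 r0; have [D D0 HD] := dotdiff_bounded HA.
(* p al >= 3 is what [cls_riesz_quot_near] requires, so the quotient for rho^p can be inverted up to
   the edge. *)
pose p := (Num.bound (3 / al)).+1.
have pal : 3 <= p%:R * al.
  have h : 3 / al < (Num.bound (3 / al))%:R by apply: archi_boundP; rewrite divr_ge0// ltW.
  by rewrite -ler_pdivrMr// (le_trans (ltW h))// /p ler_nat.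
have b1 : 1 <= p%:R * al by lra.
have hq : BM X (fun x => (chi (1 * x) * (riesz_quot (p%:R * al) x)^-1)%:C).
  have z1 : 2 / 1 < 3 :> R by lra.
  apply: (BM_cut_on HA ltr01 z1); apply: (@cls_inv _ _ _ 9^-1); first by rewrite invr_gt0.
    by move=> x /= x3; exact: riesz_quot_ge.
  exact: cls_riesz_quot_near.
have hS := BM_sum_pow p hq (BM_riesz al0).
(* xi^2 / (1 - rho^p) times the geometric sum, that is xi^2 / (1 - rho) for xi <> 0 where the cutoff
   is 1. *)
pose S x : R[i] := (chi (1 * x) * (riesz_quot (p%:R * al) x)^-1)%:C * \sum_(j < p) (riesz al x)%:C ^+ j.
have SE n k : (0 < n)%N -> (`|k| <= n)%N ->
    S (k%:~R / n%:R) * (1 - (riesz al (k%:~R / n%:R))%:C) = ((k%:~R / n%:R : R) ^+ 2)%:C.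
  move=> n0 kn; rewrite /S chi_scaled1// mul1r.
  have x1 : `|k%:~R / n%:R| <= 1 :> R.
    have np : 0 < n%:R :> R by rewrite ltr0n.
    rewrite normrM normfV (gtr0_norm np) ler_pdivrMr// mul1r -intr_norm.
    by rewrite -[n%:R]/((n%:Z)%:~R) ler_int.
  move: (k%:~R / n%:R) x1 => x x1.
  have x3 : `|x| <= 3 by lra.
  have q0 : riesz_quot (p%:R * al) x != 0.
    by rewrite lt0r_neq0// (lt_le_trans _ (riesz_quot_ge b1 x3))// invr_gt0.
  have geo : (\sum_(j < p) (riesz al x)%:C ^+ j) * (1 - (riesz al x)%:C) = 1 - (riesz al x)%:C ^+ p.
    by rewrite mulrC -[RHS]opprB subrX1 -mulNr opprB.
  rewrite -mulrA geo.
  rewrite (_ : 1 - (riesz al x)%:C ^+ p = (1 - riesz al x ^+ p)%:C); last by rewrite CB rmorphXn.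
  rewrite -CM; congr (_%:C).
  have -> : riesz al x ^+ p = riesz (p%:R * al) x.
    have p0 : 0 < p%:R :> R by rewrite ltr0n.
    by rewrite (riesz_power (p := p) (mulr_gt0 p0 al0) _ x)// mulrAC divff ?mul1r// lt0r_neq0.
  by rewrite riesz_pospow riesz_quotE mulrC mulfK.
have hb := BM_bmult HA a ltr01.
have [C1 C10 H1] := tmul_le (BMZ (- (a ^+ 2))%:C (BMM hS (BMM hb hb))).
have hs := BM_cut HA ltr01 (lclsZ (a ^+ 2 / 4) (lcls_sinr_lin (a / 2))).
have [C2 C20 H2] := tmul_le (BMM hS hs).
have quasiE n f := quasi_trig (@riesz R al) n f.
have resE n f : (fun x => quasi_interp (riesz al) n f x - quasi_interp (riesz al) n (quasi_interp (riesz al) n f) x) =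
    tmul n (fun k => 1 - (riesz al (k%:~R / n%:R))%:C * 1) (quasi_interp (riesz al) n f).
  by rewrite -quasi_residual -quasiE.
have XE n f : X (fun x => quasi_interp (riesz al) n f x - quasi_interp (riesz al) n (quasi_interp (riesz al) n f) x).
  by rewrite resE; exact: X_tmul.
have coefE n f k : fourier_coef (fun x => quasi_interp (riesz al) n f x -
    quasi_interp (riesz al) n (quasi_interp (riesz al) n f) x) k =
    if (`|k| <= n)%N then (1 - (riesz al (k%:~R / n%:R))%:C) * fourier_coef (quasi_interp (riesz al) n f) k else 0.
  by rewrite resE fourier_coef_tmul mulr1.
apply: (@lower_estimate _ _ HA _ (BM_riesz al0) (riesz_window al0) a r
  (fun n f => bl_norm X (dotdiff (a / n%:R) (dotdiff (a / n%:R) f))) (D * D + C1 + C2)) => //.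
- by rewrite !addr_ge0 ?mulr_ge0.
- move=> n f n0 Xf; have h0 := step_gt0 n0; have XQ := X_quasi X (@riesz R al) n f.
  have Xe := X_sub Xf XQ.
  have Xe1 := X_dotdiff HA Xe h0; have Xe2 := X_dotdiff HA Xe1 h0.
  have XQ1 := X_dotdiff HA XQ h0; have XQ2 := X_dotdiff HA XQ1 h0.
  have E : dotdiff (a / n%:R) (dotdiff (a / n%:R) f) = fun x =>
      dotdiff (a / n%:R) (dotdiff (a / n%:R) (fun x => f x - quasi_interp (riesz al) n f x)) x +
      dotdiff (a / n%:R) (dotdiff (a / n%:R) (quasi_interp (riesz al) n f)) x.
    rewrite (dotdiffB _ Xf XQ) (dotdiffB _ (X_dotdiff HA Xf h0) XQ1).
    by apply/funext => x; rewrite subrK.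
  rewrite E; apply: le_trans (norm_add Xe2 XQ2) _.
  have i1 := le_trans (HD _ _ Xe1 h0) (ler_wpM2l D0 (HD _ _ Xe h0)).
  have dE : dotdiff (a / n%:R) (dotdiff (a / n%:R) (quasi_interp (riesz al) n f)) =
      tmul n (fun k => (1 - dotm (a / n%:R * k%:~R)) * ((1 - dotm (a / n%:R * k%:~R)) * 1))
        (quasi_interp (riesz al) n f).
    by rewrite {1}quasiE !dotdiff_tmul.
  have i2 : bl_norm X (dotdiff (a / n%:R) (dotdiff (a / n%:R) (quasi_interp (riesz al) n f))) <=
      C1 * bl_norm X (fun x => quasi_interp (riesz al) n f x - quasi_interp (riesz al) n (quasi_interp (riesz al) n f) x).
    rewrite dE; apply: H1 => // k kn; rewrite coefE; last by rewrite leqNgt kn mulr0.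
    rewrite kn scaleE !chi_scaled1// mulr1 -expr2 dotm_sqr.
    have := SE n k n0 kn; rewrite /S chi_scaled1//.
    move: (_ * \sum_(j < p) _) (1 - (riesz al _)%:C) => s w sw.
    move: (fourier_coef _ k) (bmult _) => q b.
    rewrite (exprMn _ a) (CM (a ^+ 2)) -sw CN rmorph1; ring.
  have v0 := norm_ge0 (XE n f); have y0 := norm_ge0 Xe.
  rewrite mulrA in i1; apply: le_trans (lerD i1 i2) _.
  exact: combine_bounds (mulr_ge0 D0 D0) C10 C20 y0 v0.
move=> n f n0 Xf; have h0 := step_gt0 n0.
have v0 := norm_ge0 (XE n f).
have sE : stdiff (a / n%:R) (quasi_interp (riesz al) n f) =
    tmul n (fun k => 1 - smult (a / n%:R) k * 1) (quasi_interp (riesz al) n f).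
  by rewrite {1}quasiE tmul_stdiff.
apply: (@le_trans _ _ (C2 * bl_norm X (fun x => quasi_interp (riesz al) n f x -
    quasi_interp (riesz al) n (quasi_interp (riesz al) n f) x))); last first.
  by apply: (ler_wpM2r v0); rewrite lerDr addr_ge0// mulr_ge0.
rewrite sE; apply: H2 => // k kn; rewrite coefE; last by rewrite leqNgt kn mulr0.
rewrite kn mulr1 smult_residual// (CM ((k%:~R / n%:R) ^+ 2)) -(SE n k n0 kn) /S !chi_scaled1//.
move: (\sum_(j < p) _) (fourier_coef _ k) => s q; rewrite !mul1r.
ring.
Qed.

(** The Hilbert transform of (I - Q) Q f has symbol -i sgn(xi) |xi| = -i xi relative to Q f. From
    it, 1 - Adot_h is obtained by the multiplier a b, and 1 - A_h, divisible by xi^2, by the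
    multiplier i xi (a^2 / 4) sinr(a xi / 2). *)
Lemma fejer_lower r : hilbert_bounded X -> (0 < r)%N -> exists2 C, 0 <= C & forall n f, (0 < n)%N -> X f ->
  bl_norm X (dotdiff (a / n%:R) f) + discrete_norm X n (iter r (stdiff (a / n%:R)) f) <=
  C * (bl_norm X (fun x => f x - quasi_interp (@fejer R) n f x)
    + discrete_norm X n (fun x => f x - quasi_interp (@fejer R) n f x)).
Proof.
move=> [M HM] r0; have [D D0 HD] := dotdiff_bounded HA.
have [C1 C10 H1] := tmul_le (BMZ a%:C (BM_bmult HA a ltr01)).
have hs := BM_cut HA ltr01 (lclsZ (a ^+ 2 / 4) (lclsM (@lcls_id R) (lcls_sinr_lin (a / 2)))).
have [C2 C20 H2] := tmul_le (BMZ (0 +i* 1) hs).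
have quasiE n f := quasi_trig (@fejer R) n f.
pose E n f x := quasi_interp (@fejer R) n f x - quasi_interp (@fejer R) n (quasi_interp (@fejer R) n f) x.
have resE n f : E n f =
    tmul n (fun k => 1 - (fejer (k%:~R / n%:R))%:C * 1) (quasi_interp (@fejer R) n f).
  by rewrite -quasi_residual -quasiE.
have XE n f : X (E n f) by rewrite resE; exact: X_tmul.
have hilb n f : (0 < n)%N -> exists g, [/\ X g, `‖g‖ <= `|M| * bl_norm X (E n f),
    forall k, (`|k| <= n)%N -> fourier_coef g k =
      - (0 +i* 1) * ((k%:~R / n%:R : R)%:C * fourier_coef (quasi_interp (@fejer R) n f) k) &
    forall k, (n < `|k|)%N -> fourier_coef g k = 0].
  move=> n0; have [g [Xg [_ _ gE] ng]] := HM _ (XE n f); exists g; split => //.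
  - by apply: le_trans ng _; rewrite ler_wpM2r ?norm_ge0// ler_norm.
  - move=> k kn; rewrite gE resE fourier_coef_tmul kn fejer_sgz// mulr1.
    have key : (sgz k)%:~R * (1 - (1 - (sgz k)%:~R * (k%:~R / n%:R))%:C) = (k%:~R / n%:R : R)%:C.
      rewrite CB rmorph1 subKr (_ : (sgz k)%:~R = ((sgz k)%:~R : R)%:C); last by rewrite rmorph_int.
      rewrite -CM !mulrA -!intrM; congr ((_%:~R / _)%:C).
      by case: (ltrgtP k 0) => [k0|k0|->]; rewrite ?(ltr0_sgz k0) ?(gtr0_sgz k0) ?mulr0//; ring.
    by rewrite -key !mulrA.
  - by move=> k kn; rewrite gE resE fourier_coef_tmul leqNgt kn mulr0.
apply: (@lower_estimate _ _ HA _ BM_fejer fejer_window a r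
  (fun n f => bl_norm X (dotdiff (a / n%:R) f)) (D + C1 * `|M| + C2 * `|M|)) => //.
- by rewrite !addr_ge0 ?mulr_ge0.
- move=> n f n0 Xf; have h0 := step_gt0 n0; have XQ := X_quasi X (@fejer R) n f.
  have Xe := X_sub Xf XQ; have Xe1 := X_dotdiff HA Xe h0; have XQ1 := X_dotdiff HA XQ h0.
  have Ed : dotdiff (a / n%:R) f = fun x =>
      dotdiff (a / n%:R) (fun x => f x - quasi_interp (@fejer R) n f x) x +
      dotdiff (a / n%:R) (quasi_interp (@fejer R) n f) x.
    by rewrite (dotdiffB _ Xf XQ); apply/funext => x; rewrite subrK.
  rewrite Ed; apply: le_trans (norm_add Xe1 XQ1) _.
  have i1 := HD _ _ Xe h0; have [g [Xg ng gk gk0]] := hilb n f n0.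
  have dE : dotdiff (a / n%:R) (quasi_interp (@fejer R) n f) =
      tmul n (fun k => (1 - dotm (a / n%:R * k%:~R)) * 1) (quasi_interp (@fejer R) n f).
    by rewrite {1}quasiE dotdiff_tmul.
  have i2 : bl_norm X (dotdiff (a / n%:R) (quasi_interp (@fejer R) n f)) <= C1 * `‖g‖.
    rewrite dE; apply: H1 => // k kn; last by rewrite gk0// mulr0.
    rewrite gk// scaleE !chi_scaled1// mulr1 dotmE CM.
    move: (fourier_coef _ k) (bmult _) => q b; rewrite mul1r; ring.
  have i3 := le_trans i2 (ler_wpM2l C10 ng).
  have v0 := norm_ge0 (XE n f); have y0 := norm_ge0 Xe.
  rewrite mulrA in i3; apply: le_trans (lerD i1 i3) _.
  exact: combine_bounds D0 (mulr_ge0 C10 (normr_ge0 M)) (mulr_ge0 C20 (normr_ge0 M)) y0 v0.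
move=> n f n0 Xf; have h0 := step_gt0 n0; have [g [Xg ng gk gk0]] := hilb n f n0.
have v0 := norm_ge0 (XE n f).
have sE : stdiff (a / n%:R) (quasi_interp (@fejer R) n f) =
    tmul n (fun k => 1 - smult (a / n%:R) k * 1) (quasi_interp (@fejer R) n f).
  by rewrite {1}quasiE tmul_stdiff.
have i2 : bl_norm X (stdiff (a / n%:R) (quasi_interp (@fejer R) n f)) <= C2 * `‖g‖.
  rewrite sE; apply: H2 => // k kn; last by rewrite gk0// mulr0.
  rewrite gk// !chi_scaled1// mulr1 mul1r smult_residual//.
  have ii : (0 +i* 1) * (0 +i* 1) = -1 :> R[i] by apply: complex_eq; rewrite /= ?ReM ?ImM /=; ring.
  move: (fourier_coef _ k) (k%:~R / n%:R) => q x.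
  rewrite expr2 !CM; move: (0 +i* 1) ii => i ii.
  transitivity (- (i * i) * (x%:C * x%:C * ((a ^+ 2)%:C * (4^-1)%:C * (sinr (a / 2 * x))%:C) * q)).
    by rewrite ii; ring.
  ring.
have i3 := le_trans i2 (ler_wpM2l C20 ng).
rewrite mulrA in i3; apply: le_trans i3 _.
by apply: (ler_wpM2r v0); rewrite lerDr addr_ge0// mulr_ge0.
Qed.

End Windows.

(** Adding 1 makes both constants positive, as the equivalence demands, and permits the inversion of
    D + 1. *)
Lemma two_sided (R : realFieldType) (T : Type) (P : T -> nat -> Prop) (A B : T -> nat -> R) :
  (forall f n, P f n -> 0 <= A f n) -> (forall f n, P f n -> 0 <= B f n) ->
  (exists2 C, 0 <= C & forall f n, P f n -> A f n <= C * B f n) ->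
  (exists2 C, 0 <= C & forall f n, P f n -> B f n <= C * A f n) ->
  exists c C : R, [/\ 0 < c, 0 < C & forall f n, P f n -> c * B f n <= A f n <= C * B f n].
Proof.
move=> A0 B0 [C C0 HC] [D D0 HD]; exists (D + 1)^-1, (C + 1); split.
- by rewrite invr_gt0 ltr_wpDl.
- by rewrite ltr_wpDl.
move=> f n Pf; apply/andP; split.
  rewrite mulrC ler_pdivrMr ?ltr_wpDl// mulrDr mulr1 mulrC.
  by apply: le_trans (HD f n Pf) _; rewrite lerDl A0.
by apply: le_trans (HC f n Pf) _; rewrite mulrDl mul1r lerDl B0.
Qed.

Local Close Scope complex_scope.

Theorem theorem3p8 (R : realType) (alpha gamma : R) (X : banachLattice R)
  (alpha_gt0 : 0 < alpha) (gamma_gt0 : 0 < gamma)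
  (gamma_le : forall n : nat, (0 < n)%N ->
     gamma / n%:R <= 2 * pi / (2 * n + 1)%:R)
  (HA : assumptionA X) :
  (forall r : nat, (0 < r)%N ->
     exists c C : R, [/\ 0 < c, 0 < C &
       forall (f : R -> R[i]) (n : nat), X f -> (0 < n)%N ->
       let lhs := bl_norm X (f \- quasi_interp (riesz alpha) n f)
                  + discrete_norm X n (f \- quasi_interp (riesz alpha) n f) in
       let rhs := bl_norm X (iter 2 (fun g => g \- steklov_dot (gamma / n%:R) g) f)
                  + discrete_norm X n
                      (iter r (fun g => g \- steklov (gamma / n%:R) g) f) in
       c * rhs <= lhs <= C * rhs])
  /\
  (hilbert_bounded X ->
   forall r : nat, (0 < r)%N ->
     exists c C : R, [/\ 0 < c, 0 < C &
       forall (f : R -> R[i]) (n : nat), X f -> (0 < n)%N ->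
       let lhs := bl_norm X (f \- quasi_interp (@fejer R) n f)
                  + discrete_norm X n (f \- quasi_interp (@fejer R) n f) in
       let rhs := bl_norm X (f \- steklov_dot (gamma / n%:R) f)
                  + discrete_norm X n
                      (iter r (fun g => g \- steklov (gamma / n%:R) g) f) in
       c * rhs <= lhs <= C * rhs]).
Proof.
split=> [r r0|HB r r0].
  have ge0 (f : R -> R[i]) n : X f /\ (0 < n)%N ->
      0 <= bl_norm X (dotdiff (gamma / n%:R) (dotdiff (gamma / n%:R) f))
        + discrete_norm X n (iter r (stdiff (gamma / n%:R)) f).
    move=> [Xf n0]; have h0 := step_gt0 gamma_gt0 n0; rewrite addr_ge0 ?discrete_ge0//.
    by apply: norm_ge0; exact: (X_dotdiff HA (X_dotdiff HA Xf h0) h0).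
  have ge0' (f : R -> R[i]) n : X f /\ (0 < n)%N ->
      0 <= bl_norm X (fun x => f x - quasi_interp (riesz alpha) n f x)
        + discrete_norm X n (fun x => f x - quasi_interp (riesz alpha) n f x).
    move=> [Xf n0]; rewrite addr_ge0 ?discrete_ge0//.
    by apply: norm_ge0; apply: X_sub => //; exact: X_quasi.
  have [C1 C10 H1] := riesz_upper HA gamma_gt0 alpha_gt0 r0.
  have [C2 C20 H2] := riesz_lower HA gamma_gt0 alpha_gt0 r0.
  have [||c [C [c0 C0 H]]] := two_sided ge0' ge0.
  - by exists C1 => // f n [Xf n0]; exact: H1.
  - by exists C2 => // f n [Xf n0]; exact: H2.
  by exists c, C; split => // f n Xf n0; exact: (H f n (conj Xf n0)).
have ge0 (f : R -> R[i]) n : X f /\ (0 < n)%N ->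
    0 <= bl_norm X (dotdiff (gamma / n%:R) f)
      + discrete_norm X n (iter r (stdiff (gamma / n%:R)) f).
  move=> [Xf n0]; have h0 := step_gt0 gamma_gt0 n0; rewrite addr_ge0 ?discrete_ge0//.
  by apply: norm_ge0; exact: (X_dotdiff HA Xf h0).
have ge0' (f : R -> R[i]) n : X f /\ (0 < n)%N ->
    0 <= bl_norm X (fun x => f x - quasi_interp (@fejer R) n f x)
      + discrete_norm X n (fun x => f x - quasi_interp (@fejer R) n f x).
  move=> [Xf n0]; rewrite addr_ge0 ?discrete_ge0//.
  by apply: norm_ge0; apply: X_sub => //; exact: X_quasi.
have [C1 C10 H1] := fejer_upper HA gamma_gt0 HB r0.
have [C2 C20 H2] := fejer_lower HA gamma_gt0 HB r0.
have [||c [C [c0 C0 H]]] := two_sided ge0' ge0.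
- by exists C1 => // f n [Xf n0]; exact: H1.
- by exists C2 => // f n [Xf n0]; exact: H2.
by exists c, C; split => // f n Xf n0; exact: (H f n (conj Xf n0)).
Qed.
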